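(* Let $n\geq 7$ be an odd integer and let $d:=\phi(n)$, where $\phi$ is Euler's totient function. Let $\mathbb{Z}_n=\langle C_n\rangle\subset \mathrm{GL}_d(\mathbb{Z})$ be the cyclic group of order $n$ generated by the companion matrix $C_n$ of the $n$th cyclotomic polynomial, and let $\mathbb{Z}^d\rtimes_\alpha\mathbb{Z}_n$ be the semidirect product in which $\mathbb{Z}_n$ acts on $\mathbb{Z}^d$ by matrix multiplication (which is the conjugation action $\alpha$ of $\mathbb{Z}_n$ on $\mathbb{Z}^d$ in the semidirect product). If $2d\geq n+5$, then $$K_1\big(C^*(\mathbb{Z}^d\rtimes_\alpha \mathbb{Z}_n)\big)\neq 0.$$
   Context: The companion matrix of a monic polynomial $p(x)=a_0+a_1x+\cdots+a_{d-1}x^{d-1}+x^d$ is the $d\times d$ matrix $C$ with $Ce_i=e_{i+1}$ for $1\le i\le d-1$ and $Ce_d=-a_0e_1-a_1e_2-\cdots-a_{d-1}e_d$, where $e_1,\dots,e_d$ is the standard basis. $C_n$ denotes the companion matrix of the $n$th cyclotomic polynomial $\Phi_n(x)$, which has degree $d=\phi(n)$; $C_n\in \mathrm{GL}_d(\mathbb{Z})$ has order $n$. The action is $(C_n^k,x)\mapsto C_n^k x$ for $x\in\mathbb{Z}^d$, and the semidirect product has multiplication $(x,A)(y,B)=(x+Ay,AB)$. $C^*(\Gamma)$ denotes the group $C^*$-algebra of the discrete group $\Gamma$, and $K_1$ is topological $K$-theory of $C^*$-algebras. *)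

(* Defs.v *)
From HB Require Import structures.
From mathcomp Require Import all_boot all_order all_algebra all_field.
From mathcomp Require Import generic_quotient.
From mathcomp Require Import complex.
From mathcomp Require Import boolp classical_sets reals topology normedtype.
Set Implicit Arguments.
Unset Strict Implicit.
Unset Printing Implicit Defensive.
Import Order.TTheory GRing.Theory Num.Theory numFieldNormedType.Exports.
Local Open Scope ring_scope.

Record intGL (d : nat) := IntGL {
  intGL_mx :> 'M[int]_d;
  intGL_unit : intGL_mx \in unitmx
}.

HB.instance Definition _ d := [isSub for @intGL_mx d].
HB.instance Definition _ d := [Choice of intGL d by <:].

Section IntGLGroup.
Variable d : nat.
Implicit Types A B : intGL d.

Fact intGL_mul_unit A B : A *m B \in unitmx.
Proof. by rewrite unitmx_mul !intGL_unit. Qed.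

Fact intGL_inv_unit A : invmx A \in unitmx.
Proof. by rewrite unitmx_inv intGL_unit. Qed.

Definition intGL_one : intGL d := IntGL (unitmx1 _ d).
Definition intGL_mul A B : intGL d := IntGL (intGL_mul_unit A B).
Definition intGL_inv A : intGL d := IntGL (intGL_inv_unit A).

Fact intGL_mulA : associative intGL_mul.
Proof. by move=> A B C; apply: val_inj; rewrite /= mulmxA. Qed.
Fact intGL_mul1 : left_id intGL_one intGL_mul.
Proof. by move=> A; apply: val_inj; rewrite /= mul1mx. Qed.
Fact intGL_mulr1 : right_id intGL_one intGL_mul.
Proof. by move=> A; apply: val_inj; rewrite /= mulmx1. Qed.
Fact intGL_mulV : left_inverse intGL_one intGL_inv intGL_mul.
Proof. by move=> A; apply: val_inj; rewrite /= mulVmx ?intGL_unit. Qed.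
Fact intGL_mulrV : right_inverse intGL_one intGL_inv intGL_mul.
Proof. by move=> A; apply: val_inj; rewrite /= mulmxV ?intGL_unit. Qed.

HB.instance Definition _ := isGroup.Build (intGL d)
  intGL_mulA intGL_mul1 intGL_mulr1 intGL_mulV intGL_mulrV.

End IntGLGroup.

(* C e_j = e_(j+1) for j < d - 1 and C e_(d-1) = - \sum_i p_i e_i (0-based);
   this is the transpose of mxpoly's companionmx. *)
Definition companion (d : nat) (p : {poly int}) : 'M[int]_d :=
  \matrix_(i < d, j < d)
    if (j.+1 < d)%N then (i == j.+1 :> nat)%:R else - p`_i.

Lemma companionE (p : {poly int}) :
  companion (size p).-1 p = (companionmx p)^T.
Proof.
apply/matrixP=> i j; rewrite !mxE.
have [lt|ge] := ltnP j.+1 (size p).-1.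
  have /ltn_eqF -> : (j < (size p).-1.-1)%N by rewrite ltn_predRL.
  by rewrite [in RHS]eq_sym.
have dE : (size p).-1 = j.+1 by apply/eqP; rewrite eqn_leq ge ltn_ord.
by have -> : (j == (size p).-1.-1 :> nat) by rewrite -[val j]/(j.+1.-1) -dE.
Qed.

Lemma det_companion (d : nat) (p : {poly int}) :
  d = (size p).-1 -> p \is monic -> \det (companion d p) = (-1) ^+ d * p`_0.
Proof.
move=> -> pm; rewrite companionE det_tr.
have := char_poly_det (companionmx p); rewrite companionmxK// => ->.
by rewrite mulrA -exprMn mulrNN mulr1 expr1n mul1r.
Qed.

Lemma Cyclotomic_coef0_unit n : (0 < n)%N -> ('Phi_n)`_0 \is a GRing.unit.
Proof.
move=> n_gt0; have /(congr1 (horner_eval 0)) := prod_Cyclotomic n_gt0.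
rewrite rmorph_prod /= /horner_eval !hornerE expr0n eqn0Ngt n_gt0 sub0r => E.
have : \prod_(d <- divisors n) ('Phi_d).[0] \is a GRing.unit.
  by rewrite E unitrN unitr1.
rewrite (big_rem n) /=; last by rewrite -dvdn_divisors.
by rewrite unitrM horner_coef0 => /andP[].
Qed.

Fact companion_Cyclotomic_unit n : companion (totient n) 'Phi_n \in unitmx.
Proof.
rewrite unitmxE (@det_companion _ 'Phi_n) ?size_Cyclotomic ?Cyclotomic_monic//.
rewrite unitrMl ?unitrX ?unitrN ?unitr1//.
by case: n => [|n]; [rewrite Cyclotomic0 coef1 | apply: Cyclotomic_coef0_unit].
Qed.

Definition cyclotomic_companion (n : nat) : intGL (totient n) :=
  IntGL (companion_Cyclotomic_unit n).

Section CyclicSubgroup.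
Local Open Scope group_scope.
Variables (G : groupType) (g : G).

(* The subgroup generated by g; group exponents are natural numbers, hence the
   two cases. *)
Definition in_cyclic (h : G) : bool :=
  `[< exists k : nat, h = g ^+ k \/ h = g ^- k >].

Record cyclic := Cyclic { cyclic_val : G; cyclicP : in_cyclic cyclic_val }.

HB.instance Definition _ := [isSub for cyclic_val].
HB.instance Definition _ := [Choice of cyclic by <:].

Fact in_cyclic_mul (x y : cyclic) : in_cyclic (cyclic_val x * cyclic_val y).
Proof.
have aux k l : in_cyclic (g ^+ k * g ^- l).
  apply/asboolP; have [lekl|/ltnW lelk] := leqP k l.
    exists (l - k)%N; right.
    by rewrite -{1}(subnK lekl) expgnDr invgM mulgA mulgV mul1g.
  by exists (k - l)%N; left; rewrite expgnFr.
have auxC k l : g ^- k * g ^+ l = g ^+ l * g ^- k.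
  apply/commute_sym/commuteV/commute_sym/commuteX2; exact: commute_refl.
case: x y => x /= /asboolP[k [->|->]] [y /= /asboolP[l [->|->]]].
- by apply/asboolP; exists (k + l)%N; left; rewrite expgnDr.
- exact: aux.
- by rewrite auxC; apply: aux.
- by apply/asboolP; exists (l + k)%N; right; rewrite expgnDr invgM.
Qed.

Fact in_cyclic_inv (x : cyclic) : in_cyclic (cyclic_val x)^-1.
Proof.
case: x => x /= /asboolP[k [->|->]]; apply/asboolP; exists k; first by right.
by left; rewrite invgK.
Qed.

Fact in_cyclic_one : in_cyclic 1.
Proof. by apply/asboolP; exists 0; left. Qed.

Definition cyclic_one := Cyclic in_cyclic_one.
Definition cyclic_mul x y := Cyclic (in_cyclic_mul x y).
Definition cyclic_inv x := Cyclic (in_cyclic_inv x).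

Fact cyclic_mulA : associative cyclic_mul.
Proof. by move=> x y z; apply: val_inj; rewrite /= mulgA. Qed.
Fact cyclic_mul1 : left_id cyclic_one cyclic_mul.
Proof. by move=> x; apply: val_inj; rewrite /= mul1g. Qed.
Fact cyclic_mulr1 : right_id cyclic_one cyclic_mul.
Proof. by move=> x; apply: val_inj; rewrite /= mulg1. Qed.
Fact cyclic_mulV : left_inverse cyclic_one cyclic_inv cyclic_mul.
Proof. by move=> x; apply: val_inj; rewrite /= mulVg. Qed.
Fact cyclic_mulrV : right_inverse cyclic_one cyclic_inv cyclic_mul.
Proof. by move=> x; apply: val_inj; rewrite /= mulgV. Qed.

HB.instance Definition _ := isGroup.Build cyclic
  cyclic_mulA cyclic_mul1 cyclic_mulr1 cyclic_mulV cyclic_mulrV.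

End CyclicSubgroup.

(* Z^d x| <g>, with (x, A) (y, B) = (x + A y, A B). *)
Section SemidirectProduct.
Variables (d : nat) (g : intGL d).

Record semidirect := Semidirect {
  sd_vec : 'cV[int]_d;
  sd_mx : cyclic g
}.

Definition sd_pair (x : semidirect) := (sd_vec x, sd_mx x).
Definition pair_sd p := Semidirect p.1 p.2.
Fact sd_pairK : cancel sd_pair pair_sd. Proof. by case. Qed.
HB.instance Definition _ := Choice.copy semidirect (can_type sd_pairK).

Implicit Types x y : semidirect.

Local Notation mx A := (intGL_mx (cyclic_val A)).

Definition sd_one := Semidirect 0 1%g.
Definition sd_mul x y :=
  Semidirect (sd_vec x + mx (sd_mx x) *m sd_vec y) (sd_mx x * sd_mx y)%g.
Definition sd_inv x :=
  Semidirect (- (mx (sd_mx x)^-1%g *m sd_vec x)) (sd_mx x)^-1%g.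

Fact sd_mulA : associative sd_mul.
Proof.
move=> [u A] [v B] [w C]; congr Semidirect => /=; last by rewrite mulgA.
by rewrite mulmxDr addrA mulmxA.
Qed.
Fact sd_mul1 : left_id sd_one sd_mul.
Proof.
by move=> [u A]; congr Semidirect => /=; rewrite ?mul1g// mul1mx add0r.
Qed.
Fact sd_mulr1 : right_id sd_one sd_mul.
Proof.
by move=> [u A]; congr Semidirect => /=; rewrite ?mulg1// mulmx0 addr0.
Qed.
Fact sd_mulV : left_inverse sd_one sd_inv sd_mul.
Proof.
by move=> [u A]; congr Semidirect => /=; rewrite ?mulVg// addNr.
Qed.
Fact sd_mulrV : right_inverse sd_one sd_inv sd_mul.
Proof.
move=> [u A]; congr Semidirect => /=; rewrite ?mulgV//.
by rewrite mulmxN mulmxA mulmxV ?intGL_unit// mul1mx subrr.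
Qed.

HB.instance Definition _ := isGroup.Build semidirect
  sd_mulA sd_mul1 sd_mulr1 sd_mulV sd_mulrV.

End SemidirectProduct.

(* Unital C*-algebras; the norm is a separate field cnorm because the numeric
   hierarchy has no structure joining noncommutative rings and normed modules.
   normc is the modulus of a complex number, with values in R. *)
HB.mixin Record isCstarAlgebra (R : realType) (A : Type)
    of GRing.Algebra R[i] A := {
  star : A -> A;
  cnorm : A -> R;
  starK : involutive star;
  starD : {morph star : x y / x + y};
  starZ : forall (a : R[i]) (x : A), star (a *: x) = conjc a *: star x;
  starM : forall x y : A, star (x * y) = star y * star x;
  cnorm_eq0 : forall x : A, cnorm x = 0 -> x = 0;
  cnormD : forall x y : A, cnorm (x + y) <= cnorm x + cnorm y;
  cnormZ : forall (a : R[i]) (x : A),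
    cnorm (a *: x) = Normc.normc a * cnorm x;
  cnormM : forall x y : A, cnorm (x * y) <= cnorm x * cnorm y;
  cstarE : forall x : A, cnorm (star x * x) = cnorm x ^+ 2;
  cnorm_complete : forall u : nat -> A,
    (forall e : R, 0 < e -> exists N : nat, forall m n : nat,
       (N <= m)%N -> (N <= n)%N -> cnorm (u m - u n) < e) ->
    exists l : A, (cnorm (u n - l) @[n --> \oo] --> (0 : R))%classic
}.

#[short(type="cstarAlgType")]
HB.structure Definition CstarAlgebra (R : realType) :=
  {A of isCstarAlgebra R A & GRing.Algebra R[i] A}.

Definition unitary_rep (R : realType) (G : groupType) (A : cstarAlgType R)
    (u : G -> A) : Prop :=
  [/\ u 1%g = 1, {morph u : x y / (x * y)%g >-> x * y} &
      forall x, star (u x) * u x = 1 /\ u x * star (u x) = 1].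

(* (A, u) is the full group C*-algebra of the discrete group G: it is universal
   among unital C*-algebras with a unitary representation of G, i.e. it is the
   completion of C[G] for the norm sup {||v(f)|| : v unitary representation}.
   This determines (A, u) up to a unique isometric *-isomorphism. *)
Definition is_group_cstar (R : realType) (G : groupType) (A : cstarAlgType R)
    (u : G -> A) : Prop :=
  unitary_rep u /\
  forall (B : cstarAlgType R) (v : G -> B), unitary_rep v ->
    exists pi : {lrmorphism A -> B},
      [/\ {morph pi : x / star x >-> star x}, pi \o u =1 v &
          forall rho : {lrmorphism A -> B},
            {morph rho : x / star x >-> star x} -> rho \o u =1 v ->
            rho =1 pi].

Section NormContinuity.
Variables (R : realType) (A : cstarAlgType R).
Implicit Types (x y : A) (f g : R -> A).
Local Open Scope classical_set_scope.

Lemma cnorm0 : cnorm (0 : A) = 0.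
Proof. by rewrite -(scale0r (0 : A)) cnormZ Normc.normc0 mul0r. Qed.

Lemma cnormN x : cnorm (- x) = cnorm x.
Proof. by rewrite -scaleN1r cnormZ normcN Normc.normc1 mul1r. Qed.

Lemma cnorm_ge0 x : 0 <= cnorm x.
Proof.
have := cnormD x (- x); rewrite subrr cnorm0 cnormN -mulr2n.
by rewrite pmulrn_lge0.
Qed.

Definition norm_continuous f : Prop :=
  forall t : R, t \in `[0, 1]%R ->
    cnorm (f s - f t) @[s --> within `[0, 1] (nbhs t)] --> (0 : R).

Lemma norm_continuous_cst x : norm_continuous (fun=> x).
Proof. by move=> t _; under eq_fun do rewrite subrr cnorm0; exact: cvg_cst. Qed.

Lemma norm_squeeze (F : set_system R) (h k : R -> R) : Filter F ->
  (forall s, 0 <= h s <= k s) ->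
  k s @[s --> F] --> (0 : R) -> h s @[s --> F] --> (0 : R).
Proof.
move=> FF hk k0; apply: (squeeze_cvgr _ (cvg_cst (0 : R)) k0).
by near=> s; apply: hk.
Unshelve. all: by end_near. Qed.

Lemma norm_continuousD f g : norm_continuous f -> norm_continuous g ->
  norm_continuous (fun s => f s + g s).
Proof.
move=> cf cg t t01.
apply: (@norm_squeeze _ _ (fun s => cnorm (f s - f t) + cnorm (g s - g t))).
  by move=> s; rewrite cnorm_ge0 opprD addrACA cnormD.
by rewrite -[0 in X in _ --> X]addr0; apply: cvgD; [apply: cf|apply: cg].
Qed.

Lemma norm_continuousM f g : norm_continuous f -> norm_continuous g ->
  norm_continuous (fun s => f s * g s).
Proof.
move=> cf cg t t01.
apply: (@norm_squeeze _ _ (fun s => cnorm (f s - f t) * cnorm (g s - g t) +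
  cnorm (f s - f t) * cnorm (g t) + cnorm (f t) * cnorm (g s - g t))).
  move=> s; rewrite cnorm_ge0 /=.
  have -> : f s * g s - f t * g t = (f s - f t) * (g s - g t) +
      (f s - f t) * g t + f t * (g s - g t).
    by rewrite -mulrDr subrK mulrBl mulrBr addrA subrK.
  rewrite (le_trans (cnormD _ _))// lerD// ?cnormM//.
  by rewrite (le_trans (cnormD _ _))// lerD// cnormM.
have l0 : 0 * 0 + 0 * cnorm (g t) + cnorm (f t) * 0 = 0 :> R.
  by rewrite !mul0r mulr0 !addr0.
rewrite -[0 in X in _ --> X]l0 => {l0}.
have {cf}cf := cf t t01; have {cg}cg := cg t t01.
apply: cvgD; last exact: cvgMl_tmp cg.
by apply: cvgD; [exact: cvgM cf cg | exact: cvgMr_tmp cf].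
Qed.

Lemma norm_continuous_eq f g : f =1 g -> norm_continuous f -> norm_continuous g.
Proof. by move=> /funext ->. Qed.

Lemma norm_continuous_sum (I : Type) (r : seq I) (F : I -> R -> A) :
  (forall i, norm_continuous (F i)) ->
  norm_continuous (fun s => \sum_(i <- r) F i s).
Proof.
move=> cF; elim: r => [|i r IHr].
  by apply: norm_continuous_eq (norm_continuous_cst 0) => s; rewrite big_nil.
apply: norm_continuous_eq (norm_continuousD (cF i) IHr) => s.
by rewrite big_cons.
Qed.

Lemma norm_continuous_rev f : norm_continuous f ->
  norm_continuous (fun s => f (1 - s)).
Proof.
move=> cf t t01.
have rev01 (s : R) : s \in `[0, 1]%R -> 1 - s \in `[0, 1]%R.
  by rewrite !in_itv /= subr_ge0 gerBl => /andP[-> ->].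
have /cvgrPdist_lt c := cf _ (rev01 _ t01).
apply/cvgrPdist_lt => e /c; rewrite !near_withinE => nf.
have : (1 - s) @[s --> t] --> 1 - t by apply: cvgB; [exact: cvg_cst|exact: cvg_id].
move=> /(_ _ nf) nf'; near=> s => s01.
suff: `[0, 1]%classic (1 - s) -> `|0 - cnorm (f (1 - s) - f (1 - t))| < e.
  by apply; exact: rev01.
by near: s.
Unshelve. all: by end_near. Qed.

Lemma norm_continuous_scale x : norm_continuous (fun s => (s%:C)%C *: x).
Proof.
move=> t _.
have E : (fun s : R => cnorm ((s%:C)%C *: x - (t%:C)%C *: x)) =
    (fun s => `|s - t| * cnorm x).
  apply/funext => s; rewrite -scalerBl cnormZ; congr (_ * _).
  by rewrite -rmorphB /= expr0n /= addr0 sqrtr_sqr.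
have st0 : `|s - t| @[s --> t] --> (0 : R).
  rewrite -[0 in X in _ --> X](normr0 R) -(subrr t); apply: cvg_norm.
  by apply: cvgB; [exact: cvg_id|exact: cvg_cst].
have : `|s - t| * cnorm x @[s --> t] --> (0 : R).
  by rewrite -[0 in X in _ --> X](mul0r (cnorm x)); exact: cvgMr_tmp st0.
by rewrite -E; exact: cvg_within_filter.
Qed.

End NormContinuity.

Section MatrixPaths.
Variables (R : realType) (A : cstarAlgType R).

(* The C*-norm of M_k(A) is equivalent to the maximum of the norms of the
   entries, so norm continuity in M_k(A) is entrywise. *)
Definition mx_continuous m n (f : R -> 'M[A]_(m, n)) : Prop :=
  forall i j, norm_continuous (fun t => f t i j).

Definition mx_invertible k (u : 'M[A]_k) : Prop :=
  exists v : 'M[A]_k, u *m v = 1%:M /\ v *m u = 1%:M.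

Definition gl_path k (u v : 'M[A]_k) : Prop :=
  exists f : R -> 'M[A]_k,
    [/\ f 0 = u, f 1 = v, mx_continuous f &
        forall t : R, t \in `[0, 1]%R -> mx_invertible (f t)].

(* The image of u in M_N(A) under u |-> diag(u, 1, ..., 1), for k <= N. *)
Definition mx_stab k N (u : 'M[A]_k) : 'M[A]_N :=
  \matrix_(i < N, j < N)
    match insub (val i) : option 'I_k, insub (val j) : option 'I_k with
    | Some i', Some j' => u i' j'
    | _, _ => (i == j)%:R
    end.

Lemma mx_continuous_cst m n (u : 'M[A]_(m, n)) : mx_continuous (fun=> u).
Proof. by move=> i j; apply: norm_continuous_cst. Qed.

Lemma mx_continuousM m n p (f : R -> 'M[A]_(m, n)) (g : R -> 'M[A]_(n, p)) :
  mx_continuous f -> mx_continuous g -> mx_continuous (fun t => f t *m g t).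
Proof.
move=> cf cg i j.
have c l : norm_continuous (fun t => f t i l * g t l j).
  by apply: norm_continuousM; [apply: cf|apply: cg].
apply: norm_continuous_eq (norm_continuous_sum (index_enum _) c) => t.
by rewrite mxE.
Qed.

Lemma mx_continuous_scalar n :
  mx_continuous (fun t : R => ((t%:C)%C *: (1 : A))%:M : 'M[A]_n).
Proof.
move=> i j; have [<-|ne] := eqVneq i j.
  apply: norm_continuous_eq (norm_continuous_scale 1) => t.
  by rewrite mxE eqxx.
apply: norm_continuous_eq (norm_continuous_cst 0) => t.
by rewrite mxE (negPf ne).
Qed.

Lemma mx_continuous_block m1 m2 n1 n2 (f : R -> 'M[A]_(m1, n1)) g h
    (k : R -> 'M[A]_(m2, n2)) :
  mx_continuous f -> mx_continuous g -> mx_continuous h -> mx_continuous k ->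
  mx_continuous (fun t => block_mx (f t) (g t) (h t) (k t)).
Proof.
move=> cf cg ch ck i j; case: (split_ordP i) => i' ->;
  case: (split_ordP j) => j' ->.
- by apply: norm_continuous_eq (cf i' j') => t; rewrite block_mxEul.
- by apply: norm_continuous_eq (cg i' j') => t; rewrite block_mxEur.
- by apply: norm_continuous_eq (ch i' j') => t; rewrite block_mxEdl.
- by apply: norm_continuous_eq (ck i' j') => t; rewrite block_mxEdr.
Qed.

Lemma mx_invertible1 k : mx_invertible (1%:M : 'M[A]_k).
Proof. by exists 1%:M; rewrite mulmx1. Qed.

Lemma mx_invertibleM k (u v : 'M[A]_k) :
  mx_invertible u -> mx_invertible v -> mx_invertible (u *m v).
Proof.
move=> [u' [uu' u'u]] [v' [vv' v'v]]; exists (v' *m u'); split.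
  by rewrite mulmxA -(mulmxA u) vv' mulmx1.
by rewrite mulmxA -(mulmxA v') u'u mulmx1.
Qed.

Lemma mx_stab_id k (u : 'M[A]_k) : mx_stab k u = u.
Proof. by apply/matrixP => i j; rewrite mxE !valK. Qed.

Lemma mx_stab_stab k N M (u : 'M[A]_k) : (k <= N)%N ->
  mx_stab M (mx_stab N u) = mx_stab M u.
Proof.
move=> kN; apply/matrixP => i j; rewrite !mxE.
have noneN (l : 'I_M) : ~~ (l < N)%N -> (insub (val l) : option 'I_k) = None.
  by move=> lN; apply: insubN; apply: contra lN => /leq_trans; apply.
case: (insubP _ (val i)) => [i' _ Ei|/noneN ->]; last first.
  by [].
case: (insubP _ (val j)) => [j' _ Ej|/noneN ->]; last by case: insub.
by rewrite mxE Ei Ej -[i' == j']val_eqE Ei Ej.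
Qed.

Lemma mx_stab_block k p (u : 'M[A]_k) :
  mx_stab (k + p) u = block_mx u 0 0 1%:M.
Proof.
have insl (i : 'I_k) : insub (val (lshift p i)) = Some i :> option 'I_k.
  exact: valK.
have insr (i : 'I_p) : insub (val (rshift k i)) = None :> option 'I_k.
  by apply: insubN; rewrite -leqNgt /= leq_addr.
apply/matrixP => i j; rewrite mxE; case: (split_ordP i) => i' ->;
  case: (split_ordP j) => j' ->; rewrite ?insl ?insr.
- by rewrite block_mxEul.
- by rewrite block_mxEur mxE eq_lrshift.
- by rewrite block_mxEdl mxE eq_rlshift.
- by rewrite block_mxEdr mxE eq_rshift.
Qed.

Lemma mx_stabM k N (u v : 'M[A]_k) : (k <= N)%N ->
  mx_stab N (u *m v) = mx_stab N u *m mx_stab N v.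
Proof.
move=> /subnKC <-; rewrite !mx_stab_block mulmx_block.
by rewrite !mul0mx !mulmx0 !mulmx1 !addr0 add0r.
Qed.

Lemma mx_stab1 k N : (k <= N)%N -> mx_stab N (1%:M : 'M[A]_k) = 1%:M.
Proof. by move=> /subnKC <-; rewrite mx_stab_block -scalar_mx_block. Qed.

Lemma mx_invertible_stab k N (u : 'M[A]_k) : (k <= N)%N ->
  mx_invertible u -> mx_invertible (mx_stab N u).
Proof.
move=> kN [v [uv vu]]; exists (mx_stab N v).
by rewrite -!mx_stabM// uv vu mx_stab1.
Qed.

Lemma gl_path_refl k (u : 'M[A]_k) : mx_invertible u -> gl_path u u.
Proof.
by move=> iu; exists (fun=> u); split=> //; apply: mx_continuous_cst.
Qed.

Lemma gl_path_sym k (u v : 'M[A]_k) : gl_path u v -> gl_path v u.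
Proof.
move=> [f [f0 f1 cf fi]]; exists (fun t => f (1 - t)); split.
- by rewrite subr0.
- by rewrite subrr.
- by move=> i j; apply: (norm_continuous_rev (cf i j)).
- by move=> t; rewrite in_itv /= => /andP[t0 t1]; apply: fi;
    rewrite in_itv /= subr_ge0 gerBl t0 t1.
Qed.

Lemma gl_pathM k (u u' v v' : 'M[A]_k) :
  gl_path u u' -> gl_path v v' -> gl_path (u *m v) (u' *m v').
Proof.
move=> [f [<- <- cf fi]] [g [<- <- cg gi]].
exists (fun t => f t *m g t); split=> //; first exact: mx_continuousM.
by move=> t t01; apply: mx_invertibleM; [apply: fi|apply: gi].
Qed.

Lemma gl_path_invertible k (u v : 'M[A]_k) : gl_path u v -> mx_invertible u.
Proof. by move=> [f [<- _ _]]; apply; rewrite in_itv /= lexx ler01. Qed.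

Lemma gl_path_trans k (v u w : 'M[A]_k) :
  gl_path u v -> gl_path v w -> gl_path u w.
Proof.
move=> uv vw; have [v' [vv' v'v]] := gl_path_invertible vw.
have iv' : mx_invertible v' by exists v.
have := gl_pathM (gl_pathM uv (gl_path_refl iv')) vw.
by rewrite -mulmxA v'v mulmx1 vv' mul1mx.
Qed.

Lemma gl_path_stab k N (u v : 'M[A]_k) : (k <= N)%N ->
  gl_path u v -> gl_path (mx_stab N u) (mx_stab N v).
Proof.
move=> kN [f [<- <- cf fi]]; exists (fun t => mx_stab N (f t)); split=> //.
  move: kN => /subnKC <- i j.
  apply: norm_continuous_eq (mx_continuous_block cf (mx_continuous_cst 0)
    (mx_continuous_cst 0) (mx_continuous_cst 1%:M) i j) => t.
  by rewrite mx_stab_block.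
by move=> t /fi; apply: mx_invertible_stab.
Qed.

(* The rotation of diag(u, 1) into diag(1, u), through a product of elementary
   matrices. *)
Lemma gl_path_swap k (u : 'M[A]_k) : mx_invertible u ->
  gl_path (block_mx u 0 0 1%:M) (block_mx 1%:M 0 0 u).
Proof.
move=> iu; pose e (t : R) : 'M[A]_k := ((t%:C)%C *: (1 : A))%:M.
have eN t : e (- t) = - e t by rewrite /e rmorphN scaleNr rmorphN.
have e0 : e 0 = 0 by rewrite /e rmorph0 scale0r rmorph0.
have e1 : e 1 = 1%:M by rewrite /e rmorph1 scale1r.
have ce : mx_continuous e by exact: mx_continuous_scalar.
have cst m n (x : 'M[A]_(m, n)) := mx_continuous_cst x.
have ceN : mx_continuous (fun t => - e t).
  move=> i j; apply: norm_continuous_eq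
    (mx_continuousM (cst _ _ (- 1%:M)) ce i j) => t.
  by rewrite mulNmx mul1mx.
pose U (x : 'M[A]_k) : 'M[A]_(k + k) := block_mx 1%:M x 0 1%:M.
pose L (x : 'M[A]_k) : 'M[A]_(k + k) := block_mx 1%:M 0 x 1%:M.
have UV x : U x *m U (- x) = 1%:M.
  rewrite mulmx_block !(mulmx1, mul1mx, mul0mx, mulmx0) !addr0 add0r addNr.
  by rewrite -scalar_mx_block.
have LV x : L x *m L (- x) = 1%:M.
  rewrite mulmx_block !(mulmx1, mul1mx, mul0mx, mulmx0) !addr0 !add0r.
  by rewrite subrr -scalar_mx_block.
have UV' x : U (- x) *m U x = 1%:M by rewrite -{2}[x]opprK UV.
have LV' x : L (- x) *m L x = 1%:M by rewrite -{2}[x]opprK LV.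
pose W x := U x *m L (- x) *m U x.
pose W' x := U (- x) *m L x *m U (- x).
have WV x : W x *m W' x = 1%:M.
  by rewrite /W /W' !mulmxA -(mulmxA _ (U x)) UV mulmx1 -(mulmxA _ (L (- x)))
    LV' mulmx1 UV.
have WV' x : W' x *m W x = 1%:M.
  by rewrite /W /W' !mulmxA -(mulmxA _ (U (- x))) UV' mulmx1 -(mulmxA _ (L x))
    LV mulmx1 UV'.
exists (fun t => W (e t) *m block_mx u 0 0 1%:M *m W' (e t)); split.
- by rewrite e0 /W /W' /U /L !oppr0 -!scalar_mx_block !mulmx1 mul1mx.
- rewrite e1 /W /W' /U /L !mulmx_block.
  rewrite !(mulmx1, mul1mx, mul0mx, mulmx0, mulNmx, mulmxN, addr0, add0r,
    subrr, addNr, opprK, oppr0).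
  by [].
- have cU (x : R -> 'M[A]_k) : mx_continuous x -> mx_continuous (fun t => U (x t)).
    by move=> cx; apply: mx_continuous_block.
  have cL (x : R -> 'M[A]_k) : mx_continuous x -> mx_continuous (fun t => L (x t)).
    by move=> cx; apply: mx_continuous_block.
  apply: mx_continuousM; first apply: mx_continuousM => //.
    by apply: mx_continuousM; [apply: mx_continuousM; [exact: cU|exact: cL]|exact: cU].
  by apply: mx_continuousM; [apply: mx_continuousM; [exact: cU|exact: cL]|exact: cU].
- move=> t _; have iW : mx_invertible (W (e t)) by exists (W' (e t)).
  have iW' : mx_invertible (W' (e t)) by exists (W (e t)).
  apply: mx_invertibleM => //; apply: mx_invertibleM => //.
  by rewrite -mx_stab_block; apply: mx_invertible_stab; rewrite ?leq_addr.
Qed.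

Lemma gl_path_comm k (u v : 'M[A]_k) : mx_invertible u -> mx_invertible v ->
  gl_path (mx_stab (k + k) (u *m v)) (mx_stab (k + k) (v *m u)).
Proof.
move=> iu iv; rewrite !mx_stabM ?leq_addr// !mx_stab_block.
have pv : gl_path (mx_stab (k + k) v) (mx_stab (k + k) v).
  by apply: gl_path_refl; apply: mx_invertible_stab; rewrite ?leq_addr.
rewrite mx_stab_block in pv.
apply: gl_path_trans (gl_pathM (gl_path_swap iu) pv) _.
have -> : block_mx 1%:M 0 0 u *m block_mx v 0 0 1%:M =
    block_mx v 0 0 1%:M *m block_mx 1%:M 0 0 u :> 'M_(k + k).
  by rewrite !mulmx_block !(mulmx1, mul1mx, mul0mx, mulmx0, addr0, add0r).
exact: gl_pathM pv (gl_path_sym (gl_path_swap iu)).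
Qed.

End MatrixPaths.

Section K1Group.
Variables (R : realType) (A : cstarAlgType R).

(* An element of some GL_k(A), as a representative in GL_oo(A). *)
Record glmx := GLmx {
  gl_size : nat;
  gl_mx : 'M[A]_gl_size;
  gl_invertible : mx_invertible gl_mx
}.

HB.instance Definition _ := gen_eqMixin glmx.
HB.instance Definition _ := gen_choiceMixin glmx.

Definition gl_equiv (u v : glmx) : bool :=
  `[< exists N, [/\ (gl_size u <= N)%N, (gl_size v <= N)%N &
        gl_path (mx_stab N (gl_mx u)) (mx_stab N (gl_mx v))] >].

Lemma gl_equivP u v : gl_equiv u v ->
  exists N0, forall N, (N0 <= N)%N -> [/\ (gl_size u <= N)%N,
    (gl_size v <= N)%N & gl_path (mx_stab N (gl_mx u)) (mx_stab N (gl_mx v))].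
Proof.
move=> /asboolP[N0 [uN vN p]]; exists N0 => N N0N.
split; [exact: leq_trans uN _|exact: leq_trans vN _|].
by have := gl_path_stab N0N p; rewrite !mx_stab_stab.
Qed.

Fact gl_equiv_refl : reflexive gl_equiv.
Proof.
move=> u; apply/asboolP; exists (gl_size u); split=> //.
by apply: gl_path_refl; rewrite mx_stab_id; apply: gl_invertible.
Qed.

Fact gl_equiv_sym : symmetric gl_equiv.
Proof.
by move=> u v; apply/asboolP/asboolP => -[N [? ? p]]; exists N; split=> //;
  exact: gl_path_sym.
Qed.

Fact gl_equiv_trans : transitive gl_equiv.
Proof.
move=> v u w /gl_equivP[N1 p1] /gl_equivP[N2 p2]; apply/asboolP.
have [uN vN uv] := p1 _ (leq_maxl N1 N2).
have [_ wN vw] := p2 _ (leq_maxr N1 N2).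
by exists (maxn N1 N2); split=> //; exact: gl_path_trans uv vw.
Qed.

Canonical gl_equiv_rel := EquivRel gl_equiv
  gl_equiv_refl gl_equiv_sym gl_equiv_trans.

(* K_1(A) = GL_oo(A) / GL_oo(A)_0, where GL_oo(A) is the union of the GL_k(A)
   along u |-> diag(u, 1). The sum of two classes is the class of the product
   in GL_oo(A), which is also that of diag(u, v). *)
Definition K1 := {eq_quot gl_equiv_rel}%qT.

HB.instance Definition _ := Choice.on K1.

Local Open Scope quotient_scope.

Definition K1_class (u : glmx) : K1 := \pi_K1 u.

Lemma K1_classP u v : reflect (K1_class u = K1_class v) (gl_equiv u v).
Proof. exact: eqquotP. Qed.

Definition gl_one : glmx := GLmx (@mx_invertible1 R A 0).

Fact gl_mul_subproof (u v : glmx) (N := (gl_size u + gl_size v)%N) :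
  mx_invertible (mx_stab N (gl_mx u) *m mx_stab N (gl_mx v)).
Proof.
by apply: mx_invertibleM; apply: mx_invertible_stab;
  rewrite ?leq_addl ?leq_addr//; apply: gl_invertible.
Qed.

Definition gl_mul (u v : glmx) : glmx := GLmx (gl_mul_subproof u v).

Fact gl_inv_subproof (u : glmx) :
  mx_invertible (projT1 (cid (gl_invertible u))).
Proof. by case: cid => v /= [uv vu]; exists (gl_mx u). Qed.

Definition gl_inv (u : glmx) : glmx := GLmx (gl_inv_subproof u).

Lemma mx_stab_mul u v N : (gl_size u + gl_size v <= N)%N ->
  mx_stab N (gl_mx (gl_mul u v)) = mx_stab N (gl_mx u) *m mx_stab N (gl_mx v).
Proof. by move=> uvN; rewrite /= mx_stabM// !mx_stab_stab// ?leq_addl ?leq_addr. Qed.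

Lemma gl_mulV u :
  gl_mx (gl_inv u) *m gl_mx u = 1%:M /\ gl_mx u *m gl_mx (gl_inv u) = 1%:M.
Proof. by rewrite /=; case: cid => v []. Qed.

Lemma gl_equiv_eq u v N : (gl_size u <= N)%N -> (gl_size v <= N)%N ->
  mx_stab N (gl_mx u) = mx_stab N (gl_mx v) -> gl_equiv u v.
Proof.
move=> uN vN uv; apply/asboolP; exists N; split=> //; rewrite uv.
by apply: gl_path_refl; apply: mx_invertible_stab => //; apply: gl_invertible.
Qed.

Lemma gl_mul_equiv u u' v v' :
  gl_equiv u u' -> gl_equiv v v' -> gl_equiv (gl_mul u v) (gl_mul u' v').
Proof.
move=> /gl_equivP[N1 p1] /gl_equivP[N2 p2]; apply/asboolP.
pose N := (N1 + N2 + (gl_size u + gl_size v) + (gl_size u' + gl_size v'))%N.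
have N1N : (N1 <= N)%N by rewrite /N -!addnA leq_addr.
have N2N : (N2 <= N)%N by rewrite /N -!addnA addnCA leq_addr.
have uvN : (gl_size u + gl_size v <= N)%N by rewrite /N addnAC leq_addl.
have uvN' : (gl_size u' + gl_size v' <= N)%N by rewrite /N leq_addl.
have [_ _ pu] := p1 _ N1N; have [_ _ pv] := p2 _ N2N.
by exists N; split=> //; rewrite !mx_stab_mul//; exact: gl_pathM.
Qed.

Definition K1_zero : K1 := K1_class gl_one.
Definition K1_add (x y : K1) : K1 := K1_class (gl_mul (repr x) (repr y)).
Definition K1_opp (x : K1) : K1 := K1_class (gl_inv (repr x)).

Lemma K1_class_surj (x : K1) : exists u, x = K1_class u.
Proof. by exists (repr x); rewrite /K1_class reprK. Qed.

Lemma K1_addE u v : K1_add (K1_class u) (K1_class v) = K1_class (gl_mul u v).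
Proof.
by apply/K1_classP; apply: gl_mul_equiv; apply/K1_classP; rewrite /K1_class reprK.
Qed.

Fact K1_addA : associative K1_add.
Proof.
move=> x y z; have [u ->] := K1_class_surj x.
have [v ->] := K1_class_surj y; have [w ->] := K1_class_surj z.
rewrite !K1_addE.
apply/K1_classP.
apply: (@gl_equiv_eq _ _ (gl_size u + gl_size v + gl_size w)%N) => //.
  by rewrite /= addnA.
by rewrite !mx_stab_mul ?mulmxA//= ?addnA// ?leq_addr// -addnA leq_addl.
Qed.

Fact K1_addC : commutative K1_add.
Proof.
move=> x y; have [u ->] := K1_class_surj x.
have [v ->] := K1_class_surj y; rewrite !K1_addE.
apply/K1_classP/asboolP; pose k := (gl_size u + gl_size v)%N.
have uk : (gl_size u <= k)%N by rewrite leq_addr.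
have vk : (gl_size v <= k)%N by rewrite leq_addl.
have kk : (k <= k + k)%N by rewrite leq_addr.
have kk' : (gl_size v + gl_size u <= k + k)%N by rewrite addnC.
exists (k + k)%N; split=> //; rewrite !mx_stab_mul//.
rewrite -(mx_stab_stab _ (gl_mx u) uk) -(mx_stab_stab _ (gl_mx v) vk).
rewrite -!mx_stabM//.
by apply: gl_path_comm; apply: mx_invertible_stab => //; apply: gl_invertible.
Qed.

Fact K1_add0 : left_id K1_zero K1_add.
Proof.
move=> x; have [u ->] := K1_class_surj x; rewrite K1_addE; apply/K1_classP.
apply: (@gl_equiv_eq _ _ (gl_size u)) => //.
by rewrite mx_stab_mul//= mx_stab1// mul1mx.
Qed.

Fact K1_addN : left_inverse K1_zero K1_opp K1_add.
Proof.
move=> x; rewrite /K1_opp -{2}[x]reprK K1_addE; apply/K1_classP.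
set u := repr x; pose N := (gl_size u + gl_size u)%N.
apply: (@gl_equiv_eq _ _ N) => //.
rewrite mx_stab_mul// -mx_stabM ?leq_addr// (gl_mulV u).1.
by rewrite !mx_stab1 ?leq_addr.
Qed.

HB.instance Definition _ := GRing.isZmodule.Build K1
  K1_addA K1_addC K1_add0 K1_addN.

End K1Group.

(* Main.v *)
(* A map from T^3 to GL_2(C) of nonzero degree, evaluated at the commuting
   unitaries of the first three basis vectors of Z^d, is an invertible matrix W
   over C*(Z^d x| <C_n>).  A 3 x d integer matrix P induces a *-morphism from this
   algebra to M_o(C(T^3)), where o is the order of C_n: it sends y in Z^d to the
   diagonal matrix of the characters P C_n^i y.  On invertible matrices over
   C(T^3), the odd Chern character, i.e. the integral of tr (w_0 [w_1, w_2]) with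
   w_j = p^-1 d_j p, is a homotopy invariant that vanishes on 1; on the image of W
   it is a positive multiple of the sum over i of det (P C_n^i Y), where the
   columns of Y are the first three basis vectors.  So W is nontrivial in K_1 as
   soon as P makes this sum nonzero.
   As 2 phi(n) >= n + 5, there are distinct units 1, a, b modulo n with
   1 + a + b = 0.  For z a primitive n-th root of unity, take for P the left
   eigenvectors of C_n for z, z^a, z^b: since z z^a z^b = 1, all the terms of the
   sum are equal, to a nonzero Vandermonde determinant.  By multilinearity the sum
   is then nonzero for some integer P. *)
Require Import Defs.
From mathcomp Require Import all_boot all_order all_algebra all_field.
From mathcomp Require Import reals.
From HB Require Import structures.
From mathcomp Require Import perm complex.
From mathcomp Require Import boolp classical_sets topology normedtype sequences.
From mathcomp Require Import ring lra zify.
Set Implicit Arguments.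
Unset Strict Implicit.
Unset Printing Implicit Defensive.
Import Order.TTheory GRing.Theory Num.Theory numFieldNormedType.Exports.
Local Open Scope ring_scope.

Lemma expr_lt_eps (R : realType) (k e : R) : 0 <= k < 1 -> 0 < e ->
  exists N : nat, forall n, (N <= n)%N -> k ^+ n < e.
Proof.
move=> /andP[k0 k1] e0; have := @cvg_expr R k; rewrite ger0_norm// => /(_ k1).
move=> /cvgrPdist_lt /(_ _ e0) [N _ H]; exists N => n /H /=.
by rewrite sub0r normrN ger0_norm// exprn_ge0.
Qed.

Lemma le_eps (R : realType) (a b : R) : (forall e, 0 < e -> a < b + e) -> a <= b.
Proof. by move=> h; apply/ler_addgt0Pr => e /h /ltW. Qed.

(** * Neumann series and square roots in C*-algebras *)

Section ContractionFixpoint.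
Variables (R : realType) (V : zmodType) (nu : V -> R).
Hypothesis nuD : forall x y, nu (x + y) <= nu x + nu y.
Hypothesis nuN : forall x, nu (- x) = nu x.
Hypothesis nu_eq0 : forall x, nu x = 0 -> x = 0.
Hypothesis nu_ge0 : forall x, 0 <= nu x.
Hypothesis nu0 : nu 0 = 0.
Hypothesis complete : forall w : nat -> V,
  (forall e : R, 0 < e -> exists N : nat, forall m n,
    (N <= m)%N -> (N <= n)%N -> nu (w m - w n) < e) ->
  exists l, forall e, 0 < e -> exists N : nat, forall n, (N <= n)%N ->
    nu (w n - l) < e.

Lemma nu_small_eq0 x : (forall e, 0 < e -> nu x < e) -> x = 0.
Proof.
move=> h; apply: nu_eq0; apply/eqP; rewrite eq_le nu_ge0 andbT.
by apply: le_eps => e /h; rewrite add0r.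
Qed.

Lemma contraction_fixpoint (F : V -> V) (rho k : R) : 0 <= rho -> 0 <= k < 1 ->
  (forall x, nu x <= rho -> nu (F x) <= rho) ->
  (forall x y, nu x <= rho -> nu y <= rho -> nu (F x - F y) <= k * nu (x - y)) ->
  exists x, nu x <= rho /\ F x = x.
Proof.
move=> rho0 /andP[k0 k1] Fb Fc.
pose w n := iter n F 0.
have wb n : nu (w n) <= rho by elim: n => [|n]; [rewrite nu0|apply: Fb].
have wc n p : nu (w (n + p)%N - w n) <= k ^+ n * rho.
  elim: n => [|n IH]; first by rewrite expr0 mul1r add0n /w /= subr0 wb.
  rewrite addSn exprS -mulrA /w !iterS; apply: le_trans (Fc _ _ (wb _) (wb _)) _.
  by rewrite ler_wpM2l.
have [//| l hl] := complete (w := w).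
  move=> e e0.
  have [N hN] : exists N : nat, forall n, (N <= n)%N -> k ^+ n * rho < e.
    have [N hN] := @expr_lt_eps R k (e / (rho + 1)) ltac:(by rewrite k0)
      ltac:(by rewrite divr_gt0// ltr_wpDl).
    exists N => n /hN; rewrite ltr_pdivlMr; last by rewrite ltr_wpDl.
    by apply: le_lt_trans; rewrite ler_wpM2l ?exprn_ge0// lerDl ler01.
  exists N => m n Nm Nn; have [le_mn|/ltnW le_nm] := leqP m n.
    by rewrite -opprB nuN -(subnKC le_mn) (le_lt_trans (wc _ _))// hN.
  by rewrite -(subnKC le_nm) (le_lt_trans (wc _ _))// hN.
have lb : nu l <= rho.
  apply: le_eps => e /hl[N /(_ N (leqnn _))] hN.
  have -> : l = w N + (- (w N - l)) by rewrite opprB addrC subrK.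
  by rewrite (le_lt_trans (nuD _ _))// nuN ler_ltD.
exists l; split=> //; apply/eqP; rewrite -subr_eq0; apply/eqP.
apply: nu_small_eq0 => e e0; have e20 : 0 < e / 2 by rewrite divr_gt0.
have [N hN] := hl _ e20.
have -> : F l - l = (F l - F (w N)) + (w N.+1 - l) by rewrite addrA subrK.
rewrite (le_lt_trans (nuD _ _))// [ltRHS]splitr ltrD//; last exact: hN.
apply: le_lt_trans (Fc _ _ lb (wb _)) _.
rewrite -opprB nuN; apply: le_lt_trans (hN _ (leqnn _)).
by rewrite ler_piMl// ltW.
Qed.

End ContractionFixpoint.

Section NormedRing.
Variables (R : realType) (V : pzRingType) (nu : V -> R).

Record complete_norm : Prop := CompleteNorm {
  cn_D : forall x y, nu (x + y) <= nu x + nu y;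
  cn_N : forall x, nu (- x) = nu x;
  cn_eq0 : forall x, nu x = 0 -> x = 0;
  cn_ge0 : forall x, 0 <= nu x;
  cn_0 : nu 0 = 0;
  cn_M : forall x y, nu (x * y) <= nu x * nu y;
  cn_complete : forall w : nat -> V,
    (forall e : R, 0 < e -> exists N : nat, forall m n,
      (N <= m)%N -> (N <= n)%N -> nu (w m - w n) < e) ->
    exists l, forall e, 0 < e -> exists N : nat, forall n, (N <= n)%N ->
      nu (w n - l) < e
}.

Hypothesis nuC : complete_norm.

Lemma neumann (k : R) x : k < 1 -> nu x <= k ->
  exists y, [/\ (1 - x) * y = 1, y * (1 - x) = 1 & nu y <= nu 1 / (1 - k)].
Proof.
move=> k1 xk; have k0 : 0 <= k by apply: le_trans xk; exact: cn_ge0.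
have d0 : 0 < 1 - k by rewrite subr_gt0.
set rho := nu 1 / (1 - k).
have r0 : 0 <= rho by rewrite divr_ge0 ?cn_ge0// ltW.
have rE : nu 1 + k * rho = rho.
  apply: (mulIf (lt0r_neq0 d0)); rewrite mulrDl -mulrA /rho mulfVK ?lt0r_neq0//.
  lra.
have k01 : 0 <= k < 1 by rewrite k0.
have bnd (a : V) : nu a <= k * rho -> nu (1 + a) <= rho.
  by move=> ha; apply: le_trans (cn_D nuC _ _) _; rewrite -[leRHS]rE lerD2l.
have fp := @contraction_fixpoint _ _ nu (cn_D nuC) (cn_N nuC) (cn_eq0 nuC)
  (cn_ge0 nuC) (cn_0 nuC) (cn_complete nuC).
have [||y [yr yE]] := fp (fun y => 1 + x * y) _ _ r0 k01.
- move=> y hy; apply: bnd.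
  by rewrite (le_trans (cn_M nuC _ _))// ler_pM// cn_ge0.
- move=> y z _ _; rewrite opprD addrACA subrr add0r -mulrBr.
  by rewrite (le_trans (cn_M nuC _ _))// ler_wpM2r// cn_ge0.
have [||z [_ zE]] := fp (fun y => 1 + y * x) _ _ r0 k01.
- move=> z hz; apply: bnd.
  by rewrite (le_trans (cn_M nuC _ _))// mulrC ler_pM// cn_ge0.
- move=> a b _ _; rewrite opprD addrACA subrr add0r -mulrBl mulrC.
  by rewrite (le_trans (cn_M nuC _ _))// ler_wpM2l// cn_ge0.
have xy : (1 - x) * y = 1 by rewrite mulrBl mul1r -{1}yE addrK.
have zx : z * (1 - x) = 1 by rewrite mulrBr mulr1 -{1}zE addrK.
have zy : z = y by rewrite -[z]mulr1 -xy mulrA zx mul1r.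
by exists y; rewrite xy -{1}zy zx.
Qed.

End NormedRing.

Section CstarLemmas.
Variables (R : realType) (A : cstarAlgType R).
Implicit Types x y : A.

Lemma cstar_completeE (w : nat -> A) :
  (forall e : R, 0 < e -> exists N : nat, forall m n,
    (N <= m)%N -> (N <= n)%N -> cnorm (w m - w n) < e) ->
  exists l, forall e : R, 0 < e -> exists N : nat, forall n, (N <= n)%N ->
    cnorm (w n - l) < e.
Proof.
move=> /cnorm_complete[l /cvgrPdist_lt hl]; exists l => e /hl[N _ H].
exists N => n /H /=; rewrite sub0r normrN; apply: le_lt_trans; exact: ler_norm.
Qed.

Lemma star0 : star (0 : A) = 0.
Proof. by apply: (addrI (star 0)); rewrite -starD !addr0. Qed.

Lemma starN x : star (- x) = - star x.
Proof. by apply: (addrI (star x)); rewrite -starD !subrr star0. Qed.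

Lemma star1 : star (1 : A) = 1.
Proof. by rewrite -[LHS]mulr1 -{2}[1 : A]starK -starM mulr1 starK. Qed.

Lemma cnorm_le_star x : cnorm x <= cnorm (star x).
Proof.
have [->|/eqP x0] := eqVneq x 0; first by rewrite star0.
have nx : 0 < cnorm x.
  by rewrite lt_def cnorm_ge0 andbT; apply/eqP => /cnorm_eq0.
have := cstarE x; rewrite expr2 => E.
by rewrite -(ler_pM2r nx) -E cnormM.
Qed.

Lemma cnorm_star x : cnorm (star x) = cnorm x.
Proof. by apply/eqP; rewrite eq_le -{2}[x]starK !cnorm_le_star. Qed.

Lemma cnorm1 : cnorm (1 : A) = 1.
Proof.
have := cstarE (1 : A); rewrite star1 mul1r.
have n0 : cnorm (1 : A) != 0.
  by apply/eqP => /cnorm_eq0 /eqP; rewrite oner_eq0.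
by rewrite expr2 => /eqP; rewrite -{1}[cnorm 1]mulr1 (inj_eq (mulfI n0)) => /eqP.
Qed.

Lemma normcR (s : R) : Normc.normc (s%:C)%C = `|s|.
Proof. by rewrite /= expr0n addr0 sqrtr_sqr. Qed.

Lemma cnormZR (s : R) x : cnorm ((s%:C)%C *: x) = `|s| * cnorm x.
Proof. by rewrite cnormZ normcR. Qed.

Lemma cnorm_sum (I : Type) (r : seq I) (P : pred I) (F : I -> A) :
  cnorm (\sum_(i <- r | P i) F i) <= \sum_(i <- r | P i) cnorm (F i).
Proof.
elim/big_rec2: _ => [|i a x _ h]; first by rewrite cnorm0.
by rewrite (le_trans (cnormD _ _))// lerD2l.
Qed.

Lemma unitary_cnorm x : star x * x = 1 -> cnorm x = 1.
Proof.
move=> h; have := cstarE x; rewrite h cnorm1 => /eqP.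
by rewrite eq_sym sqrp_eq1 ?cnorm_ge0// => /eqP.
Qed.

Lemma cstar_fixpoint (F : A -> A) (rho k : R) : 0 <= rho -> 0 <= k < 1 ->
  (forall x, cnorm x <= rho -> cnorm (F x) <= rho) ->
  (forall x y, cnorm x <= rho -> cnorm y <= rho ->
     cnorm (F x - F y) <= k * cnorm (x - y)) ->
  exists x, cnorm x <= rho /\ F x = x.
Proof.
apply: contraction_fixpoint; [exact: cnormD|exact: cnormN|exact: cnorm_eq0|
  exact: cnorm_ge0|exact: cnorm0|exact: cstar_completeE].
Qed.

Lemma cstar_complete_norm : complete_norm (@cnorm R A).
Proof.
by split; [exact: cnormD|exact: cnormN|exact: cnorm_eq0|exact: cnorm_ge0|
  exact: cnorm0|exact: cnormM|exact: cstar_completeE].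
Qed.

(* The fixed point of z |-> (b + z ^+ 2) / 2 is 1 - y. *)
Lemma cstar_sqrt (b : A) : star b = b -> cnorm b < 1 ->
  exists y, star y = y /\ y * y = 1 - b.
Proof.
move=> sb b1; have b0 := cnorm_ge0 b.
pose rho := 1 - Num.sqrt (1 - cnorm b).
have d0 : 0 < 1 - cnorm b by rewrite subr_gt0.
have sq : Num.sqrt (1 - cnorm b) ^+ 2 = 1 - cnorm b by rewrite sqr_sqrtr// ltW.
have s0 : 0 < Num.sqrt (1 - cnorm b) by rewrite sqrtr_gt0.
have s1 : Num.sqrt (1 - cnorm b) <= 1 by rewrite -[leRHS]sqrtr1 ler_wsqrtr// gerBl.
have rho0 : 0 <= rho by rewrite subr_ge0.
have rho1 : 0 <= rho < 1 by rewrite rho0 /rho ltrBlDr ltrDl.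
have rhoE : 2^-1 * (cnorm b + rho * rho) = rho.
  rewrite /rho; move: sq; set s := Num.sqrt _; rewrite expr2 => sq.
  have -> : cnorm b = 1 - s * s by rewrite sq; lra.
  lra.
pose h : R[i] := ((2^-1 : R)%:C)%C.
have nh (y : A) : cnorm (h *: y) = 2^-1 * cnorm y by rewrite /h cnormZR ger0_norm ?invr_ge0 ?ler0n.
pose F (z : A) := h *: (b + z * z).
have Fc (x y : A) : cnorm x <= rho -> cnorm y <= rho ->
    cnorm (F x - F y) <= rho * cnorm (x - y).
  move=> hx hy; rewrite /F -scalerBr nh opprD addrACA subrr add0r.
  have -> : x * x - y * y = x * (x - y) + (x - y) * y.
    by rewrite mulrBr mulrBl addrA subrK.
  have h1 : cnorm (x * (x - y)) <= rho * cnorm (x - y).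
    by rewrite (le_trans (cnormM _ _))// ler_wpM2r// cnorm_ge0.
  have h2 : cnorm ((x - y) * y) <= rho * cnorm (x - y).
    by rewrite (le_trans (cnormM _ _))// mulrC ler_wpM2r// cnorm_ge0.
  have h3 := cnormD (x * (x - y)) ((x - y) * y).
  lra.
have [z hz|z [zb zE]] := @cstar_fixpoint F _ _ rho0 rho1 _ Fc.
  rewrite /F nh -[leRHS]rhoE ler_wpM2l ?invr_ge0//.
  rewrite (le_trans (cnormD _ _))// lerD2l (le_trans (cnormM _ _))//.
  by rewrite ler_pM// ?cnorm_ge0.
have sz : star z = z.
  have szE : F (star z) = star z.
    by rewrite /F -{3}zE /F starZ starD starM sb conjc_real.
  apply/eqP; rewrite -subr_eq0; apply/eqP/cnorm_eq0.
  have : cnorm (star z - z) <= rho * cnorm (star z - z).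
    by have := Fc (star z) z; rewrite szE zE cnorm_star; apply.
  have := cnorm_ge0 (star z - z); case/andP: rho1 => _ rho1 n0 n1.
  by apply/eqP; rewrite eq_le n0 andbT -(@pmulr_rle0 _ (1 - rho)) ?subr_gt0//; lra.
exists (1 - z); split; first by rewrite starD starN star1 sz.
have E : b + z * z = z + z.
  have -> : z + z = (2 : R[i]) *: z by rewrite scaler_nat mulr2n.
  rewrite -{3}zE /F scalerA.
  have -> : 2 * h = 1 :> R[i].
    by rewrite /h fmorphV rmorph_nat mulfV ?pnatr_eq0.
  by rewrite scale1r.
have -> : b = z + z - z * z by rewrite -E addrK.
by rewrite mulrBl mul1r mulrBr mulr1 !opprB opprD !addrA [1 + _ - z]addrAC.
Qed.

End CstarLemmas.

(** * Homotopy invariance of the odd Chern character *)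

Definition o0 : 'I_3 := @Ordinal 3 0 isT.
Definition o1 : 'I_3 := @Ordinal 3 1 isT.
Definition o2 : 'I_3 := @Ordinal 3 2 isT.

Lemma ord3P (j : 'I_3) : [\/ j = o0, j = o1 | j = o2].
Proof.
case: j => [[|[|[|//]]] h].
- by apply: Or31; apply: val_inj.
- by apply: Or32; apply: val_inj.
- by apply: Or33; apply: val_inj.
Qed.

Lemma locally_constant_01 (R : realType) (T : Type) (F : R -> T) :
  (forall t : R, 0 <= t <= 1 -> exists2 d : R, 0 < d &
    forall s : R, 0 <= s <= 1 -> `|s - t| < d -> F s = F t) -> F 1 = F 0.
Proof.
move=> H; pose S := [set t : R | 0 <= t <= 1 /\ forall s, 0 <= s <= t -> F s = F 0]%classic.
have S0 : S 0.
  split; first by rewrite lexx ler01.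
  by move=> s /andP[s0 s1]; congr F; apply/eqP; rewrite eq_le s1.
have hS : has_sup S by split; [exists 0|exists 1 => t [/andP[]]].
have b0 : 0 <= sup S by apply: ub_le_sup => //; case: hS.
have b1 : sup S <= 1 by apply: ge_sup; [exists 0|move=> t [/andP[]]].
have [d d0 Hd] := H (sup S) ltac:(by rewrite b0).
have [t [/andP[t0 t1] tS] tb] := sup_adherent d0 hS.
have tb' : t <= sup S.
  by apply: ub_le_sup; [case: hS|split=> //; rewrite t0].
have Fb : F (sup S) = F 0.
  rewrite -(Hd t) ?t0//; last by rewrite distrC ger0_norm ?subr_ge0//; lra.
  by apply: tS; rewrite t0 lexx.
pose b' := Num.min 1 (sup S + d / 2).
have b'1 : b' <= 1 by rewrite ge_min lexx.
have b'd : b' <= sup S + d / 2 by rewrite ge_min lexx orbT.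
have b'S : S b'.
  split; first by rewrite le_min ler01 b'1 andbT addr_ge0// divr_ge0// ltW.
  move=> s /andP[s0 sb']; have [st|ts] := leP s t; first by apply: tS; rewrite s0.
  rewrite (Hd s) ?Fb// ?s0 ?(le_trans sb')//.
  by rewrite ltr_norml; apply/andP; split; lra.
have := ub_le_sup hS.2 b'S; rewrite ge_min => /orP[le1|]; last by move=> ?; exfalso; lra.
have b1E : sup S = 1 by apply/eqP; rewrite eq_le b1.
by rewrite -b1E.
Qed.

Section Cocycle.
Variables (R : realType) (V : pzRingType) (nu : V -> R).
Hypothesis nuC : complete_norm nu.
Variables (D : 'I_3 -> V -> V -> Prop) (T : V -> R) (K : R) (kap : nat -> V).

Record smooth (p : V) (p1 : 'I_3 -> V) (p2 : 'I_3 -> 'I_3 -> V) : Prop := Smooth {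
  smooth1 : forall j, D j p (p1 j);
  smooth2 : forall j k, D k (p1 j) (p2 k j);
  smooth_sym : forall j k, p2 k j = p2 j k
}.

Record derivations : Prop := Derivations {
  DD : forall j a a' b b', D j a a' -> D j b b' -> D j (a + b) (a' + b');
  DN : forall j a a', D j a a' -> D j (- a) (- a');
  DM : forall j a a' b b', D j a a' -> D j b b' -> D j (a * b) (a' * b + a * b');
  D1 : forall j, D j 1 0;
  Dclosed : forall j a a', (forall e, 0 < e -> exists p p',
    [/\ D j p p', nu (p - a) < e & nu (p' - a') < e]) -> D j a a';
  Ddense : forall a e, 0 < e -> exists p p1 p2, smooth p p1 p2 /\ nu (p - a) < e
}.

Record invariant_trace : Prop := InvariantTrace {
  TD : forall a b, T (a + b) = T a + T b;
  TC : forall a b, T (a * b) = T (b * a);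
  TK : 0 <= K;
  Tle : forall a, `|T a| <= K * nu a;
  TD0 : forall j a a', D j a a' -> T a' = 0
}.

(* A ring has no scalars: kap m plays the role of 1 / m.+1. *)
Record reciprocals : Prop := Reciprocals {
  kapC : forall m a, kap m * a = a * kap m;
  kapE : forall m, kap m *+ m.+1 = 1;
  kap_le : forall m a, nu (kap m * a) <= m.+1%:R^-1 * nu a;
  Dkap : forall m j, D j (kap m) 0
}.

Hypothesis HD : derivations.
Hypothesis HT : invariant_trace.
Hypothesis Hk : reciprocals.

Let nuD := cn_D nuC.
Let nuN := cn_N nuC.
Let nuM := cn_M nuC.
Let nu_ge0 := cn_ge0 nuC.
Let nu0 := cn_0 nuC.

Lemma nuB a b : nu (a - b) <= nu a + nu b.
Proof. by rewrite -(nuN b) nuD. Qed.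

Lemma nuBC a b : nu (a - b) = nu (b - a).
Proof. by rewrite -nuN opprB. Qed.

Lemma D0 j : D j 0 0.
Proof. by have := DD HD (D1 HD j) (DN HD (D1 HD j)); rewrite !subrr. Qed.

Lemma inverse_unique (u r r' : V) : r * u = 1 -> u * r' = 1 -> r = r'.
Proof. by move=> ru ur; rewrite -[r]mulr1 -ur mulrA ru mul1r. Qed.

(* With q close to r and e = 1 - q u, the iterates of p |-> q + e p converge to
   r together with their derivatives. *)
Lemma D_inv j u u' r : D j u u' -> u * r = 1 -> r * u = 1 ->
  D j r (- (r * u' * r)).
Proof.
move=> Du ur ru.
have c0 : 0 < 2 * (nu u + 1) by rewrite mulr_gt0// ltr_wpDl// nu_ge0.
have [q [q1 [_ [/smooth1/(_ j) Dq hq]]]] :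
    exists p p1 p2, smooth p p1 p2 /\ nu (p - r) < (2 * (nu u + 1))^-1.
  by apply: Ddense => //; rewrite invr_gt0.
set q' := q1 j in Dq.
pose e := 1 - q * u; pose e' := - (q' * u + q * u').
have De : D j e e' by have := DD HD (D1 HD j) (DN HD (DM HD Dq Du)); rewrite add0r.
have ne : nu e <= 2^-1.
  have -> : e = (r - q) * u by rewrite mulrBl ru.
  rewrite (le_trans (nuM _ _))// nuBC.
  have -> : 2^-1 = (2 * (nu u + 1))^-1 * (nu u + 1) :> R.
    by rewrite invfM -mulrA mulVf ?mulr1// gt_eqF// ltr_wpDl// nu_ge0.
  by rewrite ler_pM// ?nu_ge0// ?ltW// ltrDl.
set r' := - (r * u' * r).
have rE : r = q + e * r by rewrite mulrBl mul1r -mulrA ur mulr1 addrC subrK.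
have rE' : r' = q' + (e' * r + e * r').
  rewrite /e' /e mulNr mulrDl -mulrA ur mulr1 mulrBl mul1r.
  rewrite {3}/r' mulrN -[q * u * _]mulrA [u * (r * u' * r)]mulrA [u * (r * u')]mulrA ur mul1r.
  by rewrite opprK !mulrA [r' + _]addrC [X in q' + X]addrA opprD subrK addNKr.
pose F (p : V * V) := (q + e * p.1, q' + (e' * p.1 + e * p.2)).
pose P m := iter m F (q, q').
have DP m : D j (P m).1 (P m).2.
  by elim: m => [|m IH]//=; apply: (DD HD Dq); exact: DM.
pose L := 4 * nu e' + 1.
have L1 : 1 <= L by rewrite lerDr mulr_ge0// nu_ge0.
pose w m := nu ((P m).2 - r') + L * nu ((P m).1 - r).
have w0 m : 0 <= w m by rewrite addr_ge0 ?mulr_ge0 ?nu_ge0// (le_trans ler01).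
have wS m : w m.+1 <= 3 / 4 * w m.
  rewrite /w; set x := (P m).1 - r; set y := (P m).2 - r'.
  have -> : (P m.+1).1 - r = e * x by rewrite {1}rE /= opprD addrACA subrr add0r -mulrBr.
  have -> : (P m.+1).2 - r' = e' * x + e * y.
    by rewrite {1}rE' /= opprD addrACA subrr add0r opprD addrACA -!mulrBr.
  have h1 : nu (e' * x) <= nu e' * nu x := nuM _ _.
  have h2 : nu (e * y) <= 2^-1 * nu y.
    by rewrite (le_trans (nuM _ _))// ler_wpM2r// nu_ge0.
  have h3 : L * nu (e * x) <= L * (2^-1 * nu x).
    rewrite ler_wpM2l// ?(le_trans ler01)// (le_trans (nuM _ _))//.
    by rewrite ler_wpM2r// nu_ge0.
  have h4 := nuD (e' * x) (e * y).
  have h5 : nu e' * nu x * 4 <= L * nu x by rewrite /L; have := nu_ge0 x; lra.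
  have := nu_ge0 y; lra.
apply: (Dclosed HD) => eps eps0.
have k01 : 0 <= (3 / 4 : R) < 1 by apply/andP; split; lra.
have e1 : 0 < eps / (w 0 + 1) by rewrite divr_gt0// ltr_wpDl.
have [m /(_ m (leqnn _)) hm] := expr_lt_eps k01 e1.
have wm : w m < eps.
  have : w m <= (3 / 4) ^+ m * w 0.
    elim: m {hm} => [|m IH]; first by rewrite mul1r.
    by apply: le_trans (wS m) _; rewrite exprS -[leRHS]mulrA ler_wpM2l//; lra.
  move=> /le_lt_trans; apply; move: hm; rewrite ltr_pdivlMr ?ltr_wpDl//.
  apply: le_lt_trans; rewrite ler_wpM2l ?exprn_ge0//; first lra.
  by rewrite lerDl.
exists (P m).1, (P m).2; split=> //; apply: le_lt_trans wm; rewrite /w.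
  have := nu_ge0 ((P m).2 - r'); have := nu_ge0 ((P m).1 - r); nra.
by rewrite lerDl mulr_ge0 ?nu_ge0// (le_trans ler01).
Qed.

Lemma smoothD p p1 p2 q q1 q2 : smooth p p1 p2 -> smooth q q1 q2 ->
  smooth (p + q) (fun j => p1 j + q1 j) (fun k j => p2 k j + q2 k j).
Proof.
move=> [a b c] [a' b' c']; split=> [j|j k|j k]; try exact: DD.
by rewrite c c'.
Qed.

Lemma smooth1_cst : smooth 1 (fun=> 0) (fun _ _ => 0).
Proof. by split=> //= [j|j k]; [exact: D1|exact: D0]. Qed.

Lemma smooth_kap m : smooth (kap m) (fun=> 0) (fun _ _ => 0).
Proof. by split=> //= [j|j k]; [exact: Dkap|exact: D0]. Qed.

Lemma smoothM p p1 p2 q q1 q2 : smooth p p1 p2 -> smooth q q1 q2 ->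
  smooth (p * q) (fun j => p1 j * q + p * q1 j)
    (fun k j => (p2 k j * q + p1 j * q1 k) + (p1 k * q1 j + p * q2 k j)).
Proof.
move=> [a b c] [a' b' c']; split=> [j|j k|j k]; first exact: DM.
  by apply: DD => //; exact: DM.
by rewrite c c' addrACA [p1 j * q1 k + _]addrC addrACA.
Qed.

Lemma smoothV p p1 p2 r : smooth p p1 p2 -> p * r = 1 -> r * p = 1 ->
  exists r2, smooth r (fun j => - (r * p1 j * r)) r2.
Proof.
move=> [a b c] pr rp; have Dr j := D_inv (a j) pr rp.
exists (fun k j => - ((- (r * p1 k * r) * p1 j + r * p2 k j) * r +
  r * p1 j * (- (r * p1 k * r)))).
split=> // j k; first by apply: (DN HD); apply: DM => //; exact: DM.
congr (- _); rewrite c !mulrDl !mulNr !mulrN !mulrA.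
by rewrite [LHS]addrAC [RHS]addrAC; congr (_ + _); rewrite addrC.
Qed.

(* The odd Chern character of p is the value at w j = p^-1 * D_j p. *)
Definition chern (w : 'I_3 -> V) : R := T (w o0 * (w o1 * w o2 - w o2 * w o1)).

Let T0 : T 0 = 0.
Proof. by have := TD HT 0 0; rewrite addr0; lra. Qed.

Let TN a : T (- a) = - T a.
Proof. by have := TD HT a (- a); rewrite subrr T0; lra. Qed.

Let T3C a b c : T (a * b * c) = T (b * c * a).
Proof. by rewrite -mulrA (TC HT). Qed.

Lemma chern_conj w v r : v * r = 1 -> r * v = 1 ->
  chern (fun j => r * w j * v) = chern w.
Proof.
move=> vr rv; rewrite /chern !mulrBr !(TD HT) !TN.
have E a b c : T (r * a * v * (r * b * v * (r * c * v))) = T (a * (b * c)).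
  have -> : r * a * v * (r * b * v * (r * c * v)) = r * (a * (b * c)) * v.
    rewrite !mulrA -[r * a * v * r]mulrA vr mulr1.
    by rewrite -[r * a * b * v * r]mulrA vr mulr1.
  by rewrite -mulrA (TC HT) -mulrA vr mulr1.
by rewrite !E.
Qed.

(* The mixed terms of the cubic form are the trace of the derivation of the
   products th_j * om_l. *)
Lemma chernD om om' th th' :
  (forall j k, D k (om j) (om' k j)) -> (forall j k, D k (th j) (th' k j)) ->
  (forall j k, om' k j - om' j k = om j * om k - om k * om j) ->
  (forall j k, th' k j - th' j k = th k * th j - th j * th k) ->
  chern (fun j => om j + th j) = chern om + chern th.
Proof.
move=> Dom Dth fom fth.
have part j k l : T (th' k j * om l) + T (th j * om' k l) = 0.
  by rewrite -(TD HT); exact: (TD0 HT) (DM HD (Dth j k) (Dom l k)).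
have f1 j k l : T (th j * om' k l) - T (th j * om' l k) =
    T (th j * om l * om k) - T (th j * om k * om l).
  by rewrite -TN -(TD HT) -mulrN -mulrDr fom mulrBr !mulrA (TD HT) TN.
have f2 j k l : T (th' k l * om j) - T (th' l k * om j) =
    T (om j * th k * th l) - T (om j * th l * th k).
  by rewrite -TN -(TD HT) -mulNr -mulrDl fth mulrBl (TD HT) TN
    !(T3C (om j)).
have := (part o0 o1 o2, part o0 o2 o1, part o1 o0 o2, part o1 o2 o0,
  part o2 o0 o1, part o2 o1 o0, (f1 o0 o1 o2, f1 o1 o2 o0, f1 o2 o0 o1,
  f2 o0 o1 o2, f2 o1 o2 o0, f2 o2 o0 o1)).
rewrite /chern !(mulrBr, mulrDl, mulrDr, mulrA, opprD, TD HT, TN).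
rewrite (T3C (om o0) (th o1) (om o2)) (T3C (th o0) (om o1) (th o2)).
rewrite (T3C (om o0) (th o2) (om o1)) (T3C (th o0) (om o2) (th o1)).
rewrite -(T3C (om o2) (th o0) (th o1)) -(T3C (om o1) (th o0) (th o2)).
rewrite -(T3C (th o2) (om o0) (om o1)) -(T3C (th o1) (om o0) (om o2)).
by case; case; case; case; case; case; move=> -[? ?] ? ? ? ? [[[[[? ?] ?] ?] ?] ?]; lra.
Qed.

Lemma chernM p p1 p2 v v1 v2 r rv : smooth p p1 p2 -> smooth v v1 v2 ->
  p * r = 1 -> r * p = 1 -> v * rv = 1 -> rv * v = 1 ->
  chern (fun j => rv * r * (p1 j * v + p * v1 j)) =
  chern (fun j => r * p1 j) + chern (fun j => rv * v1 j).
Proof.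
move=> [p_a p_b p_c] [v_a v_b v_c] pr rp vr rv1.
have Dr j := D_inv (p_a j) pr rp; have Drv j := D_inv (v_a j) vr rv1.
have conj1 : chern (fun j => rv * v1 j) = chern (fun j => v1 j * rv).
  rewrite -(chern_conj (fun j => v1 j * rv) vr rv1); congr (chern _).
  by apply/funext => j; rewrite mulrA -mulrA rv1 mulr1.
have -> : (fun j => rv * r * (p1 j * v + p * v1 j)) =
    (fun j => rv * (r * p1 j + v1 j * rv) * v).
  apply/funext => j; rewrite mulrDr mulrDr mulrDl !mulrA; congr (_ + _).
  by rewrite -[rv * r * p]mulrA rp mulr1 -[_ * rv * v]mulrA rv1 mulr1.
rewrite (chern_conj (fun j => r * p1 j + v1 j * rv) vr rv1) conj1.
apply: (@chernD _ (fun k j => - (r * p1 k * r) * p1 j + r * p2 k j) _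
  (fun k j => v2 k j * rv + v1 j * - (rv * v1 k * rv))) => j k.
- exact: DM.
- exact: DM.
- rewrite p_c opprD addrACA subrr addr0 !mulNr opprK addrC !mulrA.
  by [].
- by rewrite v_c opprD addrACA subrr add0r !mulrN opprK addrC !mulrA.
Qed.

Lemma chern_le w : `|chern w| <= 2 * K * (nu (w o0) * nu (w o1) * nu (w o2)).
Proof.
have le3 a b c : `|T (a * b * c)| <= K * (nu a * nu b * nu c).
  rewrite (le_trans (Tle HT _))// ler_wpM2l ?(TK HT)//.
  by rewrite (le_trans (nuM _ _))// ler_wpM2r// nu_ge0.
rewrite /chern mulrBr (TD HT) TN !mulrA.
have := le3 (w o0) (w o1) (w o2); have := le3 (w o0) (w o2) (w o1).
rewrite [_ * nu (w o2) * _]mulrAC !ler_norml => /andP[? ?] /andP[? ?].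
apply/andP; split; lra.
Qed.

Lemma inverse_near p q r : p * r = 1 -> r * p = 1 ->
  nu r * nu (q - p) <= 2^-1 ->
  exists s, [/\ q * s = 1, s * q = 1 & nu s <= 2 * nu 1 * nu r].
Proof.
move=> pr rp le2; have lt1 : (2^-1 : R) < 1 by lra.
have [|y [xy yx ny]] := neumann nuC (x := - (r * (q - p))) lt1.
  by rewrite nuN (le_trans (nuM _ _)).
have qE : q = p * (1 - - (r * (q - p))).
  by rewrite opprK mulrDr mulr1 mulrA pr mul1r addrC subrK.
exists (y * r); split.
- by rewrite {1}qE mulrA -[p * _ * y]mulrA xy mulr1.
- by rewrite {1}qE mulrA -[y * r * p]mulrA rp mulr1 yx.
- rewrite (le_trans (nuM _ _))// ler_wpM2r ?nu_ge0// (le_trans ny)//.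
  have -> : 1 - 2^-1 = 2^-1 :> R by lra.
  by rewrite invrK mulrC.
Qed.

Lemma smooth_kapn m i : smooth (kap m *+ i) (fun=> 0) (fun _ _ => 0).
Proof.
elim: i => [|i IH]; first by split=> [j|j k|]//=; exact: D0.
rewrite mulrS; have := smoothD (smooth_kap m) IH.
by rewrite addr0.
Qed.

Lemma smooth_mul_cst a p p1 p2 : (forall j, D j a 0) -> smooth p p1 p2 ->
  smooth (a * p) (fun j => a * p1 j) (fun k j => a * p2 k j).
Proof.
move=> Da [h1 h2 h3]; split=> [j|j k|j k]; last by rewrite h3.
- by have := DM HD (Da j) (h1 j); rewrite mul0r add0r.
- by have := DM HD (Da k) (h2 j k); rewrite mul0r add0r.
Qed.

Lemma smooth_scale m i h h1 h2 : smooth h h1 h2 ->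
  smooth (kap m *+ i * h) (fun j => kap m *+ i * h1 j)
    (fun k j => kap m *+ i * h2 k j).
Proof. by apply: smooth_mul_cst; case: (smooth_kapn m i). Qed.

Lemma smoothB p p1 p2 q q1 q2 : smooth p p1 p2 -> smooth q q1 q2 ->
  smooth (p - q) (fun j => p1 j - q1 j) (fun k j => p2 k j - q2 k j).
Proof.
move=> sp [a b c]; apply: smoothD => //; split=> [j|j k|j k]; try exact: DN.
by rewrite c.
Qed.

Lemma kapn_le m i a : (i <= m.+1)%N -> nu (kap m *+ i * a) <= nu a.
Proof.
move=> im; rewrite mulrnAl.
have le : nu ((kap m * a) *+ i) <= i%:R * (m.+1%:R^-1 * nu a).
  elim: i {im} => [|i IH]; first by rewrite mulr0n nu0 mul0r.
  rewrite mulrS (le_trans (nuD _ _))// -natr1 mulrDl mul1r addrC lerD//.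
  exact: kap_le.
apply: le_trans le _; rewrite mulrA ler_piMl ?nu_ge0//.
by rewrite ler_pdivrMr ?ltr0n// mul1r ler_nat.
Qed.

Lemma chern_step p p1 p2 h h1 h2 m s s' : smooth p p1 p2 -> smooth h h1 h2 ->
  p * s = 1 -> s * p = 1 ->
  (p + kap m * h) * s' = 1 -> s' * (p + kap m * h) = 1 ->
  chern (fun j => s' * (p1 j + kap m * h1 j)) = chern (fun j => s * p1 j) +
    chern (fun j => s' * p * (kap m * (s * (h1 j - p1 j * s * h)))).
Proof.
move=> sp sh ps sp1 qs sq; have [s2 ss] := smoothV sp ps sp1.
have := smoothD smooth1_cst (smoothM ss (smooth_scale m 1 sh)).
rewrite mulr1n; set v := 1 + _; set v1 := fun j => _; set v2 := fun k j => _ => sv.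
have vE : v = s * (p + kap m * h) by rewrite mulrDr sp1.
have v1E j : v1 j = kap m * (s * (h1 j - p1 j * s * h)).
  rewrite /v1 add0r mulrBr mulrBr addrC; congr (_ + _).
    by rewrite !mulrA -(kapC Hk).
  by rewrite mulNr; congr (- _); rewrite !mulrA -(kapC Hk) !mulrA.
have qE : p + kap m * h = p * v by rewrite vE mulrA ps mul1r.
have vr : v * (s' * p) = 1.
  by rewrite mulrA vE -[s * _ * s']mulrA qs mulr1.
have rv : s' * p * v = 1 by rewrite -mulrA -qE sq.
have := chernM sp sv ps sp1 vr rv.
have -> : (fun j => s' * p * s * (p1 j * v + p * v1 j)) =
    (fun j => s' * (p1 j + kap m * h1 j)).
  apply/funext => j; rewrite -[s' * p * s]mulrA ps mulr1; congr (_ * _).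
  rewrite v1E vE 2!mulrDr mulrA -addrA; rewrite -[p1 j * s * p]mulrA sp1 mulr1.
  congr (_ + _); rewrite mulrBr mulrBr mulrBr.
  have -> : p * (kap m * (s * h1 j)) = kap m * h1 j.
    by rewrite mulrA -(kapC Hk) -mulrA (mulrA p) ps mul1r.
  have -> : p * (kap m * (s * (p1 j * s * h))) = p1 j * s * (kap m * h).
    rewrite mulrA -(kapC Hk) -mulrA (mulrA p) ps mul1r.
    by rewrite !mulrA -(kapC Hk) !mulrA.
  by rewrite [p1 j * (s * _)]mulrA addrC subrK.
by move=> ->; congr (_ + chern _); apply/funext => j; rewrite v1E.
Qed.

Lemma chern_segment p p1 p2 q q1 q2 r s : smooth p p1 p2 -> smooth q q1 q2 ->
  p * r = 1 -> r * p = 1 -> nu r * nu (q - p) <= 2^-1 ->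
  q * s = 1 -> s * q = 1 ->
  chern (fun j => s * q1 j) = chern (fun j => r * p1 j).
Proof.
move=> sp sq pr rp le2 qs sq1.
have := smoothB sq sp; set h := q - p; set h1 := fun j => _; set h2 := fun k j => _ => sh.
pose Z := 1 + 2 * nu 1 * nu r + nu p + nu h + \sum_j (nu (p1 j) + nu (h1 j)).
have S0 (j : 'I_3) : nu (p1 j) + nu (h1 j) <= \sum_j (nu (p1 j) + nu (h1 j)).
  by rewrite (bigD1 j)//= lerDl sumr_ge0// => i _; rewrite addr_ge0.
have n1r : 0 <= 2 * nu 1 * nu r by rewrite !mulr_ge0.
have [np nh] := (nu_ge0 p, nu_ge0 h).
have Zp1 j : nu (p1 j) + nu (h1 j) <= Z by have := S0 j; rewrite /Z; lra.
have ZS : 0 <= \sum_j (nu (p1 j) + nu (h1 j)).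
  by apply: sumr_ge0 => i _; rewrite addr_ge0.
have Z1 : 1 <= Z by rewrite /Z; lra.
have Z0 : 0 <= Z by lra.
pose E := Z * Z * (Z * (Z + Z * Z * Z)).
have E0 : 0 <= E by rewrite /E !mulr_ge0// addr_ge0// !mulr_ge0.
pose B := 2 * K * (E * E * E).
have K0 := TK HT.
have B0 : 0 <= B.
  have h3 (x : R) : 0 <= x -> 0 <= x * x * x by move=> x0; rewrite !mulr_ge0.
  by apply: mulr_ge0; [rewrite mulr_ge0|exact: h3].
suff H m : `|chern (fun j => s * q1 j) - chern (fun j => r * p1 j)| <= B / m.+1%:R.
  apply/eqP; rewrite -subr_eq0 -normr_le0; apply: le_eps => e e0.
  have [m] := ltr_add_invr (y := 0) (x := e / (B + 1)) ltac:(by rewrite divr_gt0// ltr_wpDl).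
  rewrite !add0r => hm; apply: le_lt_trans (H m) _.
  move: hm; rewrite ltr_pdivlMr ?ltr_wpDl// mulrC; apply: le_lt_trans.
  by rewrite ler_wpM2r ?invr_ge0// lerDl.
pose u i := p + kap m *+ i * h; pose u1 i j := p1 j + kap m *+ i * h1 j.
have su i := smoothD sp (smooth_scale m i sh).
have near i : (i <= m.+1)%N -> exists s, [/\ u i * s = 1, s * u i = 1 & nu s <= Z].
  move=> im; have [|t [t1 t2 t3]] := @inverse_near p (u i) r pr rp.
    apply: le_trans le2; rewrite /u [p + _]addrC addrK ler_wpM2l ?nu_ge0//.
    exact: kapn_le.
  exists t; split=> //; apply: le_trans t3 _; rewrite /Z; lra.
have uS i : u i.+1 = u i + kap m * h by rewrite /u mulrSr mulrDl addrA.
have u1S i j : u1 i.+1 j = u1 i j + kap m * h1 j by rewrite /u1 mulrSr mulrDl addrA.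
have step i t t' : (i <= m)%N -> u i * t = 1 -> t * u i = 1 -> nu t <= Z ->
    u i.+1 * t' = 1 -> t' * u i.+1 = 1 -> nu t' <= Z ->
    `|chern (fun j => t' * u1 i.+1 j) - chern (fun j => t * u1 i j)| <=
      B * (m.+1%:R^-1) ^+ 3.
  move=> im ut tu tZ ut' tu' tZ'; move: ut' tu'; rewrite uS => ut' tu'.
  have -> : (fun j => t' * u1 i.+1 j) = (fun j => t' * (u1 i j + kap m * h1 j)).
    by apply/funext => j; rewrite u1S.
  rewrite (chern_step (su i) sh ut tu ut' tu') addrC addKr.
  have bnd j : nu (t' * u i * (kap m * (t * (h1 j - u1 i j * t * h)))) <= m.+1%:R^-1 * E.
    have le_u : nu (u i) <= Z.
      rewrite /u (le_trans (nuD _ _))//.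
      by have := @kapn_le m i h (leqW im); rewrite /Z; lra.
    have le_u1 : nu (u1 i j) <= Z.
      rewrite /u1 (le_trans (nuD _ _))//.
      by have := @kapn_le m i (h1 j) (leqW im); have := Zp1 j; lra.
    rewrite (le_trans (nuM _ _))//.
    have -> : m.+1%:R^-1 * E = Z * Z * (m.+1%:R^-1 * (Z * (Z + Z * Z * Z))).
      by rewrite /E; ring.
    rewrite ler_pM ?nu_ge0//.
      by rewrite (le_trans (nuM _ _))// ler_pM ?nu_ge0.
    rewrite (le_trans (kap_le Hk _ _))// ler_wpM2l ?invr_ge0//.
    rewrite (le_trans (nuM _ _))// ler_pM ?nu_ge0//.
    rewrite (le_trans (nuB _ _))// lerD//.
      by have := Zp1 j; have := nu_ge0 (p1 j); lra.
    rewrite (le_trans (nuM _ _))// ler_pM ?nu_ge0//; last by rewrite /Z; lra.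
    by rewrite (le_trans (nuM _ _))// ler_pM ?nu_ge0.
  apply: le_trans (chern_le _) _.
  have -> : B * m.+1%:R^-1 ^+ 3 = 2 * K *
    ((m.+1%:R^-1 * E) * (m.+1%:R^-1 * E) * (m.+1%:R^-1 * E)) by rewrite /B; ring.
  rewrite ler_wpM2l ?mulr_ge0//.
  by rewrite ler_pM ?mulr_ge0 ?nu_ge0// ler_pM ?nu_ge0.
have uniq i t t' : u i * t = 1 -> t' * u i = 1 -> t' = t.
  by move=> h1' h2'; exact: inverse_unique h2' h1'.
have ind i t : (i <= m.+1)%N -> u i * t = 1 -> t * u i = 1 ->
    `|chern (fun j => t * u1 i j) - chern (fun j => r * p1 j)| <=
      i%:R * (B * (m.+1%:R^-1) ^+ 3).
  elim: i t => [|i IH] t im ut tu.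
    have -> : t = r.
      by apply: (inverse_unique (u := p)) => //; move: tu; rewrite /u mulr0n mul0r addr0.
    have -> : (fun j => r * u1 0 j) = (fun j => r * p1 j).
      by apply/funext => j; rewrite /u1 mulr0n mul0r addr0.
    by rewrite subrr normr0 mul0r.
  have [t0 [ut0 tu0 t0Z]] := near i (ltnW im).
  have [t1 [ut1 tu1 t1Z]] := near _ im.
  have tE : t1 = t by apply: uniq ut tu1.
  rewrite -tE -natr1 mulrDl mul1r [leRHS]addrC.
  rewrite -(subrK (chern (fun j => t0 * u1 i j)) (chern (fun j => t1 * _ j))) -addrA.
  rewrite (le_trans (ler_normD _ _))// lerD//; first exact: step.
  exact: IH (ltnW im) ut0 tu0.
have uE : u m.+1 = q by rewrite /u (kapE Hk) mul1r addrC subrK.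
have u1E : (fun j => s * u1 m.+1 j) = (fun j => s * q1 j).
  by apply/funext => j; rewrite /u1 (kapE Hk) mul1r [p1 j + _]addrC subrK.
have := ind m.+1 s (leqnn _); rewrite uE u1E => /(_ qs sq1) /le_trans; apply.
have -> : m.+1%:R * (B * m.+1%:R^-1 ^+ 3) = B / m.+1%:R * m.+1%:R^-1 :> R.
  by field; rewrite addrC natr1 pnatr_eq0.
rewrite ler_piMr ?divr_ge0// invf_le1 ?ltr0n// ler1n//.
Qed.

Lemma chern_path (f : R -> V) p p1 p2 r :
  (forall t, 0 <= t <= 1 -> exists g, f t * g = 1 /\ g * f t = 1) ->
  (forall t, 0 <= t <= 1 -> forall e, 0 < e -> exists2 d, 0 < d &
    forall s, 0 <= s <= 1 -> `|s - t| < d -> nu (f s - f t) < e) ->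
  f 0 = p -> f 1 = 1 -> smooth p p1 p2 -> p * r = 1 -> r * p = 1 ->
  chern (fun j => r * p1 j) = 0.
Proof.
move=> finv fcont f0 f1 sp pr rp.
pose Good t c e := forall q q1 q2 s, smooth q q1 q2 -> q * s = 1 -> s * q = 1 ->
  nu (q - f t) < e -> chern (fun j => s * q1 j) = c.
have good t : 0 <= t <= 1 -> exists e, [/\ 0 < e, exists c, Good t c e &
    forall q, nu (q - f t) < e -> exists s, q * s = 1 /\ s * q = 1].
  move=> /finv[g [fg gf]].
  have n1 := nu_ge0 1; have ng := nu_ge0 g.
  pose e := (8 * (nu 1 + 1) * (nu g + 1))^-1.
  have e0 : 0 < e by rewrite invr_gt0 !mulr_gt0// ltr_wpDl.
  have eE : e * (8 * (nu 1 + 1) * (nu g + 1)) = 1.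
    by rewrite mulVf// gt_eqF// -invr_gt0.
  have near q : nu (q - f t) < e ->
      exists s, [/\ q * s = 1, s * q = 1 & nu s <= 2 * nu 1 * nu g].
    move=> hq; apply: (inverse_near fg gf).
    apply: le_trans (_ : nu g * e <= _); first by rewrite ler_wpM2l// ltW.
    nra.
  exists e; split=> //; last by move=> q /near[s [? ? _]]; exists s.
  have [q [q1 [q2 [sq hq]]]] := Ddense HD (f t) e0.
  have [s [qs sq1 ns]] := near _ hq.
  exists (chern (fun j => s * q1 j)) => q' q1' q2' s' sq' qs' sq1' hq'.
  apply: chern_segment sq sq' qs sq1 _ qs' sq1'.
  have hqq : nu (q' - q) <= 2 * e.
    have -> : q' - q = (q' - f t) - (q - f t) by rewrite opprB addrA subrK.
    by apply: le_trans (nuB _ _) _; lra.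
  apply: le_trans (ler_pM (nu_ge0 _) (nu_ge0 _) ns hqq) _.
  nra.
pose Val t c := exists2 e, 0 < e & Good t c e.
have Val_uniq t c c' : 0 <= t <= 1 -> Val t c -> Val t c' -> c = c'.
  move=> t01 [e e0 h] [e' e0' h']; have [e1 [e10 _ hi]] := good t t01.
  pose em := Num.min e1 (Num.min e e').
  have em0 : 0 < em by rewrite !lt_min e10 e0 e0'.
  have [q [q1 [q2 [sq hq]]]] := Ddense HD (f t) em0.
  move: hq; rewrite !lt_min => /and3P[q_1 q_2 q_3].
  have [s [qs sq1]] := hi _ q_1.
  by rewrite -(h _ _ _ _ sq qs sq1 q_2) -(h' _ _ _ _ sq qs sq1 q_3).
have Val_ex t : exists c, 0 <= t <= 1 -> Val t c.
  have [/good[e [e0 [c hc] _]]|n] := boolP (0 <= t <= 1); last by exists 0.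
  by exists c => _; exists e.
have [F FV] := choice Val_ex.
have loc t : 0 <= t <= 1 -> exists2 d, 0 < d &
    forall s, 0 <= s <= 1 -> `|s - t| < d -> F s = F t.
  move=> t01; have [e e0 he] := FV t t01.
  have e20 : 0 < e / 2 by rewrite divr_gt0.
  have [d d0 hd] := fcont t t01 _ e20; exists d => // s s01 sd.
  apply: (Val_uniq s) => //; first exact: FV.
  exists (e / 2) => // q q1 q2 u sq qu uq hq; apply: (he _ _ _ _ sq qu uq).
  have -> : q - f t = (q - f s) + (f s - f t) by rewrite addrA subrK.
  by rewrite (le_lt_trans (nuD _ _))// [ltRHS]splitr ltrD// hd.
have z01 : 0 <= (0 : R) <= 1 by rewrite lexx ler01.
have o01 : 0 <= (1 : R) <= 1 by rewrite ler01 lexx.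
have F0 : chern (fun j => r * p1 j) = F 0.
  have [e e0 he] := FV 0 z01; apply: he sp pr rp _.
  by rewrite f0 subrr nu0.
have F1 : chern (fun j => 1 * (fun=> 0) j) = F 1.
  have [e e0 he] := FV 1 o01; apply: he smooth1_cst (mul1r 1) (mul1r 1) _.
  by rewrite f1 subrr nu0.
rewrite F0 -(locally_constant_01 loc) -F1 /chern !mul1r mul0r.
exact: T0.
Qed.

End Cocycle.

(** * Almost periodic functions on Z^3 *)

Lemma frac_le (R : realType) (B e : R) : 0 <= B -> 0 < e -> B * (e / (B + 1)) <= e.
Proof.
move=> B0 e0; rewrite mulrCA ler_piMr ?(ltW e0)// ler_pdivrMr ?ltr_wpDl//.
by rewrite mul1r lerDl.
Qed.

Section AlmostPeriodic.
Variable R : realType.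
Local Notation C := R[i].
Local Notation normc := (@Normc.normc R).
Local Notation I := ('i%C : C).

Lemma normc_ge0 (z : C) : 0 <= normc z.
Proof. by case: z => a b; exact: sqrtr_ge0. Qed.

Lemma normc_eq0 (z : C) : (normc z == 0) = (z == 0).
Proof.
by apply/eqP/eqP => [/Normc.eq0_normc|->]; rewrite ?Normc.normc0.
Qed.

Lemma normc_Re (z : C) : `|complex.Re z| <= normc z.
Proof.
case: z => a b /=; rewrite -sqrtr_sqr ler_wsqrtr// lerDl; exact: sqr_ge0.
Qed.

Lemma normc_sum (J : Type) (r : seq J) (P : pred J) (F : J -> C) :
  normc (\sum_(i <- r | P i) F i) <= \sum_(i <- r | P i) normc (F i).
Proof.
elim/big_rec2: _ => [|i a x _ h]; first by rewrite Normc.normc0.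
by rewrite (le_trans (le_normcD _ _))// lerD2l.
Qed.

Lemma normc_conj (z : C) : normc (conjc z) = normc z.
Proof. by case: z => a b /=; rewrite sqrrN. Qed.

Lemma normcB (z w : C) : normc (z - w) = normc (w - z).
Proof. by rewrite -normcN opprB. Qed.

Lemma normcX (z : C) n : normc (z ^+ n) = normc z ^+ n.
Proof.
elim: n => [|n IH]; first by rewrite !expr0 Normc.normc1.
by rewrite !exprS Normc.normcM IH.
Qed.

(* A point of infinite order of the unit circle. *)
Definition circle_pt : C := (3 / 5 +i* (4 / 5))%C.

Lemma normc_circle_pt : normc circle_pt = 1.
Proof. by rewrite /= -[RHS]sqrtr1; congr Num.sqrt; field. Qed.

Lemma circle_pt_neq0 : circle_pt != 0.
Proof. by rewrite -normc_eq0 normc_circle_pt oner_eq0. Qed.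

(* (3 + 4i)^n is congruent to 3 + 4i modulo 5. *)
Lemma circle_ptX n : exists a b : int, circle_pt ^+ n.+1 * 5 ^+ n.+1 =
  ((5 * a + 3)%:~R +i* (5 * b + 4)%:~R)%C.
Proof.
have u5 : circle_pt * 5 = (3 +i* 4)%C.
  have -> : (5 : C) = (5 : R)%:C%C by rewrite rmorph_nat.
  by apply/eqP; rewrite eq_complex /= !mulr0 subr0 add0r; apply/andP; split; apply/eqP; field.
elim: n => [|n [a [b IH]]].
  by exists 0, 0; rewrite !expr1 u5 !mulr0 !add0r.
rewrite !(exprSr _ n.+1) mulrACA IH u5.
exists (3 * a - 4 * b - 2), (4 * a + 3 * b + 4).
by apply/eqP; rewrite eq_complex /= !(rmorphD, rmorphM, rmorphB, rmorphN) /=; apply/andP; split; apply/eqP; ring.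
Qed.

Lemma circle_ptX_neq1 n : (0 < n)%N -> circle_pt ^+ n != 1.
Proof.
case: n => // n _; apply/eqP => E; have [a [b]] := circle_ptX n.
rewrite E mul1r -natrX -[_%:R](rmorph_nat (real_complex R)) => /eqP.
rewrite eq_complex /= => /andP[_]; rewrite eq_sym intr_eq0 => /eqP.
lia.
Qed.

Lemma uuXz_neq1 (z : int) : z != 0 -> circle_pt ^ z != 1.
Proof.
case: z => [n|n]; first by rewrite -exprnP => n0; apply: circle_ptX_neq1; lia.
by move=> _; rewrite NegzE -exprnN invr_eq1 circle_ptX_neq1.
Qed.

Lemma normc_uuXz (z : int) : normc (circle_pt ^ z) = 1.
Proof.
case: z => [n|n]; first by rewrite -exprnP normcX normc_circle_pt expr1n.
by rewrite NegzE -exprnN Normc.normcV normcX normc_circle_pt expr1n invr1.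
Qed.

Lemma normc1_conj (z : C) : normc z = 1 -> conjc z = z^-1.
Proof.
case: z => a b /= h; have {}h : a ^+ 2 + b ^+ 2 = 1.
  have : Num.sqrt (a ^+ 2 + b ^+ 2) ^+ 2 = 1 by rewrite h expr1n.
  by rewrite sqr_sqrtr// addr_ge0// sqr_ge0.
have z0 : (a +i* b)%C != 0.
  rewrite eq_complex /=; apply/negP => /andP[/eqP a0 /eqP b0].
  by move: h; rewrite a0 b0 expr0n addr0 => /eqP; rewrite eq_sym oner_eq0.
apply: (mulfI z0); rewrite mulfV//; apply/eqP; rewrite eq_complex /=.
by rewrite !mulrN opprK -!expr2 h eqxx [b * a]mulrC addNr eqxx.
Qed.

Local Notation X := 'cV[int]_3.
Local Notation X' := 'rV[int]_3.

(* chi k is the character k of the torus T^3, restricted to the dense subgroup of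
   the points (circle_pt ^ x_0, circle_pt ^ x_1, circle_pt ^ x_2). *)
Definition chi (k : X') (x : X) : C := circle_pt ^ ((k *m x) 0 0).

Lemma chiD k l x : chi (k + l) x = chi k x * chi l x.
Proof. by rewrite /chi mulmxDl mxE expfzDr ?circle_pt_neq0. Qed.

Lemma chi0 x : chi 0 x = 1.
Proof. by rewrite /chi mul0mx mxE expr0z. Qed.

Lemma normc_chi k x : normc (chi k x) = 1.
Proof. exact: normc_uuXz. Qed.

Lemma chi_neq0 k x : chi k x != 0.
Proof. by rewrite -normc_eq0 normc_chi oner_eq0. Qed.

Lemma chiN k x : chi (- k) x = (chi k x)^-1.
Proof.
by apply: (mulIf (chi_neq0 k x)); rewrite -chiD addNr chi0 mulVf ?chi_neq0.
Qed.

Lemma chi_conj k x : conjc (chi k x) = chi (- k) x.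
Proof. by rewrite chiN normc1_conj ?normc_chi. Qed.

Lemma chi_comp k (M : 'M[int]_3) x : chi k (M *m x) = chi (k *m M) x.
Proof. by rewrite /chi mulmxA. Qed.

Definition trig (l : seq (C * X')) (x : X) : C := \sum_(t <- l) t.1 * chi t.2 x.

Definition trig_der (j : 'I_3) (l : seq (C * X')) : seq (C * X') :=
  [seq (I * (t.2 0 j)%:~R * t.1, t.2) | t : C * X' <- l].

Definition tmul (l l' : seq (C * X')) : seq (C * X') :=
  [seq (t.1 * t'.1, t.2 + t'.2) | t <- l, t' <- l'].

Lemma trig_nil x : trig [::] x = 0.
Proof. by rewrite /trig big_nil. Qed.

Lemma trig_cat l l' x : trig (l ++ l') x = trig l x + trig l' x.
Proof. by rewrite /trig big_cat. Qed.

Lemma trig_der_cat j l l' : trig_der j (l ++ l') = trig_der j l ++ trig_der j l'.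
Proof. exact: map_cat. Qed.

Lemma trig_mul l l' x : trig (tmul l l') x = trig l x * trig l' x.
Proof.
rewrite /trig big_allpairs_dep /= mulr_suml; apply: eq_bigr => t _.
by rewrite mulr_sumr; apply: eq_bigr => t' _ /=; rewrite chiD mulrACA.
Qed.

Lemma trig_der_mul j l l' x : trig (trig_der j (tmul l l')) x =
  trig (trig_der j l) x * trig l' x + trig l x * trig (trig_der j l') x.
Proof.
rewrite /trig !big_map big_allpairs_dep /= !mulr_suml -big_split.
apply: eq_bigr => t _; rewrite /= !mulr_sumr -big_split; apply: eq_bigr => t' _.
rewrite /= chiD mxE rmorphD /=; ring.
Qed.

Lemma pdC j k l : trig_der j (trig_der k l) = trig_der k (trig_der j l).
Proof. by rewrite /trig_der -!map_comp; apply: eq_map => t /=; rewrite mulrCA. Qed.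

Definition ap (f : X -> C) : Prop := forall e : R, 0 < e ->
  exists l, forall x, normc (f x - trig l x) <= e.

Lemma ap_trig l : ap (trig l).
Proof. by move=> e e0; exists l => x; rewrite subrr Normc.normc0 ltW. Qed.

Lemma ap_eq f g : f =1 g -> ap f -> ap g.
Proof. by move=> fg h e /h[l hl]; exists l => x; rewrite -fg. Qed.

Lemma ap_cst c : ap (fun=> c).
Proof.
apply: ap_eq (ap_trig [:: (c, 0)]) => x.
by rewrite /trig big_seq1 /= chi0 mulr1.
Qed.

Lemma ap_chi k : ap (chi k).
Proof.
by apply: ap_eq (ap_trig [:: (1, k)]) => x; rewrite /trig big_seq1 /= mul1r.
Qed.

Lemma apD f g : ap f -> ap g -> ap (fun x => f x + g x).
Proof.
move=> hf hg e e0; have e20 : 0 < e / 2 by rewrite divr_gt0.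
have [l hl] := hf _ e20; have [l' hl'] := hg _ e20; exists (l ++ l') => x.
rewrite trig_cat opprD addrACA (le_trans (le_normcD _ _))// [leRHS]splitr.
by rewrite lerD.
Qed.

Lemma trig_bounded l : exists2 B, 0 <= B & forall x, normc (trig l x) <= B.
Proof.
exists (\sum_(t <- l) normc t.1); first by apply: sumr_ge0 => t _; exact: normc_ge0.
move=> x; rewrite (le_trans (normc_sum _ _ _))//; apply: ler_sum => t _.
by rewrite Normc.normcM normc_chi mulr1.
Qed.

Lemma ap_bounded f : ap f -> exists2 B, 0 <= B & forall x, normc (f x) <= B.
Proof.
move=> /(_ 1 ltr01)[l hl]; have [B B0 hB] := trig_bounded l.
exists (1 + B); first by rewrite addr_ge0.
move=> x; rewrite -[f x](subrK (trig l x)) (le_trans (le_normcD _ _))//.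
by rewrite lerD.
Qed.

Lemma ap_limit f : (forall e : R, 0 < e ->
  exists2 g, ap g & forall x, normc (f x - g x) <= e) -> ap f.
Proof.
move=> h e e0; have e20 : 0 < e / 2 by rewrite divr_gt0.
have [g /(_ _ e20)[l hl] hg] := h _ e20; exists l => x.
rewrite -[f x](subrK (g x)) -addrA (le_trans (le_normcD _ _))// [leRHS]splitr.
by rewrite lerD.
Qed.

Lemma apM f g : ap f -> ap g -> ap (fun x => f x * g x).
Proof.
move=> hf hg; have [F F0 hF] := ap_bounded hf.
have mul_trig l : ap (fun x => trig l x * g x).
  apply: ap_limit => e e0; have [B B0 hB] := trig_bounded l.
  have [l' hl'] := hg (e / (B + 1)) ltac:(by rewrite divr_gt0// ltr_wpDl).
  exists (trig (tmul l l')); first exact: ap_trig.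
  move=> x; rewrite trig_mul -mulrBr Normc.normcM.
  apply: le_trans (ler_pM (normc_ge0 _) (normc_ge0 _) (hB x) (hl' x)) _.
  exact: frac_le.
apply: ap_limit => e e0; have [B B0 hB] := ap_bounded hg.
have [l hl] := hf (e / (B + 1)) ltac:(by rewrite divr_gt0// ltr_wpDl).
exists (fun x => trig l x * g x); first exact: mul_trig.
move=> x; rewrite -mulrBl Normc.normcM mulrC.
apply: le_trans (ler_pM (normc_ge0 _) (normc_ge0 _) (hB x) (hl x)) _.
exact: frac_le.
Qed.

Lemma apZ c f : ap f -> ap (fun x => c * f x).
Proof. by move=> hf; apply: apM => //; exact: ap_cst. Qed.

Lemma apN f : ap f -> ap (fun x => - f x).
Proof.
by move=> hf; apply: ap_eq (apZ (-1) hf) => x; rewrite mulN1r.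
Qed.

Lemma ap_sum (J : Type) (r : seq J) (F : J -> X -> C) : (forall i, ap (F i)) ->
  ap (fun x => \sum_(i <- r) F i x).
Proof.
move=> h; elim: r => [|i r IH].
  by apply: ap_eq (ap_cst 0) => x; rewrite big_nil.
by apply: ap_eq (apD (h i) IH) => x; rewrite big_cons.
Qed.

Lemma ap_conj f : ap f -> ap (fun x => conjc (f x)).
Proof.
move=> hf e /hf[l hl]; exists [seq (conjc t.1, - t.2) | t <- l] => x.
have -> : trig [seq (conjc t.1, - t.2) | t <- l] x = conjc (trig l x).
  rewrite /trig big_map rmorph_sum; apply: eq_bigr => t _ /=.
  by rewrite rmorphM /= chi_conj.
by rewrite -rmorphB normc_conj.
Qed.

Lemma ap_comp f (M : 'M[int]_3) : ap f -> ap (fun x => f (M *m x)).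
Proof.
move=> hf e /hf[l hl]; exists [seq (t.1, t.2 *m M) | t <- l] => x.
have -> : trig [seq (t.1, t.2 *m M) | t <- l] x = trig l (M *m x).
  by rewrite /trig big_map; apply: eq_bigr => t _ /=; rewrite chi_comp.
exact: hl.
Qed.

Definition pt (a b c : nat) : X := \col_i [:: a%:Z; b%:Z; c%:Z]`_i.

Definition avg (m : nat) (f : X -> C) : C := (m.+1%:R ^+ 3)^-1 *
  \sum_(t : 'I_m.+1 * 'I_m.+1 * 'I_m.+1) f (pt t.1.1 t.1.2 t.2).

Lemma avgD m f g : avg m (fun x => f x + g x) = avg m f + avg m g.
Proof. by rewrite /avg big_split mulrDr. Qed.

Lemma avgZ m c f : avg m (fun x => c * f x) = c * avg m f.
Proof. by rewrite /avg -mulr_sumr mulrCA. Qed.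

Lemma normc_nat (n : nat) : normc n%:R = n%:R.
Proof. by rewrite -(rmorph_nat (real_complex R)) normcR ger0_norm. Qed.

Lemma sum_box_cst m (B : R) :
  \sum_(t : 'I_m.+1 * 'I_m.+1 * 'I_m.+1) B = m.+1%:R ^+ 3 * B.
Proof.
by rewrite sumr_const !card_prod !card_ord -[LHS]mulr_natl !natrM !exprSr expr0 mul1r.
Qed.

Lemma box_gt0 m : 0 < (m.+1%:R ^+ 3)^-1 :> R.
Proof. by rewrite invr_gt0 exprn_gt0. Qed.

Lemma normc_box m : normc (m.+1%:R ^+ 3)^-1 = (m.+1%:R ^+ 3)^-1.
Proof. by rewrite Normc.normcV normcX normc_nat. Qed.

Lemma avg_le m f B : (forall x, normc (f x) <= B) -> normc (avg m f) <= B.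
Proof.
move=> h; rewrite Normc.normcM normc_box.
rewrite -ler_pdivlMl ?box_gt0// invrK -sum_box_cst.
by rewrite (le_trans (normc_sum _ _ _))// ler_sum.
Qed.

Lemma avg_cst m c : avg m (fun=> c) = c.
Proof.
rewrite /avg sumr_const !card_prod !card_ord -[_ *+ (_ * _)]mulr_natl mulrA !natrM.
have -> : m.+1%:R * m.+1%:R * m.+1%:R = m.+1%:R ^+ 3 :> C.
  by rewrite !exprSr expr0 mul1r.
by rewrite mulVf ?mul1r// expf_neq0// pnatr_eq0.
Qed.

Lemma ord3_sum (V : nmodType) (F : 'I_3 -> V) :
  \sum_j F j = F o0 + F o1 + F o2.
Proof.
rewrite !big_ord_recl big_ord0 addr0 addrA.
by congr (F _ + F _ + F _); apply: val_inj.
Qed.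

Lemma chi_pt k a b c : chi k (pt a b c) =
  (circle_pt ^ k 0 o0) ^+ a * (circle_pt ^ k 0 o1) ^+ b * (circle_pt ^ k 0 o2) ^+ c.
Proof.
rewrite /chi mxE ord3_sum !mxE /=.
by rewrite !expfzDr ?circle_pt_neq0// -!exprz_exp.
Qed.

Definition geo m (z : C) : C := m.+1%:R^-1 * \sum_(a < m.+1) z ^+ a.

Lemma avg_chiE m k :
  avg m (chi k) = geo m (circle_pt ^ k 0 o0) * geo m (circle_pt ^ k 0 o1) * geo m (circle_pt ^ k 0 o2).
Proof.
rewrite /avg /geo; under eq_bigr do rewrite chi_pt.
rewrite -(pair_bigA _ (fun a c : _ => (circle_pt ^ k 0 o0) ^+ val a.1 *
  (circle_pt ^ k 0 o1) ^+ val a.2 * (circle_pt ^ k 0 o2) ^+ val c)) /=.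
under eq_bigr do rewrite -mulr_sumr.
rewrite -mulr_suml.
rewrite -(pair_bigA _ (fun a c : _ => (circle_pt ^ k 0 o0) ^+ val a *
  (circle_pt ^ k 0 o1) ^+ val c)) /=.
under eq_bigr do rewrite -mulr_sumr.
rewrite -mulr_suml exprSr expr2 !invfM; ring.
Qed.

Lemma geo_le1 m z : normc z = 1 -> normc (geo m z) <= 1.
Proof.
move=> z1; rewrite Normc.normcM Normc.normcV normc_nat ler_pdivrMl// mulr1.
rewrite (le_trans (normc_sum _ _ _))//.
rewrite (eq_bigr (fun=> 1)) => [|i _]; last by rewrite normcX z1 expr1n.
by rewrite sumr_const card_ord.
Qed.

Lemma geo_small m z : normc z = 1 -> z != 1 ->
  normc (geo m z) <= 2 / normc (z - 1) / m.+1%:R.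
Proof.
move=> z1 zn; have d0 : 0 < normc (z - 1).
  by rewrite lt_def normc_ge0 normc_eq0 subr_eq0 zn.
rewrite Normc.normcM Normc.normcV normc_nat mulrC ler_pM2r ?invr_gt0//.
rewrite ler_pdivlMr// mulrC -Normc.normcM -subrX1.
by rewrite (le_trans (le_normcD _ _))// normcN Normc.normc1 normcX z1 expr1n.
Qed.

Lemma avg_chi k : k != 0 ->
  exists2 B, 0 <= B & forall m, normc (avg m (chi k)) <= B / m.+1%:R.
Proof.
move=> k0; have n1 j := normc_uuXz (k 0 j).
have [j kj] : exists j, k 0 j != 0.
  apply/existsP; apply: contraNT k0; rewrite negb_exists => /forallP h.
  by apply/eqP/matrixP => i j; rewrite ord1 mxE; apply/eqP; rewrite -[_ == _]negbK.
exists (2 / normc (circle_pt ^ k 0 j - 1)); first by rewrite divr_ge0// normc_ge0.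
move=> m; rewrite avg_chiE 2!Normc.normcM.
have small := geo_small m (n1 j) (uuXz_neq1 kj).
have l1 i := geo_le1 m (n1 i); have g0 i := normc_ge0 (geo m (circle_pt ^ k 0 i)).
apply: le_trans small.
case: (ord3P j) => ->.
- by rewrite -mulrA ler_piMr// mulr_ile1.
- by rewrite mulrAC ler_piMl// mulr_ile1.
- by rewrite ler_piMl// mulr_ile1.
Qed.

Definition const_coef (l : seq (C * X')) : C := \sum_(t <- l | t.2 == 0) t.1.

Lemma avg_trig l :
  exists2 B, 0 <= B & forall m, normc (avg m (trig l) - const_coef l) <= B / m.+1%:R.
Proof.
elim: l => [|[c k] l [B B0 IH]].
  exists 0 => // m; rewrite /const_coef big_nil mul0r.
  have -> : trig [::] = fun=> 0 by apply/funext => x; rewrite trig_nil.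
  by rewrite avg_cst subrr Normc.normc0.
have E : trig ((c, k) :: l) = fun x => c * chi k x + trig l x.
  by apply/funext => x; rewrite /trig big_cons.
rewrite E /const_coef big_cons /=; have [->|k0] := eqVneq k 0.
  exists B => // m; rewrite avgD avgZ.
  have -> : chi 0 = fun=> 1 by apply/funext => x; rewrite chi0.
  by rewrite avg_cst mulr1 opprD addrACA subrr add0r.
have [B' B'0 h] := avg_chi k0.
exists (normc c * B' + B); first by rewrite addr_ge0// mulr_ge0// normc_ge0.
move=> m; rewrite avgD avgZ -addrA (le_trans (le_normcD _ _))// mulrDl lerD//.
by rewrite Normc.normcM -mulrA ler_wpM2l// normc_ge0.
Qed.

Lemma inv_nat_small (B e : R) : 0 <= B -> 0 < e ->
  exists N, forall m, (N <= m)%N -> B / m.+1%:R < e.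
Proof.
move=> B0 e0; have e1 : 0 < e / (B + 1) by rewrite divr_gt0// ltr_wpDl.
have [N hN] := ltr_add_invr e1; exists N => m Nm.
apply: le_lt_trans (_ : B / N.+1%:R < e).
  by rewrite ler_wpM2l// lef_pV2 ?posrE ?ltr0n// ler_nat.
move: hN; rewrite add0r ltr_pdivlMr ?ltr_wpDl// mulrC; apply: le_lt_trans.
by rewrite ler_wpM2r ?invr_ge0// lerDl.
Qed.

(* Averages over boxes stand for the integral over T^3. *)
Definition rmean (f : X -> C) : R :=
  (limn (fun m => complex.Re (avg m f)))%classic.

Lemma avg_trig_cvg l :
  ((fun m => complex.Re (avg m (trig l))) @ \oo --> complex.Re (const_coef l))%classic.
Proof.
apply/cvgrPdist_lt => e e0; have [B B0 h] := avg_trig l.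
have [N hN] := inv_nat_small B0 e0; exists N => // m /hN; apply: le_lt_trans.
rewrite distrC -raddfB; apply: le_trans (normc_Re _) _.
exact: h.
Qed.

Lemma rmean_cvg f : ap f ->
  ((fun m => complex.Re (avg m f)) @ \oo --> rmean f)%classic.
Proof.
move=> hf; suff : cvgn (fun m => complex.Re (avg m f)) by [].
apply: cauchy_cvg; suff H : cauchy_ex (nbhs ((fun m => complex.Re (avg m f)) @ \oo)%classic).
  exact: cauchy_exP H.
move=> e e0.
have e20 : 0 < e / 2 by rewrite divr_gt0.
have [l hl] := hf _ e20; have [B B0 h] := avg_trig l.
have [N hN] := inv_nat_small B0 e20; exists (complex.Re (const_coef l)), N => // m /hN hm.
rewrite /ball /= distrC -raddfB.
apply: le_lt_trans (normc_Re _) _.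
have -> : avg m f - const_coef l = avg m (fun x => f x - trig l x) +
    (avg m (trig l) - const_coef l).
  rewrite addrA; congr (_ - _); rewrite -avgD; congr avg.
  by apply/funext => x; rewrite subrK.
apply: le_lt_trans (le_normcD _ _) _; rewrite [ltRHS]splitr ler_ltD//.
  exact: avg_le.
by apply: le_lt_trans hm.
Qed.

Lemma rmean_trig l : rmean (trig l) = complex.Re (const_coef l).
Proof. by apply: cvg_lim; [exact: Rhausdorff|exact: avg_trig_cvg]. Qed.

Lemma rmeanD f g : ap f -> ap g -> rmean (fun x => f x + g x) = rmean f + rmean g.
Proof.
move=> hf hg; apply: cvg_lim; first exact: Rhausdorff.
under eq_fun do rewrite avgD raddfD.
by apply: cvgD; exact: rmean_cvg.
Qed.

Lemma rmeanZ (c : R) f : ap f -> rmean (fun x => c%:C%C * f x) = c * rmean f.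
Proof.
move=> hf; apply: cvg_lim; first exact: Rhausdorff.
have E m : complex.Re (avg m (fun x => c%:C%C * f x)) = c * complex.Re (avg m f).
  by rewrite avgZ; case: (avg m f) => a b /=; rewrite mul0r subr0.
under eq_fun do rewrite E.
by apply: cvgMl_tmp; exact: rmean_cvg.
Qed.

Lemma rmean_le f B : ap f -> (forall x, normc (f x) <= B) -> `|rmean f| <= B.
Proof.
move=> hf h; have hm m : `|complex.Re (avg m f)| <= B.
  by apply: le_trans (normc_Re _) _; exact: avg_le.
rewrite ler_norml; apply/andP; split.
- apply: (cvgr_to_ge (rmean_cvg hf)); near=> m.
  by have := hm m; rewrite ler_norml => /andP[].
- apply: (cvgr_to_le (rmean_cvg hf)); near=> m.
  by have := hm m; rewrite ler_norml => /andP[].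
Unshelve. all: by end_near. Qed.

Lemma rmeanN f : ap f -> rmean (fun x => - f x) = - rmean f.
Proof.
move=> hf; rewrite -[RHS]mulN1r -rmeanZ//; congr rmean.
by apply/funext => x; rewrite rmorphN1 mulN1r.
Qed.

Lemma rmean_ge0 f : ap f -> (forall x, 0 <= complex.Re (f x)) -> 0 <= rmean f.
Proof.
move=> hf h; apply: (cvgr_to_ge (rmean_cvg hf)); near=> m.
rewrite /avg -(rmorph_nat (real_complex R)) -rmorphXn -fmorphV.
set r := _^-1; have r0 : 0 <= r by rewrite invr_ge0 exprn_ge0.
have ReZ (z : C) : complex.Re (r%:C%C * z) = r * complex.Re z.
  by case: z => a b /=; rewrite mul0r subr0.
by rewrite ReZ mulr_ge0// raddf_sum; apply: sumr_ge0 => t _; exact: h.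
Unshelve. all: by end_near. Qed.

Lemma rmean_trig_near f l e : ap f -> (forall x, normc (f x - trig l x) <= e) ->
  `|rmean f - complex.Re (const_coef l)| <= e.
Proof.
move=> hf h; have ht := ap_trig l.
rewrite -rmean_trig -(rmeanN ht) -rmeanD//; last exact: apN.
by apply: rmean_le => //; apply: apD => //; exact: apN.
Qed.

Lemma rmean_trig_der j l : rmean (trig (trig_der j l)) = 0.
Proof.
rewrite rmean_trig /const_coef big_map big1 ?raddf0// => t /= /eqP ->.
by rewrite mxE rmorph0 mulr0 mul0r.
Qed.

Lemma rmean_comp f (M : 'M[int]_3) : ap f -> \det M != 0 ->
  rmean (fun x => f (M *m x)) = rmean f.
Proof.
move=> hf dM; apply/eqP; rewrite -subr_eq0 -normr_le0; apply: le_eps => e e0.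
have e30 : 0 < e / 3 by rewrite divr_gt0.
have [l hl] := hf _ e30; have h1 := rmean_trig_near hf hl.
pose l' := [seq (t.1, t.2 *m M) | t <- l].
have lE x : trig l' x = trig l (M *m x).
  by rewrite /trig big_map; apply: eq_bigr => t _ /=; rewrite chi_comp.
have hl' x : normc (f (M *m x) - trig l' x) <= e / 3 by rewrite lE; exact: hl.
have h2 := rmean_trig_near (ap_comp M hf) hl'.
have cE : const_coef l' = const_coef l.
  rewrite /const_coef big_map; apply: eq_bigl => t /=.
  apply/eqP/eqP => [E|->]; last by rewrite mul0mx.
  have : t.2 *m M *m \adj M = 0 by rewrite E mul0mx.
  rewrite -mulmxA mul_mx_adj mul_mx_scalar => /eqP.
  by rewrite scalemx_eq0 (negPf dM) => /eqP.
rewrite cE in h2; move: h1 h2; rewrite !ler_norml => /andP[? ?] /andP[? ?].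
rewrite ltr_norml; apply/andP; split; lra.
Qed.

(* f' is the j-th partial derivative of f, for the closure of the derivation of
   trigonometric polynomials: Z^3 carries no differentiable structure. *)
Definition apd (j : 'I_3) (f f' : X -> C) : Prop := forall e : R, 0 < e ->
  exists l, forall x, normc (f x - trig l x) <= e /\
    normc (f' x - trig (trig_der j l) x) <= e.

Lemma apd_trig j l : apd j (trig l) (trig (trig_der j l)).
Proof. by move=> e e0; exists l => x; rewrite !subrr Normc.normc0 ltW. Qed.

Lemma apd_ap j f f' : apd j f f' -> ap f.
Proof. by move=> h e /h[l hl]; exists l => x; case: (hl x). Qed.

Lemma apd_ap' j f f' : apd j f f' -> ap f'.
Proof. by move=> h e /h[l hl]; exists (trig_der j l) => x; case: (hl x). Qed.

Lemma apd_eq j f f' g g' : f =1 g -> f' =1 g' -> apd j f f' -> apd j g g'.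
Proof.
by move=> fg fg' h e /h[l hl]; exists l => x; rewrite -fg -fg'.
Qed.

Lemma apd_cst j c : apd j (fun=> c) (fun=> 0).
Proof.
apply: apd_eq (apd_trig j [:: (c, 0)]) => x; rewrite /trig big_seq1 /=.
  by rewrite chi0 mulr1.
by rewrite mxE mulr0 !mul0r.
Qed.

Lemma apdD j f f' g g' : apd j f f' -> apd j g g' ->
  apd j (fun x => f x + g x) (fun x => f' x + g' x).
Proof.
move=> hf hg e e0; have e20 : 0 < e / 2 by rewrite divr_gt0.
have [l hl] := hf _ e20; have [l' hl'] := hg _ e20; exists (l ++ l') => x.
have [a b] := hl x; have [a' b'] := hl' x.
by split; rewrite ?trig_der_cat trig_cat opprD addrACA (le_trans (le_normcD _ _))//
  [leRHS]splitr lerD.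
Qed.

Lemma normc_prod_close (K d : R) (a b a' b' : C) : d <= 1 ->
  normc a <= K -> normc b <= K -> normc (a - a') <= d -> normc (b - b') <= d ->
  normc (a * b - a' * b') <= d * (2 * K + 1).
Proof.
move=> d1 aK bK ha hb.
have d0 : 0 <= d := le_trans (normc_ge0 _) ha.
have -> : a * b - a' * b' = a * (b - b') + ((a - a') * b - (a - a') * (b - b')).
  by ring.
apply: le_trans (le_normcD _ _) _.
have h1 : normc (a * (b - b')) <= K * d by rewrite Normc.normcM ler_pM ?normc_ge0.
have h2 : normc ((a - a') * b) <= d * K by rewrite Normc.normcM ler_pM ?normc_ge0.
have h3 : normc ((a - a') * (b - b')) <= d * 1.
  by rewrite Normc.normcM ler_pM ?normc_ge0// (le_trans hb).
have := le_normcD ((a - a') * b) (- ((a - a') * (b - b'))); rewrite normcN; lra.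
Qed.

Lemma apdM j f f' g g' : apd j f f' -> apd j g g' ->
  apd j (fun x => f x * g x) (fun x => f' x * g x + f x * g' x).
Proof.
move=> hf hg e e0.
have [F F0 hF] := ap_bounded (apd_ap hf); have [F' F'0 hF'] := ap_bounded (apd_ap' hf).
have [G G0 hG] := ap_bounded (apd_ap hg); have [G' G'0 hG'] := ap_bounded (apd_ap' hg).
pose K := F + F' + G + G'.
have K0 : 0 < 2 * (2 * K + 1) by rewrite /K; lra.
pose d := Num.min 1 (e / (2 * (2 * K + 1))).
have d0 : 0 < d by rewrite lt_min ltr01 divr_gt0.
have d1 : d <= 1 by rewrite ge_min lexx.
have dK : d * (2 * K + 1) <= e / 2.
  have : d <= e / (2 * (2 * K + 1)) by rewrite ge_min lexx orbT.
  by rewrite ler_pdivlMr//; lra.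
have [l hl] := hf _ d0; have [l' hl'] := hg _ d0.
exists (tmul l l') => x; have [a b] := hl x; have [a' b'] := hl' x.
have [hFx hF'x hGx hG'x] : [/\ normc (f x) <= K, normc (f' x) <= K,
    normc (g x) <= K & normc (g' x) <= K].
  split; [move: (hF x)|move: (hF' x)|move: (hG x)|move: (hG' x)]; rewrite /K; lra.
have c1 := normc_prod_close d1 hFx hGx a a'.
have c2 := normc_prod_close d1 hF'x hGx b a'.
have c3 := normc_prod_close d1 hFx hG'x a b'.
split; first by rewrite trig_mul; lra.
rewrite trig_der_mul opprD addrACA (le_trans (le_normcD _ _))//; lra.
Qed.

Lemma apd_closed j f f' : (forall e : R, 0 < e -> exists g g', [/\ apd j g g',
    forall x, normc (f x - g x) <= e & forall x, normc (f' x - g' x) <= e]) ->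
  apd j f f'.
Proof.
move=> h e e0; have e20 : 0 < e / 2 by rewrite divr_gt0.
have [g [g' [/(_ _ e20)[l hl] hg hg']]] := h _ e20; exists l => x.
have [a b] := hl x; split.
  rewrite -[f x](subrK (g x)) -addrA (le_trans (le_normcD _ _))// [leRHS]splitr.
  by rewrite lerD.
rewrite -[f' x](subrK (g' x)) -addrA (le_trans (le_normcD _ _))// [leRHS]splitr.
by rewrite lerD.
Qed.

Lemma apd_sum j (J : Type) (r : seq J) (F F' : J -> X -> C) :
  (forall i, apd j (F i) (F' i)) ->
  apd j (fun x => \sum_(i <- r) F i x) (fun x => \sum_(i <- r) F' i x).
Proof.
move=> h; elim: r => [|i r IH].
  by apply: apd_eq (apd_cst j 0) => x; rewrite big_nil.
by apply: apd_eq (apdD (h i) IH) => x; rewrite big_cons.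
Qed.

Lemma rmean_apd j f f' : apd j f f' -> rmean f' = 0.
Proof.
move=> h; have hf' := apd_ap' h; apply/eqP; rewrite -normr_le0.
apply: le_eps => e e0; have e20 : 0 < e / 2 by rewrite divr_gt0.
have [l hl] := h _ e20; rewrite add0r.
have := rmean_trig_near hf' (fun x => (hl x).2).
rewrite -rmean_trig rmean_trig_der subr0 => /le_lt_trans; apply.
by rewrite ltr_pdivrMr// ltr_pMr// ltr1n.
Qed.

Lemma normc_complete (u : nat -> C) :
  (forall e : R, 0 < e -> exists N, forall m n, (N <= m)%N -> (N <= n)%N ->
    normc (u m - u n) < e) ->
  exists l, forall e : R, 0 < e -> exists N, forall n, (N <= n)%N ->
    normc (u n - l) < e.
Proof.
have real (v : nat -> R) : (forall e : R, 0 < e -> exists N, forall m n,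
    (N <= m)%N -> (N <= n)%N -> `|v m - v n| < e) ->
    exists l, forall e : R, 0 < e -> exists N, forall n, (N <= n)%N ->
    `|v n - l| < e.
  move=> h; have : cvgn v.
    apply: cauchy_cvg; suff H : cauchy_ex (nbhs (v @ \oo)%classic).
      exact: cauchy_exP H.
    move=> e /h[N hN]; exists (v N), N => // m Nm; exact: hN.
  move=> /cvgrPdist_lt hv; exists (limn v) => e /hv[N _ hN].
  by exists N => n /hN; rewrite distrC.
move=> hu.
have [|a ha] := real (fun n => complex.Re (u n)).
  move=> e /hu[N hN]; exists N => m n Nm Nn; rewrite -raddfB.
  exact: le_lt_trans (normc_Re _) (hN _ _ Nm Nn).
have Im_le (z : C) : `|complex.Im z| <= normc z.
  by case: z => x y /=; rewrite -sqrtr_sqr ler_wsqrtr// lerDr sqr_ge0.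
have [|b hb] := real (fun n => complex.Im (u n)).
  move=> e /hu[N hN]; exists N => m n Nm Nn; rewrite -raddfB.
  exact: le_lt_trans (Im_le _) (hN _ _ Nm Nn).
exists (a +i* b)%C => e e0; have e20 : 0 < e / 2 by rewrite divr_gt0.
have [N hN] := ha _ e20; have [M hM] := hb _ e20.
exists (maxn N M) => n; rewrite geq_max => /andP[/hN h1 /hM h2].
have -> : u n - (a +i* b)%C = (complex.Re (u n) - a)%:C%C +
    I * (complex.Im (u n) - b)%:C%C.
  by case: (u n) => x y; apply/eqP; rewrite eq_complex /=; apply/andP; split; apply/eqP; ring.
apply: le_lt_trans (le_normcD _ _) _; rewrite Normc.normcM !normcR.
have -> : normc I = 1 by rewrite /= expr0n add0r expr1n sqrtr1.
by rewrite mul1r [ltRHS]splitr ltrD.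
Qed.

End AlmostPeriodic.

(** * The C*-algebra of almost periodic matrix functions *)

Section HermitianNorm.
Variables (R : realType) (n : nat).
Local Notation C := R[i].
Local Notation normc := (@Normc.normc R).
Implicit Types (v w : 'cV[C]_n) (M : 'M[C]_n).

Definition hnorm v : R := Num.sqrt (\sum_i normc (v i 0) ^+ 2).

Lemma hnorm_ge0 v : 0 <= hnorm v. Proof. exact: sqrtr_ge0. Qed.

Lemma hnorm_sqr v : hnorm v ^+ 2 = \sum_i normc (v i 0) ^+ 2.
Proof. by rewrite sqr_sqrtr// sumr_ge0// => i _; exact: sqr_ge0. Qed.

Lemma normc_le_hnorm v i : normc (v i 0) <= hnorm v.
Proof.
rewrite -(ler_pXn2r (ltn0Sn 1)) ?nnegrE ?hnorm_ge0 ?normc_ge0// hnorm_sqr.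
by rewrite (bigD1 i)//= lerDl sumr_ge0// => j _; exact: sqr_ge0.
Qed.

Lemma hnorm_le_sum v : hnorm v <= \sum_i normc (v i 0).
Proof.
have s0 : 0 <= \sum_i normc (v i 0) by apply: sumr_ge0 => i _; exact: normc_ge0.
rewrite -(ler_pXn2r (ltn0Sn 1)) ?nnegrE ?hnorm_ge0// hnorm_sqr.
rewrite [leRHS]expr2 mulr_suml ler_sum// => i _; rewrite expr2.
rewrite ler_wpM2l ?normc_ge0// (bigD1 i)//= lerDl sumr_ge0// => j _.
exact: normc_ge0.
Qed.

Lemma hnorm_eq0 v : hnorm v = 0 -> v = 0.
Proof.
move=> h; apply/matrixP => i j; rewrite ord1 mxE; apply/eqP.
by rewrite -normc_eq0 eq_le normc_ge0 andbT -h normc_le_hnorm.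
Qed.

Lemma hn0 : hnorm 0 = 0.
Proof.
by rewrite /hnorm big1 ?sqrtr0// => i _; rewrite mxE Normc.normc0 expr0n.
Qed.

Lemma hnZ (c : C) v : hnorm (c *: v) = normc c * hnorm v.
Proof.
apply/eqP; rewrite -(eqrXn2 (ltn0Sn 1)) ?mulr_ge0 ?hnorm_ge0 ?normc_ge0//.
rewrite exprMn !hnorm_sqr mulr_sumr; apply/eqP/eq_bigr => i _.
by rewrite mxE Normc.normcM exprMn.
Qed.

Lemma cauchy_schwarz v w : \sum_i normc (v i 0) * normc (w i 0) <= hnorm v * hnorm w.
Proof.
have [/hnorm_eq0 ->|v0] := eqVneq (hnorm v) 0.
  by rewrite hn0 mul0r big1// => i _; rewrite mxE Normc.normc0 mul0r.
have [/hnorm_eq0 ->|w0] := eqVneq (hnorm w) 0.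
  by rewrite hn0 mulr0 big1// => i _; rewrite mxE Normc.normc0 mulr0.
have a0 : 0 < hnorm v by rewrite lt_def v0 hnorm_ge0.
have b0 : 0 < hnorm w by rewrite lt_def w0 hnorm_ge0.
have -> : hnorm v * hnorm w = \sum_i (hnorm w / hnorm v * normc (v i 0) ^+ 2 +
    hnorm v / hnorm w * normc (w i 0) ^+ 2) / 2.
  by rewrite -mulr_suml big_split /= -!mulr_sumr -!hnorm_sqr; field; rewrite v0 w0.
apply: ler_sum => i _; set x := normc _; set y := normc _.
set a := hnorm v in a0 v0 *; set b := hnorm w in b0 w0 *.
rewrite -subr_ge0.
have -> : (b / a * x ^+ 2 + a / b * y ^+ 2) / 2 - x * y =
    (b * x - a * y) ^+ 2 / (2 * a * b) by field; rewrite v0 w0.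
by rewrite divr_ge0 ?sqr_ge0// !mulr_ge0// ltW.
Qed.

Lemma hnD v w : hnorm (v + w) <= hnorm v + hnorm w.
Proof.
rewrite -(ler_pXn2r (ltn0Sn 1)) ?nnegrE ?addr_ge0 ?hnorm_ge0// hnorm_sqr sqrrD.
rewrite !hnorm_sqr.
have := cauchy_schwarz v w; rewrite -(ler_pMn2r (ltn0Sn 1)) => h.
apply: le_trans (_ : \sum_i (normc (v i 0) + normc (w i 0)) ^+ 2 <= _).
  apply: ler_sum => i _; rewrite mxE ler_pXn2r ?nnegrE ?normc_ge0//.
    exact: le_normcD.
  by rewrite addr_ge0// normc_ge0.
under eq_bigr do rewrite sqrrD.
by rewrite big_split /= lerD2r big_split /= lerD2l sumrMnl.
Qed.

Definition dot v w : C := \sum_i conjc (v i 0) * w i 0.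

Definition adj M : 'M[C]_n := (map_mx conjc M)^T.

Lemma dot_adj M v w : dot (M *m v) w = dot v (adj M *m w).
Proof.
rewrite /dot.
under eq_bigr => i _ do rewrite mxE rmorph_sum /= mulr_suml.
rewrite exchange_big /=; apply: eq_bigr => j _.
rewrite mxE mulr_sumr; apply: eq_bigr => i _.
by rewrite !mxE rmorphM -mulrA mulrCA.
Qed.

Lemma conjc_mul_normc (z : C) : conjc z * z = ((normc z ^+ 2)%:C)%C.
Proof.
case: z => a b /=; rewrite sqr_sqrtr ?addr_ge0 ?sqr_ge0//.
by apply/eqP; rewrite eq_complex /=; apply/andP; split; apply/eqP; ring.
Qed.

Lemma dot_self v : dot v v = ((hnorm v ^+ 2)%:C)%C.
Proof.
by rewrite hnorm_sqr rmorph_sum /=; apply: eq_bigr => i _; rewrite conjc_mul_normc.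
Qed.

Lemma dot_le v w : normc (dot v w) <= hnorm v * hnorm w.
Proof.
apply: le_trans (normc_sum _ _ _) _; apply: le_trans (cauchy_schwarz v w).
by apply: ler_sum => i _; rewrite Normc.normcM normc_conj.
Qed.

Lemma hnorm_sqr_adj M v : hnorm (M *m v) ^+ 2 <= hnorm v * hnorm (adj M *m M *m v).
Proof.
have := dot_le v (adj M *m (M *m v)); rewrite -dot_adj dot_self normcR mulmxA.
by rewrite ger0_norm// exprn_ge0// hnorm_ge0.
Qed.

Lemma adjK M : adj (adj M) = M.
Proof. by apply/matrixP => i j; rewrite !mxE conjcK. Qed.

Lemma adjM M N : adj (M *m N) = adj N *m adj M.
Proof. by rewrite /adj map_mxM trmx_mul. Qed.

Lemma hnorm_mul_le M (B : R) v : (forall i j, normc (M i j) <= B) ->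
  hnorm (M *m v) <= n%:R * n%:R * B * hnorm v.
Proof.
move=> h; apply: le_trans (hnorm_le_sum _) _.
have -> : n%:R * n%:R * B * hnorm v = \sum_(i < n) n%:R * B * hnorm v.
  by rewrite sumr_const card_ord -[RHS]mulr_natl !mulrA.
apply: ler_sum => i _; rewrite mxE; apply: le_trans (normc_sum _ _ _) _.
have -> : n%:R * B * hnorm v = \sum_(j < n) B * hnorm v.
  by rewrite sumr_const card_ord -[RHS]mulr_natl !mulrA.
apply: ler_sum => j _; rewrite Normc.normcM ler_pM ?normc_ge0//.
exact: normc_le_hnorm.
Qed.

Lemma normc_entry_le M (B : R) i j : (forall v, hnorm (M *m v) <= B * hnorm v) ->
  normc (M i j) <= B.
Proof.
move=> h; have := h (delta_mx j 0); rewrite -colE.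
have -> : hnorm (delta_mx j 0) = 1.
  rewrite /hnorm (bigD1 j)//= big1 => [|k kj].
    by rewrite mxE !eqxx Normc.normc1 expr1n addr0 sqrtr1.
  have -> : (delta_mx j 0 : 'cV[C]_n) k 0 = 0 by rewrite mxE (negPf kj).
  by rewrite Normc.normc0 expr0n.
rewrite mulr1; apply: le_trans; have := normc_le_hnorm (col j M) i.
by rewrite mxE.
Qed.

End HermitianNorm.

Section Algebra.
Variables (R : realType) (q : nat).
Local Notation C := R[i].
Local Notation normc := (@Normc.normc R).
Local Notation n := q.+1.
Local Notation X := 'cV[int]_3.

(* Almost periodic functions from Z^3 to the n x n matrices: a copy of
   C(T^3, M_n(C)), a point of Z^3 being sent to a dense subgroup of T^3. *)
Record apmx := Apmx {
  apf :> X -> 'M[C]_n;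
  apP : forall i j, ap (fun x => apf x i j)
}.

HB.instance Definition _ := gen_eqMixin apmx.
HB.instance Definition _ := gen_choiceMixin apmx.

Implicit Types a b c : apmx.

Lemma apmx_eq a b : (forall x, a x = b x) -> a = b.
Proof.
case: a b => [f hf] [g hg] /= /funext E; rewrite E in hf *.
by congr Apmx; exact: Prop_irrelevance.
Qed.

Fact apmx_zeroP i j : ap (fun x : X => (0 : 'M[C]_n) i j).
Proof. exact: ap_cst. Qed.
Fact apmx_oneP i j : ap (fun x : X => (1 : 'M[C]_n) i j).
Proof. exact: ap_cst. Qed.
Fact apmx_addP a b i j : ap (fun x => (a x + b x) i j).
Proof. by apply: ap_eq (apD (apP a i j) (apP b i j)) => x; rewrite mxE. Qed.
Fact apmx_oppP a i j : ap (fun x => (- a x) i j).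
Proof. by apply: ap_eq (apN (apP a i j)) => x; rewrite mxE. Qed.
Fact apmx_scaleP (s : C) a i j : ap (fun x => (s *: a x) i j).
Proof. by apply: ap_eq (apZ s (apP a i j)) => x; rewrite mxE. Qed.
Fact apmx_mulP a b i j : ap (fun x => (a x *m b x) i j).
Proof.
have := @ap_sum R _ (index_enum 'I_n) (fun k x => a x i k * b x k j)
  (fun k => apM (apP a i k) (apP b k j)).
by apply: ap_eq => x; rewrite mxE.
Qed.
Fact apmx_starP a i j : ap (fun x => adj (a x) i j).
Proof. by apply: ap_eq (ap_conj (apP a j i)) => x; rewrite !mxE. Qed.

Definition apmx_zero := Apmx apmx_zeroP.
Definition apmx_one := Apmx apmx_oneP.
Definition apmx_add a b := Apmx (apmx_addP a b).
Definition apmx_opp a := Apmx (apmx_oppP a).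
Definition apmx_mul a b := Apmx (apmx_mulP a b).
Definition apmx_scale s a := Apmx (apmx_scaleP s a).
Definition apmx_star a := Apmx (apmx_starP a).

Fact apmx_addA : associative apmx_add.
Proof. by move=> a b c; apply: apmx_eq => x; rewrite /= addrA. Qed.
Fact apmx_addC : commutative apmx_add.
Proof. by move=> a b; apply: apmx_eq => x; rewrite /= addrC. Qed.
Fact apmx_add0 : left_id apmx_zero apmx_add.
Proof. by move=> a; apply: apmx_eq => x; rewrite /= add0r. Qed.
Fact apmx_addN : left_inverse apmx_zero apmx_opp apmx_add.
Proof. by move=> a; apply: apmx_eq => x; rewrite /= addNr. Qed.

HB.instance Definition _ := GRing.isZmodule.Build apmx
  apmx_addA apmx_addC apmx_add0 apmx_addN.

Fact apmx_mulA : associative apmx_mul.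
Proof. by move=> a b c; apply: apmx_eq => x; rewrite /= mulmxA. Qed.
Fact apmx_mul1 : left_id apmx_one apmx_mul.
Proof. by move=> a; apply: apmx_eq => x; rewrite /= mul1mx. Qed.
Fact apmx_mulr1 : right_id apmx_one apmx_mul.
Proof. by move=> a; apply: apmx_eq => x; rewrite /= mulmx1. Qed.
Fact apmx_mulDl : left_distributive apmx_mul +%R.
Proof. by move=> a b c; apply: apmx_eq => x; rewrite /= mulmxDl. Qed.
Fact apmx_mulDr : right_distributive apmx_mul +%R.
Proof. by move=> a b c; apply: apmx_eq => x; rewrite /= mulmxDr. Qed.
Fact apmx_one_neq0 : apmx_one != 0.
Proof.
apply/eqP => /(congr1 (fun a : apmx => a 0)) /= /eqP; exact/negP/oner_neq0.
Qed.

HB.instance Definition _ := GRing.Zmodule_isNzRing.Build apmx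
  apmx_mulA apmx_mul1 apmx_mulr1 apmx_mulDl apmx_mulDr apmx_one_neq0.

Fact apmx_scaleA s t a : apmx_scale s (apmx_scale t a) = apmx_scale (s * t) a.
Proof. by apply: apmx_eq => x; rewrite /= scalerA. Qed.
Fact apmx_scale1 : left_id 1 apmx_scale.
Proof. by move=> a; apply: apmx_eq => x; rewrite /= scale1r. Qed.
Fact apmx_scaleDr : right_distributive apmx_scale +%R.
Proof. by move=> s a b; apply: apmx_eq => x; rewrite /= scalerDr. Qed.
Fact apmx_scaleDl a : {morph apmx_scale^~ a : s t / s + t}.
Proof. by move=> s t; apply: apmx_eq => x; rewrite /= scalerDl. Qed.

HB.instance Definition _ := GRing.Zmodule_isLmodule.Build C apmx
  apmx_scaleA apmx_scale1 apmx_scaleDr apmx_scaleDl.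

Fact apmx_scaleAl (s : C) (a b : apmx) : s *: (a * b) = (s *: a) * b.
Proof. by apply: apmx_eq => x; rewrite /= scalemxAl. Qed.
Fact apmx_scaleAr (s : C) (a b : apmx) : s *: (a * b) = a * (s *: b).
Proof. by apply: apmx_eq => x; rewrite /= scalemxAr. Qed.

HB.instance Definition _ := GRing.Lmodule_isLalgebra.Build C apmx apmx_scaleAl.
HB.instance Definition _ := GRing.Lalgebra_isAlgebra.Build C apmx apmx_scaleAr.

Lemma apmx1E x : (1 : apmx) x = 1%:M. Proof. by []. Qed.
Lemma apmxDE a b x : (a + b) x = a x + b x. Proof. by []. Qed.
Lemma apmxNE a x : (- a) x = - a x. Proof. by []. Qed.
Lemma apmxME a b x : (a * b) x = a x *m b x. Proof. by []. Qed.
Lemma apmxZE (s : C) a x : (s *: a) x = s *: a x. Proof. by []. Qed.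

Local Open Scope classical_set_scope.

Definition apmx_bound a : set R :=
  [set r | 0 <= r /\ forall x v, hnorm (a x *m v) <= r * hnorm v]%R.

Definition apmx_norm a : R := inf (apmx_bound a).

Local Close Scope classical_set_scope.

Lemma apmx_bound_ex a : (apmx_bound a !=set0)%classic.
Proof.
have [B hB] : exists B : 'I_n -> 'I_n -> R, forall i j, 0 <= B i j /\
    forall x, normc (a x i j) <= B i j.
  have h i j : exists B, 0 <= B /\ forall x, normc (a x i j) <= B.
    by have [B B0 hB] := ap_bounded (apP a i j); exists B.
  have [B hB] := choice (fun p => h p.1 p.2).
  by exists (fun i j => B (i, j)) => i j; have [] := hB (i, j).
pose S := \sum_i \sum_j B i j.
have BS i j : B i j <= S.
  rewrite /S (bigD1 i)//= (bigD1 j)//= -addrA lerDl addr_ge0//.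
    by apply: sumr_ge0 => k _; case: (hB i k).
  by apply: sumr_ge0 => k _; apply: sumr_ge0 => l _; case: (hB k l).
have S0 : 0 <= S by apply: le_trans (BS ord0 ord0); case: (hB ord0 ord0).
exists (n%:R * n%:R * S); split; first by rewrite !mulr_ge0.
move=> x v; apply: hnorm_mul_le => i j; apply: le_trans (BS i j).
by have [_] := hB i j; apply.
Qed.

Lemma apmx_norm_ge0 a : 0 <= apmx_norm a.
Proof. by apply: lb_le_inf; [exact: apmx_bound_ex|move=> r []]. Qed.

Lemma apmx_norm_le a r : 0 <= r -> (forall x v, hnorm (a x *m v) <= r * hnorm v) ->
  apmx_norm a <= r.
Proof. by move=> r0 h; apply: ge_inf => //; exists 0 => s []. Qed.

Lemma apmx_normP a x v : hnorm (a x *m v) <= apmx_norm a * hnorm v.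
Proof.
apply: le_eps => e e0; have e1 : 0 < e / (hnorm v + 1).
  by rewrite divr_gt0// ltr_wpDl// hnorm_ge0.
have hi : has_inf (apmx_bound a).
  by split; [exact: apmx_bound_ex|exists 0 => s []].
have [r [r0 hr] lt_r] := inf_adherent e1 hi.
apply: le_lt_trans (hr x v) _.
apply: le_lt_trans (_ : (apmx_norm a + e / (hnorm v + 1)) * hnorm v < _).
  by rewrite ler_wpM2r ?hnorm_ge0// ltW.
rewrite mulrDl ltrD2l mulrAC ltr_pdivrMr ?ltr_wpDl ?hnorm_ge0//.
by rewrite ltr_pM2l// ltrDl.
Qed.

Fact apmx_starK : involutive apmx_star.
Proof. by move=> a; apply: apmx_eq => x; rewrite /= adjK. Qed.
Fact apmx_starD : {morph apmx_star : a b / a + b}.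
Proof. by move=> a b; apply: apmx_eq => x; rewrite /= ?apmxDE /adj map_mxD raddfD. Qed.
Fact apmx_starZ (s : C) a : apmx_star (s *: a) = conjc s *: apmx_star a.
Proof. by apply: apmx_eq => x; rewrite /= ?apmxZE /adj map_mxZ linearZ. Qed.
Fact apmx_starM a b : apmx_star (a * b) = apmx_star b * apmx_star a.
Proof. by apply: apmx_eq => x; rewrite /= ?apmxME adjM. Qed.

Fact apmx_norm_eq0 a : apmx_norm a = 0 -> a = 0.
Proof.
move=> h; apply: apmx_eq => x; apply/matrixP => i j; rewrite mxE; apply/eqP.
rewrite -normc_eq0 eq_le normc_ge0 andbT; apply: normc_entry_le => v.
by rewrite -h apmx_normP.
Qed.

Fact apmx_normD a b : apmx_norm (a + b) <= apmx_norm a + apmx_norm b.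
Proof.
apply: apmx_norm_le => [|x v]; first by rewrite addr_ge0 ?apmx_norm_ge0.
by rewrite apmxDE mulmxDl (le_trans (hnD _ _))// mulrDl lerD// apmx_normP.
Qed.

Fact apmx_normZ_le (s : C) a : apmx_norm (s *: a) <= normc s * apmx_norm a.
Proof.
apply: apmx_norm_le => [|x v]; first by rewrite mulr_ge0 ?normc_ge0 ?apmx_norm_ge0.
by rewrite apmxZE -scalemxAl hnZ -mulrA ler_wpM2l ?normc_ge0// apmx_normP.
Qed.

Fact apmx_normZ (s : C) a : apmx_norm (s *: a) = normc s * apmx_norm a.
Proof.
apply/eqP; rewrite eq_le apmx_normZ_le /=.
have [->|s0] := eqVneq s 0; first by rewrite Normc.normc0 mul0r apmx_norm_ge0.
have ns : 0 < normc s by rewrite lt_def normc_ge0 normc_eq0 s0.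
have := apmx_normZ_le s^-1 (s *: a); rewrite scalerA mulVf// scale1r Normc.normcV.
by rewrite ler_pdivlMl.
Qed.

Fact apmx_normM a b : apmx_norm (a * b) <= apmx_norm a * apmx_norm b.
Proof.
apply: apmx_norm_le => [|x v]; first by rewrite mulr_ge0 ?apmx_norm_ge0.
rewrite apmxME -mulmxA (le_trans (apmx_normP _ _ _))// -mulrA.
by rewrite ler_wpM2l ?apmx_norm_ge0// apmx_normP.
Qed.

Lemma apmx_norm_sqr a : apmx_norm a ^+ 2 <= apmx_norm (apmx_star a * a).
Proof.
set r := apmx_norm (_ * _); have r0 : 0 <= r by exact: apmx_norm_ge0.
have le_s : apmx_norm a <= Num.sqrt r.
  apply: apmx_norm_le => [|x v]; first exact: sqrtr_ge0.
  rewrite -(ler_pXn2r (ltn0Sn 1)) ?nnegrE ?mulr_ge0 ?hnorm_ge0 ?sqrtr_ge0//.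
  rewrite exprMn [Num.sqrt r ^+ 2]sqr_sqrtr//; apply: le_trans (hnorm_sqr_adj _ _) _.
  rewrite [hnorm v ^+ 2]expr2 mulrCA ler_wpM2l ?hnorm_ge0//.
  exact: (apmx_normP (apmx_star a * a)).
by rewrite -(sqr_sqrtr r0) ler_pXn2r ?nnegrE ?apmx_norm_ge0 ?sqrtr_ge0.
Qed.

Lemma apmx_norm_star_ge a : apmx_norm a <= apmx_norm (apmx_star a).
Proof.
have [a0|a0] := eqVneq (apmx_norm a) 0; first by rewrite a0 apmx_norm_ge0.
have na : 0 < apmx_norm a by rewrite lt_def a0 apmx_norm_ge0.
rewrite -(ler_pM2r na) -expr2.
exact: le_trans (apmx_norm_sqr a) (apmx_normM _ _).
Qed.

Fact apmx_cstarE a : apmx_norm (apmx_star a * a) = apmx_norm a ^+ 2.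
Proof.
apply/eqP; rewrite eq_le apmx_norm_sqr andbT (le_trans (apmx_normM _ _))//.
rewrite expr2 ler_wpM2r ?apmx_norm_ge0//.
by rewrite -{2}[a]apmx_starK apmx_norm_star_ge.
Qed.

Lemma apmx_entry_le a x i j : normc (a x i j) <= apmx_norm a.
Proof. by apply: normc_entry_le => v; exact: apmx_normP. Qed.

Lemma apmx_norm_le_entry a B : 0 <= B -> (forall x i j, normc (a x i j) <= B) ->
  apmx_norm a <= n%:R * n%:R * B.
Proof.
move=> B0 h; apply: apmx_norm_le => [|x v]; first by rewrite !mulr_ge0.
by apply: hnorm_mul_le => i j; exact: h.
Qed.

Lemma apmx_complete (u : nat -> apmx) :
  (forall e : R, 0 < e -> exists N, forall m k, (N <= m)%N -> (N <= k)%N ->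
    apmx_norm (u m - u k) < e) ->
  exists l, forall e : R, 0 < e -> exists N, forall k, (N <= k)%N ->
    apmx_norm (u k - l) < e.
Proof.
move=> hu.
have entry x i j : exists l, forall e : R, 0 < e -> exists N, forall k, (N <= k)%N ->
    normc (u k x i j - l) < e.
  apply: normc_complete => e /hu[N hN]; exists N => m k Nm Nk.
  apply: le_lt_trans (hN _ _ Nm Nk).
  by have := apmx_entry_le (u m - u k) x i j; rewrite !mxE.
have [l hl] := choice (fun p : X * 'I_n * 'I_n => entry p.1.1 p.1.2 p.2).
have unif (e : R) : 0 < e -> exists N, forall k, (N <= k)%N ->
    forall x i j, normc (u k x i j - l (x, i, j)) <= e.
  move=> e0; have e20 : 0 < e / 2 by rewrite divr_gt0.
  have [N hN] := hu _ e20; exists N => k Nk x i j.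
  have [M hM] := hl (x, i, j) _ e20.
  have h1 := hM (maxn N M) (leq_maxr _ _).
  have h2 := apmx_entry_le (u k - u (maxn N M)) x i j.
  have h3 := hN _ _ Nk (leq_maxl N M).
  have -> : u k x i j - l (x, i, j) = (u k x i j - u (maxn N M) x i j) +
      (u (maxn N M) x i j - l (x, i, j)) by rewrite addrA subrK.
  apply: le_trans (le_normcD _ _) _; rewrite [leRHS]splitr; apply: lerD.
    by apply: le_trans (ltW h3); rewrite !mxE in h2.
  exact: ltW.
have lP i j : ap (fun x => (\matrix_(i, j) l (x, i, j)) i j).
  apply: ap_limit => e e0; have [N hN] := unif _ e0.
  exists (fun x => u N x i j); first exact: apP.
  by move=> x; rewrite mxE normcB hN.
exists (Apmx lP) => e e0.
have e1 : 0 < e / (n%:R * n%:R + 1) by rewrite divr_gt0// ltr_wpDl ?mulr_ge0.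
have [N hN] := unif _ e1; exists N => k Nk.
apply: le_lt_trans (_ : n%:R * n%:R * (e / (n%:R * n%:R + 1)) < e).
  apply: apmx_norm_le_entry => [|x i j]; first exact: ltW.
  by rewrite !mxE; exact: hN.
rewrite mulrCA gtr_pMr// ltr_pdivrMr ?mul1r ?ltrDl//.
by rewrite ltr_wpDl ?mulr_ge0.
Qed.

Fact apmx_norm_complete (u : nat -> apmx) :
  (forall e : R, 0 < e -> exists N : nat, forall m n : nat,
     (N <= m)%N -> (N <= n)%N -> apmx_norm (u m - u n) < e) ->
  exists l : apmx, (apmx_norm (u n - l) @[n --> \oo] --> (0 : R))%classic.
Proof.
move=> /apmx_complete[l hl]; exists l; apply/cvgrPdist_lt => e /hl[N hN].
exists N => // k /hN; rewrite sub0r normrN ger0_norm//; exact: apmx_norm_ge0.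
Qed.

HB.instance Definition _ := isCstarAlgebra.Build R apmx apmx_starK apmx_starD
  apmx_starZ apmx_starM apmx_norm_eq0 apmx_normD apmx_normZ apmx_normM
  apmx_cstarE apmx_norm_complete.

End Algebra.

Section MatrixNorm.
Variables (R : realType) (A : cstarAlgType R).

Definition mxnu m n (a : 'M[A]_(m, n)) : R := \sum_i \sum_j cnorm (a i j).

Lemma mxnu_ge0 m n (a : 'M[A]_(m, n)) : 0 <= mxnu a.
Proof. by apply: sumr_ge0 => i _; apply: sumr_ge0 => j _; exact: cnorm_ge0. Qed.

Lemma cnorm_le_mxnu m n (a : 'M[A]_(m, n)) i j : cnorm (a i j) <= mxnu a.
Proof.
rewrite /mxnu (bigD1 i)//= (bigD1 j)//= -addrA lerDl addr_ge0//.
  by apply: sumr_ge0 => k _; exact: cnorm_ge0.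
by apply: sumr_ge0 => k _; apply: sumr_ge0 => l _; exact: cnorm_ge0.
Qed.

Lemma mxnu_le m n (a : 'M[A]_(m, n)) (e : R) :
  (forall i j, cnorm (a i j) <= e) -> mxnu a <= m%:R * n%:R * e.
Proof.
move=> h; rewrite /mxnu.
have -> : m%:R * n%:R * e = \sum_(i < m) \sum_(j < n) e.
  by rewrite !sumr_const !card_ord -[RHS]mulr_natl -[e *+ n]mulr_natl mulrA.
by apply: ler_sum => i _; apply: ler_sum => j _.
Qed.

Lemma mxnuM m n p (a : 'M[A]_(m, n)) (b : 'M[A]_(n, p)) :
  mxnu (a *m b) <= mxnu a * mxnu b.
Proof.
rewrite /mxnu mulr_suml; apply: ler_sum => i _.
apply: le_trans (_ : \sum_j \sum_k cnorm (a i k) * cnorm (b k j) <= _).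
  apply: ler_sum => j _; rewrite mxE (le_trans (cnorm_sum _ _ _))//.
  by apply: ler_sum => k _; exact: cnormM.
rewrite exchange_big /= mulr_suml; apply: ler_sum => k _.
rewrite -mulr_sumr ler_wpM2l ?cnorm_ge0// [leRHS](bigD1 k)//= lerDl.
by apply: sumr_ge0 => l _; apply: sumr_ge0 => j _; exact: cnorm_ge0.
Qed.

Lemma mx_complete_norm N : complete_norm (@mxnu N N).
Proof.
split.
- move=> a b; rewrite /mxnu -big_split; apply: ler_sum => i _.
  by rewrite -big_split; apply: ler_sum => j _; rewrite mxE cnormD.
- move=> a; apply: eq_bigr => i _; apply: eq_bigr => j _.
  by rewrite mxE cnormN.
- move=> a a0; apply/matrixP => i j; rewrite mxE; apply: cnorm_eq0.
  by apply/eqP; rewrite eq_le cnorm_ge0 andbT -a0 cnorm_le_mxnu.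
- exact: mxnu_ge0.
- by rewrite /mxnu big1// => i _; rewrite big1// => j _; rewrite mxE cnorm0.
- exact: mxnuM.
- move=> w hw.
  have entry i j : exists l, forall e : R, 0 < e -> exists N0, forall k,
      (N0 <= k)%N -> cnorm (w k i j - l) < e.
    apply: cstar_completeE => e /hw[N0 h]; exists N0 => m k hm hk.
    apply: le_lt_trans (h _ _ hm hk).
    by have := cnorm_le_mxnu (w m - w k) i j; rewrite !mxE.
  have [l hl] := choice (fun p : 'I_N * 'I_N => entry p.1 p.2).
  exists (\matrix_(i, j) l (i, j)) => e e0.
  have K0 : 0 <= (N%:R * N%:R : R) by rewrite mulr_ge0.
  have e1 : 0 < e / (N%:R * N%:R + 1) by rewrite divr_gt0// ltr_wpDl.
  have [N0 hN0] := choice (fun p => hl p _ e1).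
  exists (\max_p N0 p) => k hk.
  apply: le_lt_trans (_ : N%:R * N%:R * (e / (N%:R * N%:R + 1)) < e).
    apply: mxnu_le => i j; rewrite !mxE; apply: ltW; apply: (hN0 (i, j)).
    exact: leq_trans (leq_bigmax (i, j)) hk.
  rewrite mulrCA gtr_pMr// ltr_pdivrMr ?mul1r ?ltrDl//.
  by rewrite ltr_wpDl.
Qed.

End MatrixNorm.

Section Cocycle3.
Variables (R : realType) (q N : nat).
Local Notation C := R[i].
Local Notation normc := (@Normc.normc R).
Local Notation n := q.+1.
Local Notation X := 'cV[int]_3.
Local Notation B := (apmx R q).
Implicit Types a b : B.

Definition tr a : R := rmean (fun x => \tr (a x)).

Lemma ap_tr a : ap (fun x => \tr (a x)).
Proof. by apply: ap_sum => i; exact: apP. Qed.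

Lemma trD a b : tr (a + b) = tr a + tr b.
Proof.
rewrite -rmeanD; try exact: ap_tr.
by congr rmean; apply/funext => x; rewrite apmxDE mxtraceD.
Qed.

Lemma trC a b : tr (a * b) = tr (b * a).
Proof. by congr rmean; apply/funext => x; rewrite !apmxME mxtrace_mulC. Qed.

Lemma tr_le a : `|tr a| <= n%:R * cnorm a.
Proof.
apply: rmean_le; first exact: ap_tr.
move=> x; apply: le_trans (normc_sum _ _ _) _.
have -> : n%:R * cnorm a = \sum_(i < n) cnorm a.
  by rewrite sumr_const card_ord -[RHS]mulr_natl.
by apply: ler_sum => i _; exact: apmx_entry_le.
Qed.

Lemma tr_sum (J : Type) (r : seq J) (F : J -> B) :
  tr (\sum_(i <- r) F i) = \sum_(i <- r) tr (F i).
Proof.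
elim: r => [|i r IH]; last by rewrite !big_cons trD IH.
rewrite !big_nil; have := trD 0 0; rewrite addr0; lra.
Qed.

Definition der (j : 'I_3) a b : Prop :=
  forall i k, apd j (fun x => a x i k) (fun x => b x i k).

Lemma derD j a a' b b' : der j a a' -> der j b b' -> der j (a + b) (a' + b').
Proof.
move=> ha hb i k; apply: apd_eq (apdD (ha i k) (hb i k)) => x;
  by rewrite apmxDE mxE.
Qed.

Lemma der_cst (M : 'M[C]_n) j a b : (forall x, a x = M) -> (forall x, b x = 0) ->
  der j a b.
Proof.
move=> ha hb i k; apply: apd_eq (apd_cst j (M i k)) => x; rewrite ?ha ?hb//.
by rewrite mxE.
Qed.

Lemma derM j a a' b b' : der j a a' -> der j b b' ->
  der j (a * b) (a' * b + a * b').
Proof.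
move=> ha hb i k.
have := apd_sum (index_enum 'I_n) (fun l => apdM (ha i l) (hb l k)).
apply: apd_eq => x; first by rewrite apmxME mxE.
by rewrite apmxDE !apmxME !mxE big_split.
Qed.

Lemma derN j a a' : der j a a' -> der j (- a) (- a').
Proof.
move=> ha i k; have := apdM (apd_cst j (-1)) (ha i k).
by apply: apd_eq => x; rewrite apmxNE mxE ?mul0r ?add0r mulN1r.
Qed.

Lemma der_sum j (J : Type) (r : seq J) (F F' : J -> B) :
  (forall i, der j (F i) (F' i)) ->
  der j (\sum_(i <- r) F i) (\sum_(i <- r) F' i).
Proof.
move=> h; elim: r => [|i r IH]; last by rewrite !big_cons; exact: derD.
by rewrite !big_nil; exact: (@der_cst 0).
Qed.

Lemma der_closed j a a' : (forall e : R, 0 < e -> exists b b',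
  [/\ der j b b', cnorm (b - a) < e & cnorm (b' - a') < e]) -> der j a a'.
Proof.
move=> h i k; apply: apd_closed => e /h[b [b' [hb hba hba']]].
exists (fun x => b x i k), (fun x => b' x i k); split=> // x.
- rewrite normcB; apply: le_trans (ltW hba).
  by have := apmx_entry_le (b - a) x i k; rewrite !mxE.
- rewrite normcB; apply: le_trans (ltW hba').
  by have := apmx_entry_le (b' - a') x i k; rewrite !mxE.
Qed.

Lemma tr_der j a a' : der j a a' -> tr a' = 0.
Proof.
by move=> h; apply: (@rmean_apd _ j (fun x => \tr (a x))); apply: apd_sum => i.
Qed.

Fact tmxP (L : 'I_n -> 'I_n -> seq (C * 'rV[int]_3)) i k :
  ap (fun x => (\matrix_(i, k) trig (L i k) x : 'M[C]_n) i k).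
Proof. by apply: ap_eq (ap_trig (L i k)) => x; rewrite mxE. Qed.

Definition tmx L : B := Apmx (tmxP L).

Lemma der_tmx j L : der j (tmx L) (tmx (fun i k => trig_der j (L i k))).
Proof. by move=> i k; apply: apd_eq (apd_trig j (L i k)) => x; rewrite mxE. Qed.

Lemma tmx_dense a (e : R) : 0 < e -> exists L, cnorm (tmx L - a) < e.
Proof.
move=> e0; have e1 : 0 < e / (n%:R * n%:R + 1) by rewrite divr_gt0// ltr_wpDl// mulr_ge0.
have [L hL] := choice (fun p : 'I_n * 'I_n => apP a p.1 p.2 e1).
exists (fun i k => L (i, k)).
apply: le_lt_trans (_ : n%:R * n%:R * (e / (n%:R * n%:R + 1)) < e).
  apply: apmx_norm_le_entry => [|x i k]; first exact: ltW.
  by rewrite !mxE normcB; exact: hL (i, k) x.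
rewrite mulrCA gtr_pMr// ltr_pdivrMr ?mul1r ?ltrDl//.
by rewrite ltr_wpDl ?mulr_ge0.
Qed.

Lemma apmx_derivations : derivations (@cnorm R B) der.
Proof.
split.
- exact: derD.
- exact: derN.
- exact: derM.
- by move=> j; exact: (@der_cst 1%:M).
- exact: der_closed.
- move=> a e e0; have [L hL] := tmx_dense a e0.
  exists (tmx L), (fun j => tmx (fun s t => trig_der j (L s t))).
  exists (fun l j => tmx (fun s t => trig_der l (trig_der j (L s t)))); split=> //.
  split=> [j|j l|j l]; [exact: der_tmx|exact: der_tmx|].
  by congr tmx; apply/funext => s; apply/funext => t; rewrite pdC.
Qed.

Definition mxder j (a b : 'M[B]_N) : Prop := forall i k, der j (a i k) (b i k).

Definition mxtr (a : 'M[B]_N) : R := \sum_i tr (a i i).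

Definition mxkap m : 'M[B]_N := (((m.+1%:R^-1 : C)%:A : B)%:M).

Lemma smooth_mx (p : 'M[B]_N) (p1 : 'I_3 -> 'M[B]_N) (p2 : 'I_3 -> 'I_3 -> 'M[B]_N) :
  (forall i k, smooth der (p i k) (fun j => p1 j i k) (fun l j => p2 l j i k)) ->
  smooth mxder p p1 p2.
Proof.
move=> h; split=> [j i k|j l i k|j l]; first by case: (h i k).
  by case: (h i k).
by apply/matrixP => i k; case: (h i k).
Qed.

Lemma mx_derivations : derivations (@mxnu R B N N) mxder.
Proof.
have HD := apmx_derivations; split.
- by move=> j a a' b b' ha hb i k; rewrite !mxE; exact: derD.
- by move=> j a a' ha i k; rewrite !mxE; exact: derN.
- move=> j a a' b b' ha hb i k; rewrite !mxE -big_split.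
  by apply: der_sum => l; exact: derM.
- move=> j i k; rewrite !mxE; case: (i == k) => /=.
    exact: (@der_cst 1%:M).
  exact: (@der_cst 0).
- move=> j a a' h i k; apply: der_closed => e /h[p [p' [hp hpa hpa']]].
  exists (p i k), (p' i k); split; first exact: hp.
  + by apply: le_lt_trans hpa; have := cnorm_le_mxnu (p - a) i k; rewrite !mxE.
  + by apply: le_lt_trans hpa'; have := cnorm_le_mxnu (p' - a') i k; rewrite !mxE.
- move=> a e e0.
  have e1 : 0 < e / (N%:R * N%:R + 1) by rewrite divr_gt0// ltr_wpDl// mulr_ge0.
  have [p hp] := choice (fun t : 'I_N * 'I_N => Ddense HD (a t.1 t.2) e1).
  have [p1 hp1] := choice hp; have [p2 hp2] := choice hp1.
  exists (\matrix_(i, k) p (i, k)), (fun j => \matrix_(i, k) p1 (i, k) j).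
  exists (fun l j => \matrix_(i, k) p2 (i, k) l j); split.
    apply: smooth_mx => i k; rewrite mxE; case: (hp2 (i, k)) => -[h1 h2 h3] _.
    by split=> [j|j l|j l]; rewrite !mxE.
  apply: le_lt_trans (_ : N%:R * N%:R * (e / (N%:R * N%:R + 1)) < e).
    by apply: mxnu_le => i k; rewrite !mxE; case: (hp2 (i, k)) => _ /ltW.
  rewrite mulrCA gtr_pMr// ltr_pdivrMr ?mul1r ?ltrDl//.
  by rewrite ltr_wpDl ?mulr_ge0.
Qed.

Lemma mx_invariant_trace : invariant_trace (@mxnu R B N N) mxder mxtr n%:R.
Proof.
split.
- by move=> a b; rewrite /mxtr -big_split; apply: eq_bigr => i _; rewrite mxE trD.
- move=> a b; rewrite /mxtr.
  transitivity (\sum_i \sum_k tr (a i k * b k i)).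
    by apply: eq_bigr => i _; rewrite mxE tr_sum.
  rewrite exchange_big; apply: eq_bigr => k _; rewrite mxE tr_sum.
  by apply: eq_bigr => i _; rewrite trC.
- by [].
- move=> a; apply: le_trans (ler_norm_sum _ _ _) _.
  rewrite /mxnu mulr_sumr; apply: ler_sum => i _.
  apply: le_trans (tr_le _) _; rewrite ler_wpM2l// (bigD1 i)//= lerDl.
  by apply: sumr_ge0 => k _; exact: cnorm_ge0.
- move=> j a a' h; rewrite /mxtr big1// => i _; exact: tr_der (h i i).
Qed.

Lemma mx_reciprocals : reciprocals (@mxnu R B N N) mxder mxkap.
Proof.
have kE m (a : 'M[B]_N) : mxkap m * a = map_mx (GRing.scale (m.+1%:R^-1 : C)) a.
  apply/matrixP => i k; rewrite /mxkap -mulmxE mul_scalar_mx !mxE.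
  by rewrite -scalerAl mul1r.
split.
- move=> m a; apply/matrixP => i k; rewrite /mxkap kE.
  rewrite -mulmxE !mxE (bigD1 k)//= big1 => [|l lk].
    by rewrite !mxE eqxx addr0 mulr1n -scalerAr mulr1.
  by rewrite !mxE (negPf lk) mulr0n mulr0.
- move=> m; apply/matrixP => i k; rewrite mulmxnE !mxE; case: (i == k) => /=.
    rewrite -scaler_nat scalerA mulfV ?scale1r//.
    by rewrite pnatr_eq0.
  by rewrite !mulr0n mul0rn.
- move=> m a; rewrite kE /mxnu mulr_sumr; apply: ler_sum => i _.
  rewrite mulr_sumr; apply: ler_sum => k _; rewrite mxE cnormZ.
  by rewrite Normc.normcV normc_nat.
- move=> m j i k; rewrite !mxE; case: (i == k) => /=.
    rewrite mulr1n.
    exact: (@der_cst ((m.+1%:R^-1 : C) *: 1%:M)).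
  by rewrite mulr0n; exact: (@der_cst 0).
Qed.

End Cocycle3.

(** * Determinant sums along the powers of the companion matrix *)

Definition units_mod (n : nat) : {set 'I_n} := [set i : 'I_n | coprime n i].

Lemma card_units_mod n : #|units_mod n| = totient n.
Proof.
rewrite totient_count_coprime big_mkord -sum1_card big_mkcond /=.
by apply: eq_bigr => i _; rewrite inE; case: coprime.
Qed.

(* More than half of the residues are units, so i and -1 - i are often both
   units. *)
Lemma three_units n : (n + 5 <= 2 * totient n)%N -> exists a b : nat,
  [/\ [/\ coprime n a, coprime n b & (a + b).+1 = n], a != b, a != 1%N & b != 1%N].
Proof.
rewrite -card_units_mod; set S := units_mod n => le5.
pose S' := [set i : 'I_n | rev_ord i \in S].
have cS' : #|S'| = #|S|.
  have -> : S' = @rev_ord n @^-1: S by apply/setP => i; rewrite !inE.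
  rewrite on_card_preimset//; exists (@rev_ord n) => i _; exact: rev_ordK.
have cU : (#|S :|: S'| <= n)%N by rewrite -[X in (_ <= X)%N]card_ord max_card.
have := cardsUI S S'; rewrite cS' => cUI.
pose E1 := [set i : 'I_n | i == 1%N :> nat].
pose E2 := [set i : 'I_n | rev_ord i == 1%N :> nat].
pose E3 := [set i : 'I_n | i == rev_ord i].
have le1 (E : {set 'I_n}) : (forall i j, i \in E -> j \in E -> i = j) -> (#|E| <= 1)%N.
  by move=> h; apply/card_le1_eqP => i j hi hj; exact: h.
have c1 : (#|E1| <= 1)%N.
  by apply: le1 => i j; rewrite !inE => /eqP ? /eqP ?; apply: val_inj => /=; lia.
have c2 : (#|E2| <= 1)%N.
  apply: le1 => i j; rewrite !inE /= => /eqP ? /eqP ?; apply: val_inj => /=.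
  by have := ltn_ord i; have := ltn_ord j; lia.
have c3 : (#|E3| <= 1)%N.
  apply: le1 => i j; rewrite !inE -!val_eqE /= => /eqP ? /eqP ?; apply: val_inj => /=.
  by have := ltn_ord i; have := ltn_ord j; lia.
have : (0 < #|(S :&: S') :\: (E1 :|: E2 :|: E3)|)%N.
  have h1 := cardsID (E1 :|: E2 :|: E3) (S :&: S').
  have h2 : (#|S :&: S' :&: (E1 :|: E2 :|: E3)| <= #|E1 :|: E2 :|: E3|)%N.
    exact/subset_leq_card/subsetIr.
  have h3 := (leq_card_setU (E1 :|: E2) E3).1; have h4 := (leq_card_setU E1 E2).1.
  move: h1 h2 h3 h4 cUI cU le5 c1 c2 c3.
  move: #|S :&: S' :&: (E1 :|: E2 :|: E3)| #|S :&: S' :\: (E1 :|: E2 :|: E3)|.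
  move: #|S :&: S'| #|S :|: S'| #|E1 :|: E2 :|: E3| #|E1 :|: E2| #|E1| #|E2| #|E3| #|S|.
  by lia.
rewrite card_gt0 => /finset.set0Pn[i SiS]; move: SiS; rewrite !inE !negb_or -!andbA.
move=> /and5P[n1 n2 n3 u1 u2]; exists i, (rev_ord i).
split; [split=> //|by []|by []|by []].
by have := ltn_ord i; rewrite /=; lia.
Qed.

Lemma det_mulmx_expand (R : comPzRingType) m d (A : 'M[R]_(m, d)) (Z : 'M[R]_(d, m)) :
  \det (A *m Z) = \sum_(f : {ffun 'I_m -> 'I_d})
    (\prod_i A i (f i)) * \det (rowsub f Z).
Proof.
rewrite /determinant.
transitivity (\sum_(s : 'S_m) \sum_(f : {ffun 'I_m -> 'I_d})
    (-1) ^+ s * ((\prod_i A i (f i)) * \prod_i Z (f i) (s i))).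
  apply: eq_bigr => s _; rewrite -mulr_sumr; congr (_ * _).
  under eq_bigr do rewrite mxE.
  rewrite bigA_distr_bigA; apply: eq_bigr => f _; exact: big_split.
rewrite exchange_big; apply: eq_bigr => f _; rewrite mulr_sumr.
apply: eq_bigr => s _; rewrite mulrCA; congr (_ * (_ * _)).
by apply: eq_bigr => i _; rewrite !mxE.
Qed.

Section Eigenvectors.
Variable n : nat.
Hypothesis n_gt0 : (0 < n)%N.
Local Notation d := (totient n).
Local Notation g := (cyclotomic_companion n).

Let gm i : 'M[int]_d := intGL_mx (g ^+ i)%g.
Let cm (M : 'M[int]_d) : 'M[algC]_d := map_mx intr M.

Definition powers (l : algC) : 'rV[algC]_d := \row_i l ^+ i.

Lemma root_Cyclotomic (l : algC) : n.-primitive_root l ->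
  \sum_(i < d) (('Phi_n)`_i)%:~R * l ^+ i = - l ^+ d.
Proof.
move=> pl; have /rootP := root_cyclotomic pl l; rewrite pl /root.
rewrite -(Cintr_Cyclotomic pl) => /esym/eqP.
rewrite horner_coef size_map_inj_poly ?rmorph0//; last exact: intr_inj.
rewrite size_Cyclotomic big_ord_recr /= !coef_map /=.
have := Cyclotomic_monic n; rewrite monicE lead_coefE size_Cyclotomic /= => /eqP ->.
rewrite mul1r eq_sym addr_eq0 => /eqP <-.
by apply: eq_bigr => i _; rewrite coef_map.
Qed.

Lemma powers_companion l : n.-primitive_root l ->
  powers l *m cm g = l *: powers l.
Proof.
move=> pl; apply/matrixP => i j; rewrite !mxE.
under eq_bigr do rewrite !mxE.
rewrite -exprS; case: ltnP => [lt|ge].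
  rewrite (bigD1 (Ordinal lt))//= eqxx mulr1 big1 ?addr0// => k kj.
  by rewrite -val_eqE /= in kj; rewrite (negPf kj) mulr0.
have -> : j.+1 = d by apply/eqP; rewrite eqn_leq ltn_ord.
rewrite -[RHS]opprK -(root_Cyclotomic pl) -sumrN; apply: eq_bigr => k _.
by rewrite rmorphN mulrN mulrC.
Qed.

Lemma powers_gm l s : n.-primitive_root l ->
  powers l *m cm (gm s) = l ^+ s *: powers l.
Proof.
move=> pl; elim: s => [|s IH].
  by rewrite /gm expg0 /cm map_mx1 mulmx1 expr0 scale1r.
have -> : cm (gm s.+1) = cm g *m cm (gm s) by rewrite /cm -map_mxM /gm expgS.
by rewrite mulmxA powers_companion// -scalemxAl IH scalerA -exprS.
Qed.

Lemma companion_expn : (g ^+ n = 1)%g.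
Proof.
have [z pz] := C_prim_root_exists n_gt0.
apply: val_inj; apply/eqP; rewrite -subr_eq0; apply/eqP.
set M := _ - _; have M0 l : n.-primitive_root l -> powers l *m cm M = 0.
  move=> pl; rewrite /cm map_mxB mulmxBr.
  by rewrite [X in X - _](powers_gm n pl) (prim_expr_order pl) scale1r map_mx1 mulmx1 subrr.
apply/matrixP => i j; rewrite [RHS]mxE.
pose p : {poly algC} := \poly_(k < d) (if insub k is Some k' then (M k' j)%:~R else 0).
have pE k : p`_(val (k : 'I_d)) = (M k j)%:~R.
  by rewrite coef_poly ltn_ord valK.
have p0 : p = 0.
  apply/eqP; apply: contraT => pn0.
  pose rs := [seq z ^+ val k | k <- enum (units_mod n)].
  have h1 : all (root p) rs.
    apply/allP => y /mapP[k]; rewrite mem_enum inE => ck ->.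
    have pk : n.-primitive_root (z ^+ k) by rewrite prim_root_exp_coprime// coprime_sym.
    have /matrixP/(_ 0 j) := M0 _ pk; rewrite !mxE => E.
    apply/rootP; rewrite horner_poly -[RHS]E; apply: eq_bigr => t _.
    by rewrite valK !mxE mulrC.
  have h2 : uniq rs.
    rewrite map_inj_uniq; first exact: enum_uniq.
    move=> k l /eqP.
    by rewrite (eq_prim_root_expr pz) !modn_small ?ltn_ord// => /eqP/val_inj.
  have := max_poly_roots pn0 h1 h2; rewrite size_map -cardE card_units_mod.
  by rewrite ltnNge size_poly.
have /eqP := pE i; rewrite p0 coef0 eq_sym intr_eq0 => /eqP.
by [].
Qed.

Lemma companion_order : exists q, (g ^+ q.+1 = 1)%g /\
  forall k, (0 < k < q.+1)%N -> (g ^+ k <> 1)%g.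
Proof.
have ex : exists k, (0 < k)%N && (g ^+ k == 1)%g.
  by exists n; rewrite n_gt0 companion_expn eqxx.
case: (ex_minnP ex) => -[//|q] /= /eqP gq qmin; exists q; split=> // k /andP[k0 kq] gk.
by have := qmin k; rewrite k0 gk eqxx leqNgt kq => /(_ isT).
Qed.

Lemma minor_sum_neq0 q (hd : (n + 5 <= 2 * d)%N) (Y : 'M[int]_(d, 3)) :
  (forall i k, Y i k = (i == k :> nat)%:R) ->
  exists P : 'M[int]_(3, d), \sum_(i < q.+1) \det (P *m gm i *m Y) != 0.
Proof.
move=> hY; have [z pz] := C_prim_root_exists n_gt0.
have [a [b [[ca cb ab] nab na1 nb1]]] := three_units hd.
pose ex (p : 'I_3) := nth 0%N [:: 1; a; b]%N p.
have exlt p : (ex p < n)%N by case: p => -[|[|[|//]]] ? /=; rewrite /ex /=; lia.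
have exco p : coprime (ex p) n.
  by case: p => -[|[|[|//]]] ?; rewrite /ex /= ?coprime1n // coprime_sym.
have exinj p p' : ex p = ex p' -> p = p'.
  move=> E; apply: val_inj; move: E.
  by case: p p' => -[|[|[|//]]] ? [[|[|[|//]]] ?]; rewrite /ex //=; lia.
pose lam p := z ^+ ex p.
have plam p : n.-primitive_root (lam p) by rewrite prim_root_exp_coprime.
have lam_inj p p' : lam p = lam p' -> p = p'.
  move=> /eqP; rewrite (eq_prim_root_expr pz) !modn_small// => /eqP; exact: exinj.
have lam_prod : \prod_p lam p = 1.
  rewrite -expr_sum !big_ord_recl big_ord0 /ex /= -[RHS](prim_expr_order pz).
  by congr (_ ^+ _); lia.
pose A : 'M[algC]_(3, d) := \matrix_(p, i) lam p ^+ i.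
have Agm s : A *m cm (gm s) = diag_mx (\row_p lam p ^+ s) *m A.
  apply/row_matrixP => p; rewrite [LHS]row_mul.
  have -> : row p A = powers (lam p) by apply/rowP => i; rewrite !mxE.
  rewrite powers_gm//; apply/rowP => i.
  by rewrite [RHS]mxE mul_diag_mx !mxE.
pose v := \det (A *m map_mx intr Y).
have v0 : v != 0.
  have -> : v = \det (Vandermonde 3 (\row_p lam p)).
    rewrite -det_tr; congr (\det _); apply/matrixP => p k; rewrite !mxE.
    have kd : (k < d)%N by have := ltn_ord k; have := exlt ord0; lia.
    rewrite (bigD1 (Ordinal kd))//= big1 => [|i ik].
      by rewrite !mxE hY /= eqxx mulr1 addr0.
    by rewrite -val_eqE /= in ik; rewrite !mxE hY (negPf ik) mulr0.
  rewrite det_Vandermonde; apply/prodf_neq0 => i _; apply/prodf_neq0 => j ij.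
  rewrite !mxE subr_eq0; apply/eqP => /lam_inj E.
  by rewrite E ltnn in ij.
have detE s : \det (A *m map_mx intr (gm s *m Y)) = v.
  rewrite map_mxM mulmxA [A *m _]Agm -mulmxA det_mulmx det_diag.
  under eq_bigr do rewrite mxE.
  by rewrite prodrXl lam_prod expr1n mul1r.
apply/not_existsP => h.
have : \sum_(s < q.+1) \det (A *m map_mx intr (gm s *m Y)) = 0.
  under eq_bigr do rewrite det_mulmx_expand.
  rewrite exchange_big big1// => f _; rewrite -mulr_sumr.
  have -> : \sum_(i < q.+1) \det (rowsub f (map_mx intr (gm i *m Y))) =
      (\sum_(i < q.+1) \det (rowsub f 1%:M *m gm i *m Y))%:~R :> algC.
    rewrite rmorph_sum; apply: eq_bigr => i _ /=; rewrite -det_map_mx; congr (\det _).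
    by rewrite -mulmxA mul_rowsub_mx mul1mx map_mxsub.
  by have /negP := h (rowsub f 1%:M); rewrite negbK => /eqP ->; rewrite mulr0.
under eq_bigr do rewrite detE.
rewrite sumr_const card_ord => /eqP; rewrite mulrn_eq0 /=.
by rewrite (negPf v0).
Qed.

End Eigenvectors.

(** * The induced representation *)

Section Contractive.
Variables (R : realType) (q : nat) (A : cstarAlgType R).
Variable pi : {lrmorphism A -> apmx R q}.
Hypothesis pi_star : {morph pi : x / star x >-> star x}.

Lemma hnorm_sqr_pi a x v : hnorm (pi a x *m v) ^+ 2 =
  complex.Re (dot v (pi (star a * a) x *m v)).
Proof.
rewrite rmorphM /= pi_star ?apmxME -mulmxA.
have -> : star (pi a) x = adj (pi a x) by [].
by rewrite -dot_adj dot_self.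
Qed.

Lemma star_morphism_unit_ball a : cnorm a < 1 -> cnorm (pi a) <= 1.
Proof.
move=> a1; have b1 : cnorm (star a * a) < 1.
  by rewrite cstarE expr_lt1// cnorm_ge0.
have [|y [sy yE]] := cstar_sqrt _ b1; first by rewrite starM starK.
apply: apmx_norm_le => // x v; rewrite mul1r.
rewrite -(ler_pXn2r (ltn0Sn 1)) ?nnegrE ?hnorm_ge0// hnorm_sqr_pi.
have := hnorm_sqr_pi y x v; rewrite sy yE rmorphB rmorph1 => E.
have : pi (star a * a) x *m v = v - (1 - pi (star a * a)) x *m v.
  by rewrite apmxDE apmxNE apmx1E mulmxBl mul1mx opprB addrC subrK.
move=> ->; have dB w w' : dot v (w - w') = dot v w - dot v w'.
  rewrite /dot -sumrB; apply: eq_bigr => i _.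
  by rewrite !mxE mulrBr.
have ReB (z w : R[i]) : complex.Re (z - w) = complex.Re z - complex.Re w.
  by case: z w => ? ? [].
rewrite dB ReB -E dot_self /=; by rewrite lerBlDr lerDl sqr_ge0.
Qed.

Lemma star_morphism_contractive a : cnorm (pi a) <= cnorm a.
Proof.
apply: le_eps => e e0; have e20 : 0 < e / 2 by rewrite divr_gt0.
pose r := cnorm a + e / 2; have r0 : 0 < r by rewrite ltr_wpDl// cnorm_ge0.
have sr : Normc.normc ((r^-1)%:C)%C = r^-1 by rewrite normcR ger0_norm// invr_ge0 ltW.
have : cnorm (((r^-1)%:C)%C *: a) < 1.
  by rewrite cnormZ sr mulrC ltr_pdivrMr// mul1r ltrDl.
move=> /star_morphism_unit_ball; rewrite linearZ cnormZ sr ler_pdivrMl// mulr1.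
by move=> /le_lt_trans; apply; rewrite ltrD2l ltr_pdivrMr// ltr_pMr// ltr1n.
Qed.

End Contractive.

Section InducedRepresentation.
Variables (R : realType) (d q : nat) (g : intGL d).
Hypothesis gq : (g ^+ q.+1 = 1)%g.
Hypothesis gmin : forall k, (0 < k < q.+1)%N -> (g ^+ k <> 1)%g.
Variable P : 'M[int]_(3, d).
Local Notation C := R[i].
Local Notation n := q.+1.
Local Notation X := 'cV[int]_3.
Local Notation G := (semidirect g).

Let gm i : 'M[int]_d := intGL_mx (g ^+ i)%g.

Lemma expg_modn k : (g ^+ (k %% q.+1) = g ^+ k)%g.
Proof.
by rewrite [in RHS](divn_eq k q.+1) expgnDr mulnC expgnA gq expg1n mul1g.
Qed.

Lemma expg_inj (i j : 'I_n) : (g ^+ i = g ^+ j)%g -> i = j.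
Proof.
wlog le_ij : i j / (i <= j)%N.
  move=> h; have [/h//|/ltnW le_ji E] := leqP i j.
  by apply/esym/h.
move=> E; apply/val_inj/eqP; rewrite eqn_leq le_ij /= leqNgt; apply/negP => lt_ij.
apply: (gmin (k := (j - i)%N)).
  by rewrite subn_gt0 lt_ij (leq_ltn_trans (leq_subr _ _)).
apply: (mulgI (g ^+ i)%g); rewrite -expgnDr subnKC// mulg1.
by rewrite E.
Qed.

Lemma in_cyclic_expg (h : cyclic g) (i : 'I_n) :
  exists j : 'I_n, (g ^+ i * cyclic_val h = g ^+ j)%g.
Proof.
have ord k : exists j : 'I_n, (g ^+ k = g ^+ j)%g.
  by exists (Ordinal (ltn_pmod k (ltn0Sn q))); rewrite /= expg_modn.
case: h => h /= /asboolP[k [->|->]]; first by rewrite -expgnDr.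
have -> : (g ^- k = g ^+ (k * q))%g.
  apply: (mulgI (g ^+ k)%g); rewrite mulgV -expgnDr.
  by rewrite -mulnS mulnC expgnA gq expg1n.
by rewrite -expgnDr.
Qed.

Definition rep_mx (s : G) (x : X) : 'M[C]_n := \matrix_(i, j)
  if (g ^+ i * cyclic_val (sd_mx s) == g ^+ j)%g
  then chi R (P *m gm i *m sd_vec s)^T x else 0.

Fact repP s i j : ap (fun x => rep_mx s x i j).
Proof.
case E : (g ^+ i * cyclic_val (sd_mx s) == g ^+ j)%g.
  by apply: ap_eq (ap_chi (P *m gm i *m sd_vec s)^T) => x; rewrite mxE E.
by apply: ap_eq (ap_cst (0 : C)) => x; rewrite mxE E.
Qed.

Definition rep (s : G) : apmx R q := Apmx (repP s).

Lemma rep_one : rep 1%g = 1.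
Proof.
apply: apmx_eq => x; apply/matrixP => i j; rewrite !mxE /= mulg1 mulmx0.
have -> : (g ^+ i == g ^+ j)%g = (i == j).
  by apply/eqP/eqP => [/expg_inj|->].
by rewrite trmx0 chi0; case: (i == j).
Qed.

Lemma rep_mul : {morph rep : s t / (s * t)%g >-> s * t}.
Proof.
move=> [y h] [y' h']; apply: apmx_eq => x; apply/matrixP => i l.
rewrite apmxME mxE /=; have [j jE] := in_cyclic_expg h i.
rewrite mxE (bigD1 j)//= big1 => [|k kj].
  rewrite !mxE /= jE eqxx addr0 mulgA jE.
  case: eqP => // _; last by rewrite mulr0.
  rewrite mulmxDr raddfD chiD; congr (_ * chi R _ _).
  by rewrite mulmxA -(mulmxA P); congr (P *m _ *m _)^T; rewrite /gm -jE.
rewrite !mxE /= jE; case: eqP => [/expg_inj jk|_]; last by rewrite mul0r.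
by rewrite jk eqxx in kj.
Qed.

Lemma rep_star s : star (rep s) = rep s^-1%g.
Proof.
case: s => y h; apply: apmx_eq => x; apply/matrixP => i j; rewrite !mxE /=.
have -> : (g ^+ j * cyclic_val h == g ^+ i)%g =
    (g ^+ i * (cyclic_val h)^-1 == g ^+ j)%g.
  by apply/eqP/eqP => <-; rewrite ?mulgK// mulgVK.
case: eqP => [E|_]; last by rewrite conjc0.
rewrite chi_conj mulmxN; congr (chi R _ x).
rewrite linearN /=; congr (- _ ^T).
rewrite [RHS]mulmxA -[P *m gm i *m _]mulmxA; congr (P *m _ *m y).
by rewrite /gm -E.
Qed.

Lemma rep_unitary : unitary_rep rep.
Proof.
split; [exact: rep_one|exact: rep_mul|move=> s].
by rewrite rep_star -!rep_mul mulVg mulgV rep_one.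
Qed.

Lemma rep_translation y x : rep (Semidirect y 1%g) x =
  diag_mx (\row_i chi R (P *m gm i *m y)^T x).
Proof.
apply/matrixP => i j; rewrite !mxE /= mulg1.
have -> : (g ^+ i == g ^+ j)%g = (i == j).
  by apply/eqP/eqP => [/expg_inj|->].
by have [->|_] := eqVneq i j; rewrite ?mulr1n ?mulr0n.
Qed.

End InducedRepresentation.

(** * The Bott element and its Chern character *)

Definition mx2 (V : pzSemiRingType) (a b c d : V) : 'M[V]_2 :=
  \matrix_(i, j) if i == 0 :> nat then (if j == 0 :> nat then a else b)
                 else (if j == 0 :> nat then c else d).

Lemma mx2_mul (V : pzSemiRingType) (a b c d a' b' c' d' : V) :
  mx2 a b c d *m mx2 a' b' c' d' =
  mx2 (a * a' + b * c') (a * b' + b * d') (c * a' + d * c') (c * b' + d * d').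
Proof.
apply/matrixP => i j; rewrite !mxE !big_ord_recl big_ord0 !mxE /= addr0.
by case: ifP => _; case: ifP.
Qed.

Lemma mx2_sub (V : pzRingType) (a b c d a' b' c' d' : V) :
  mx2 a b c d - mx2 a' b' c' d' = mx2 (a - a') (b - b') (c - c') (d - d').
Proof. by apply/matrixP => i j; rewrite !mxE; case: ifP => _; case: ifP. Qed.

Lemma mx2_tr (V : pzSemiRingType) (a b c d : V) : \tr (mx2 a b c d) = a + d.
Proof. by rewrite /mxtrace !big_ord_recl big_ord0 !mxE /= addr0. Qed.

Lemma tr_triple (K : comPzRingType) (a b c d a0 b0 c0 d0 a1 b1 c1 d1 a2 b2 c2 d2 : K) :
  \tr (mx2 d (- b) (- c) a *m mx2 a0 b0 c0 d0 *m
    (mx2 d (- b) (- c) a *m mx2 a1 b1 c1 d1 *m (mx2 d (- b) (- c) a *m mx2 a2 b2 c2 d2) -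
     mx2 d (- b) (- c) a *m mx2 a2 b2 c2 d2 *m (mx2 d (- b) (- c) a *m mx2 a1 b1 c1 d1))) =
  - (a * d - b * c) * (
     a * (b0 * (c1 * d2 - c2 * d1) - c0 * (b1 * d2 - b2 * d1) + d0 * (b1 * c2 - b2 * c1))
   - b * (a0 * (c1 * d2 - c2 * d1) - c0 * (a1 * d2 - a2 * d1) + d0 * (a1 * c2 - a2 * c1))
   + c * (a0 * (b1 * d2 - b2 * d1) - b0 * (a1 * d2 - a2 * d1) + d0 * (a1 * b2 - a2 * b1))
   - d * (a0 * (b1 * c2 - b2 * c1) - b0 * (a1 * c2 - a2 * c1) + c0 * (a1 * b2 - a2 * b1))).
Proof.
rewrite !mx2_mul mx2_sub mx2_mul mx2_tr.
ring.
Qed.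

Lemma det_mx33 (K : comPzRingType) (m : 'M[K]_3) : \det m =
  m o0 o0 * (m o1 o1 * m o2 o2 - m o2 o1 * m o1 o2)
  - m o1 o0 * (m o0 o1 * m o2 o2 - m o2 o1 * m o0 o2)
  + m o2 o0 * (m o0 o1 * m o1 o2 - m o1 o1 * m o0 o2).
Proof.
pose f (a b : nat) := m (inord a) (inord b).
have mE i j : m i j = f i j by rewrite /f !inord_val.
rewrite (expand_det_col _ ord0) !big_ord_recl big_ord0 /cofactor.
rewrite !(expand_det_col _ ord0) !big_ord_recl !big_ord0 /cofactor.
rewrite !det_mx11 !mxE !mE /= /bump /=; ring.
Qed.

Ltac commute_tac base := lazymatch goal with
  | |- GRing.comm _ (_ * _) => apply: commrM; commute_tac base
  | |- GRing.comm _ (_ - _) => apply: commrB; commute_tac base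
  | |- GRing.comm _ (_ + _) => apply: commrD; commute_tac base
  | |- GRing.comm (_ * _) _ => apply: commr_sym; commute_tac base
  | |- _ => base
  end.

Section BottElement.
Variable V : pzRingType.
Variables (J : V) (c s : 'I_3 -> V).

Definition bp := c o2 + J * (s o2 * (s o0 * s o1)).
Definition bp' := c o2 - J * (s o2 * (s o0 * s o1)).
Definition bq := J * (s o2 * c o0) + s o2 * c o1.
Definition bq' := J * (s o2 * c o0) - s o2 * c o1.
Definition bh := s o2 * (c o0 * c o1).

(* x0 + i (x1 s1 + x2 s2 + x3 s3) for the Pauli matrices s1, s2, s3 and a map
   (x0, x1, x2, x3) from T^3 to R^4 \ 0 of nonzero degree; its determinant is
   1 + bh ^ 2. *)
Definition bott : 'M[V]_2 := mx2 bp bq bq' bp'.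

Definition bott_inv (nb : V) : 'M[V]_2 :=
  mx2 (bp' * nb) (- bq * nb) (- bq' * nb) (bp * nb).

Definition bott_der (dc ds : 'I_3 -> V) : 'M[V]_2 :=
  let x0 := dc o2 in
  let x1 := ds o2 * c o0 + s o2 * dc o0 in
  let x2 := ds o2 * c o1 + s o2 * dc o1 in
  let x3 := ds o2 * (s o0 * s o1) + s o2 * (ds o0 * s o1 + s o0 * ds o1) in
  mx2 (x0 + J * x3) (J * x1 + x2) (J * x1 - x2) (x0 - J * x3).

Hypothesis JC : forall v, GRing.comm J v.
Hypothesis J2 : J * J = -1.
Hypothesis ccC : forall k l, GRing.comm (c k) (c l).
Hypothesis csC : forall k l, GRing.comm (c k) (s l).
Hypothesis ssC : forall k l, GRing.comm (s k) (s l).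
Hypothesis cs1 : forall k, c k * c k + s k * s k = 1.

Lemma bott_comm z : (forall k, GRing.comm z (c k)) -> (forall k, GRing.comm z (s k)) ->
  [/\ GRing.comm z bp, GRing.comm z bp', GRing.comm z bq, GRing.comm z bq' &
      GRing.comm z bh].
Proof.
move=> zc zs; have zJ : GRing.comm z J by apply: commr_sym; exact: JC.
by split; repeat first [exact: zJ|exact: zc|exact: zs|apply: commrB|apply: commrD|
  apply: commrM].
Qed.

Let sqM (x y : V) : GRing.comm x y -> x * y * (x * y) = x * x * (y * y).
Proof. by move=> xy; rewrite mulrA -(mulrA x y x) -xy !mulrA. Qed.

Let sqB (x y : V) : GRing.comm x y -> (x + y) * (x - y) = x * x - y * y.
Proof.
by move=> xy; rewrite mulrDl !mulrBr xy addrA subrK.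
Qed.

Lemma bott_det : bp * bp' - bq * bq' = 1 + bh * bh.
Proof.
have cC' k l := commr_sym (csC k l).
have JJ x : J * x * (J * x) = - (x * x) by rewrite sqM ?J2 ?mulN1r//; exact: JC.
have JC' v : GRing.comm v J by apply: commr_sym; exact: JC.
rewrite !sqB; first last.
- by commute_tac ltac:(first [exact: JC'|exact: JC|exact: ccC|exact: csC|exact: ssC|exact: cC']).
- by commute_tac ltac:(first [exact: JC'|exact: JC|exact: ccC|exact: csC|exact: ssC|exact: cC']).
rewrite !JJ !opprK.
rewrite !(sqM (x := s o2)); try by commute_tac ltac:(first [exact: ssC|exact: cC']).
rewrite (sqM (ssC o0 o1)) (sqM (ccC o0 o1)).
have sE k : s k * s k = 1 - c k * c k by rewrite -(cs1 k) addrC addKr.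
rewrite -[X in _ = X + _](cs1 o2) [s o0 * s o0]sE [s o1 * s o1]sE.
set S := s o2 * s o2; set a := c o0 * c o0; set b := c o1 * c o1.
have -> : (1 - a) * (1 - b) = 1 + a * b - (a + b).
  rewrite mulrBl mul1r mulrBr mulr1 opprB addrA addrAC [a + b]addrC opprD !addrA.
  by rewrite [LHS]addrAC [1 - b + _]addrAC.
by rewrite -opprD -mulrDr opprK mulrBr -addrA subrK
  mulrDr mulr1 addrA.
Qed.

Lemma bott_comm_pq :
  [/\ GRing.comm bp bp', GRing.comm bp bq, GRing.comm bp bq', GRing.comm bp' bq &
      GRing.comm bp' bq'] /\ [/\ GRing.comm bq bq', GRing.comm bp bh,
      GRing.comm bp' bh, GRing.comm bq bh & GRing.comm bq' bh].
Proof.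
have hc k := bott_comm (ccC k) (csC k).
have hs k := bott_comm (fun l => commr_sym (csC l k)) (ssC k).
have L z : (forall k, GRing.comm (c k) z) -> (forall k, GRing.comm (s k) z) ->
    [/\ GRing.comm z bp, GRing.comm z bp', GRing.comm z bq, GRing.comm z bq' &
    GRing.comm z bh].
  by move=> zc zs; apply: bott_comm => k; apply: commr_sym.
have [||a1 a2 a3 a4 a5] := L bp; [by move=> k; case: (hc k)|by move=> k; case: (hs k)|].
have [||b1 b2 b3 b4 b5] := L bp'; [by move=> k; case: (hc k)|by move=> k; case: (hs k)|].
have [||d1 d2 d3 d4 d5] := L bq; [by move=> k; case: (hc k)|by move=> k; case: (hs k)|].
have [||e1 e2 e3 e4 e5] := L bq'; [by move=> k; case: (hc k)|by move=> k; case: (hs k)|].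
by [].
Qed.

Lemma comm_inverse (x n y : V) : x * n = 1 -> n * x = 1 -> GRing.comm y x ->
  GRing.comm y n.
Proof.
move=> xn nx yx; rewrite /GRing.comm.
by rewrite -[LHS]mul1r -nx -!mulrA (mulrA x) -yx -(mulrA y) xn mulr1.
Qed.

Lemma bott_invE nb : (1 + bh * bh) * nb = 1 -> nb * (1 + bh * bh) = 1 ->
  bott *m bott_inv nb = 1%:M /\ bott_inv nb *m bott = 1%:M.
Proof.
move=> n1 n2; have [[pp' pq pq' p'q p'q'] [qq' ph p'h qh q'h]] := bott_comm_pq.
have nC y : GRing.comm y bh -> GRing.comm y nb.
  move=> yh; apply: (comm_inverse n1 n2).
  by apply: commrD; [exact: commr1|apply: commrM].
have [np np' nq nq'] : [/\ GRing.comm bp nb, GRing.comm bp' nb, GRing.comm bq nb &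
  GRing.comm bq' nb] by split; exact: nC.
have E : 1%:M = mx2 1 0 0 1 :> 'M[V]_2.
  apply/matrixP => i j; rewrite !mxE -val_eqE /=.
  by case: i j => -[|[|//]] ? [[|[|//]] ?].
rewrite E /bott /bott_inv !mx2_mul; split; congr mx2; rewrite ?mulNr ?mulrN ?mulrA.
- by rewrite -mulrBl bott_det.
- by rewrite pq addNr.
- by rewrite p'q' subrr.
- by rewrite -qq' -pp' addrC -mulrBl bott_det.
- by rewrite -!(mulrA _ nb) -np -nq' !mulrA -pp' -mulrBl bott_det.
- by rewrite -!(mulrA _ nb) -nq -np' !mulrA p'q subrr.
- by rewrite -!(mulrA _ nb) -np -nq' !mulrA pq' addNr.
- by rewrite -!(mulrA _ nb) -nq -np' !mulrA -qq' addrC -mulrBl bott_det.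
Qed.

End BottElement.

(* With theta_k the angles whose cosine and sine are c k and s k, and the
   angles depending on parameters t_j through the matrix m = d theta_k / d t_j,
   this is the density of the pulled back volume form of S^3. *)
Lemma bott_density (K : comPzRingType) (J nb : K) (c s : 'I_3 -> K) (m : 'M[K]_3) :
  J * J = -1 -> (forall k, c k * c k + s k * s k = 1) ->
  (1 + bh c s * bh c s) * nb = 1 ->
  let w j := bott_inv J c s nb *m
    bott_der J c s (fun k => - (m k j * s k)) (fun k => m k j * c k) in
  \tr (w o0 *m (w o1 *m w o2 - w o2 *m w o1)) =
  4 * \det m * (nb * nb * (s o2 * s o2 *
    (c o0 * c o0 * (s o1 * s o1) + s o0 * s o0))).
Proof.
move=> J2 cs1 hnb w.
set W := fun j => bott_der J c s (fun k => - (m k j * s k)) (fun k => m k j * c k) in w *.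
have wE j : w j = nb *: (mx2 (bp' J c s) (- bq J c s) (- bq' J c s) (bp J c s) *m W j).
  rewrite /w scalemxAl; congr (_ *m _); apply/matrixP => i k; rewrite !mxE.
  by rewrite [nb * _]mulrC; case: ifP => _; case: ifP.
rewrite !wE; do 2! rewrite -?scalemxAl -?scalemxAr -?scalerBr.
rewrite !mxtraceZ /W /bott_der /= tr_triple.
set D := (X in - _ * X).
have DE : D = 4 * (J * J) * \det m * (s o2 * s o2 * ((c o2 * c o2 + s o2 * s o2) *
    (c o0 * c o0 * (s o1 * s o1) + s o0 * s o0 * (c o1 * c o1 + s o1 * s o1)))).
  by rewrite /D det_mx33 /bp /bp' /bq /bq'; ring.
rewrite (bott_det _ J2 _ _ _ cs1); try by move=> *; exact: mulrC.
rewrite DE !cs1 J2 mul1r mulr1.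
set F := s o2 * s o2 * _; set h := bh c s in hnb *.
transitivity ((1 + h * h) * nb * (4 * \det m * (nb * nb * F))); first ring.
by rewrite hnb mul1r.
Qed.

Section CosSin.
Variables (R : realType) (A : cstarAlgType R) (U : 'I_3 -> A).
Local Notation C := R[i].
Local Notation I := ('i%C : C).

Definition chalf : C := 2^-1.
Definition chalf_i : C := - I * chalf.

Definition cosA k : A := chalf *: (U k + star (U k)).
Definition sinA k : A := chalf_i *: (U k - star (U k)).
Definition imA : A := I%:A.

Hypothesis UU : forall k, star (U k) * U k = 1 /\ U k * star (U k) = 1.
Hypothesis UC : forall k l, GRing.comm (U k) (U l).
Hypothesis USC : forall k l, GRing.comm (U k) (star (U l)).

Lemma conjc_chalf : conjc chalf = chalf.
Proof. by rewrite /chalf -(rmorph_nat (real_complex R)) -fmorphV conjc_real. Qed.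

Lemma conjc_chalf_i : conjc chalf_i = - chalf_i.
Proof.
have -> : conjc chalf_i = conjc (- I) * conjc chalf by exact: rmorphM.
rewrite conjc_chalf /chalf_i -mulNr; congr (_ * _).
by apply/eqP; rewrite eq_complex /= !oppr0 !eqxx.
Qed.

Lemma I2 : I * I = -1.
Proof. by rewrite -expr2 sqr_i. Qed.

Lemma normc_chalf : Normc.normc chalf = 2^-1.
Proof. by rewrite Normc.normcV normc_nat. Qed.

Lemma normc_chalf_i : Normc.normc chalf_i = 2^-1.
Proof.
rewrite Normc.normcM normc_chalf normcN.
have -> : Normc.normc I = 1 by rewrite /= expr0n add0r expr1n sqrtr1.
by rewrite mul1r.
Qed.

Lemma imA_comm v : GRing.comm imA v.
Proof. by rewrite /GRing.comm /imA -scalerAl -scalerAr mul1r mulr1. Qed.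

Lemma imA2 : imA * imA = -1.
Proof. by rewrite /imA -scalerAl mul1r scalerA I2 scaleN1r. Qed.

Let commZ (z y : A) (c : C) : GRing.comm z y -> GRing.comm z (c *: y).
Proof. by move=> zy; rewrite /GRing.comm -scalerAr -scalerAl zy. Qed.

Lemma comm_cosA z k : GRing.comm z (U k) -> GRing.comm z (star (U k)) ->
  GRing.comm z (cosA k).
Proof. by move=> zu zs; apply/commZ/commrD. Qed.

Lemma comm_sinA z k : GRing.comm z (U k) -> GRing.comm z (star (U k)) ->
  GRing.comm z (sinA k).
Proof. by move=> zu zs; apply/commZ/commrB. Qed.

Let SSC k l : GRing.comm (star (U k)) (star (U l)).
Proof. by rewrite /GRing.comm -!starM UC. Qed.

Let cosU k l : GRing.comm (cosA k) (U l).
Proof. by apply/commr_sym/comm_cosA; [exact: UC|exact: USC]. Qed.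
Let cosS k l : GRing.comm (cosA k) (star (U l)).
Proof. by apply/commr_sym/comm_cosA; [exact/commr_sym/USC|exact: SSC]. Qed.
Let sinU k l : GRing.comm (sinA k) (U l).
Proof. by apply/commr_sym/comm_sinA; [exact: UC|exact: USC]. Qed.
Let sinS k l : GRing.comm (sinA k) (star (U l)).
Proof. by apply/commr_sym/comm_sinA; [exact/commr_sym/USC|exact: SSC]. Qed.

Lemma cos_cosC k l : GRing.comm (cosA k) (cosA l).
Proof. exact: comm_cosA. Qed.
Lemma cos_sinC k l : GRing.comm (cosA k) (sinA l).
Proof. exact: comm_sinA. Qed.
Lemma sin_sinC k l : GRing.comm (sinA k) (sinA l).
Proof. exact: comm_sinA. Qed.

Lemma cos_sin1 k : cosA k * cosA k + sinA k * sinA k = 1.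
Proof.
have [VU UV] := UU k; rewrite /cosA /sinA; set u := U k; set v := star u.
rewrite -!scalerAl -!scalerAr !scalerA.
have -> : chalf_i * chalf_i = - (chalf * chalf).
  by rewrite /chalf_i mulrACA mulNr mulrN opprK I2 mulN1r.
rewrite scaleNr -scalerBr.
have -> : (u + v) * (u + v) - (u - v) * (u - v) = (4 : C) *: 1.
  have -> : (u + v) * (u + v) = (u * u + v * v) + (1 + 1).
    by rewrite mulrDl !mulrDr VU UV [1 + v * v]addrC addrACA.
  have -> : (u - v) * (u - v) = (u * u + v * v) - (1 + 1).
    by rewrite mulrBl !mulrBr VU UV opprB addrACA -opprD.
  rewrite opprD opprK addrACA subrr add0r scaler_nat.
  by rewrite !mulrS mulr0n addr0 !addrA.
rewrite scalerA; have -> : chalf * chalf * 4 = 1 by rewrite /chalf; field.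
exact: scale1r.
Qed.

Lemma star_cosA k : star (cosA k) = cosA k.
Proof. by rewrite /cosA starZ conjc_chalf starD starK addrC. Qed.

Lemma star_sinA k : star (sinA k) = sinA k.
Proof.
by rewrite /sinA starZ conjc_chalf_i starD starN starK scaleNr -scalerN opprB addrC.
Qed.

Let normU k : cnorm (U k) = 1.
Proof. by apply: unitary_cnorm; case: (UU k). Qed.

Lemma cnorm_cosA k : cnorm (cosA k) <= 1.
Proof.
rewrite /cosA cnormZ normc_chalf ler_pdivrMl// mulr1.
by rewrite (le_trans (cnormD _ _))// cnorm_star normU.
Qed.

Lemma cnorm_sinA k : cnorm (sinA k) <= 1.
Proof.
rewrite /sinA cnormZ normc_chalf_i ler_pdivrMl// mulr1.
by rewrite (le_trans (cnormD _ _))// cnormN cnorm_star normU.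
Qed.

Lemma star_bh : star (bh cosA sinA) = bh cosA sinA.
Proof.
rewrite /bh !starM !star_cosA star_sinA -(cos_cosC o0 o1).
by apply: commr_sym; apply: commrM; apply: commr_sym; exact: cos_sinC.
Qed.

Lemma cnorm_bh : cnorm (bh cosA sinA) <= 1.
Proof.
rewrite (le_trans (cnormM _ _))// mulr_ile1 ?cnorm_ge0 ?cnorm_sinA//.
by rewrite (le_trans (cnormM _ _))// mulr_ile1 ?cnorm_ge0 ?cnorm_cosA.
Qed.

End CosSin.

(* 1 + h^2 = (1 + ih)(1 - ih), and |1 - ih|^2 = |1 + h^2| <= 2 makes
   1 + ih = 2 - (1 - ih) invertible by the Neumann series. *)
Lemma one_plus_sqr_invertible (R : realType) (A : cstarAlgType R) (h : A) :
  star h = h -> cnorm h <= 1 ->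
  exists nb, (1 + h * h) * nb = 1 /\ nb * (1 + h * h) = 1.
Proof.
move=> sh h1; pose J := imA A.
have JC v : J * v = v * J := imA_comm v.
have J2 : J * J = -1 := imA2 A.
have sJ : star J = - J.
  rewrite /J /imA starZ star1 -scaleNr; congr (_ *: _).
  by apply/eqP; rewrite eq_complex /= oppr0 !eqxx.
have fact : (1 + J * h) * (1 - J * h) = 1 + h * h.
  rewrite mulrDl !mulrBr !mul1r mulr1 addrA subrK mulrA -(mulrA J) -JC mulrA J2.
  by rewrite mulN1r mulNr opprK.
have fact' : (1 - J * h) * (1 + J * h) = 1 + h * h.
  rewrite mulrBl !mulrDr !mul1r mulr1 opprD addrA addrK mulrA -(mulrA J) -JC mulrA J2.
  by rewrite mulN1r mulNr opprK.
have sP : star (1 + J * h) = 1 - J * h by rewrite starD star1 starM sJ sh mulrN -JC.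
have n2 : cnorm (1 + h * h) <= 2.
  rewrite (le_trans (cnormD _ _))// cnorm1 -[2]/(1 + 1) lerD2l.
  by rewrite (le_trans (cnormM _ _))// mulr_ile1 ?cnorm_ge0.
have nP : cnorm (1 + J * h) <= 3 / 2.
  have : cnorm (1 + J * h) ^+ 2 <= 2 by rewrite -cstarE sP fact'.
  have := cnorm_ge0 (1 + J * h); nra.
have nM : cnorm (1 - J * h) <= 3 / 2 by rewrite -sP cnorm_star.
have inv y z : y = 2 *: (1 - (2^-1 : R)%:C%C *: z) -> cnorm z <= 3 / 2 ->
    exists w : A, y * w = 1 /\ w * y = 1.
  move=> -> nz; have lt1 : (3 / 4 : R) < 1 by lra.
  have [|w [w1 w2 _]] := neumann (cstar_complete_norm A) (x := (2^-1 : R)%:C%C *: z) lt1.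
    by rewrite cnormZR ger0_norm ?invr_ge0//; lra.
  exists ((2^-1 : R[i]) *: w); rewrite -!scalerAl -!scalerAr w1 w2 !scalerA.
  by rewrite mulfV ?mulVf ?pnatr_eq0// scale1r.
have two (z : A) : 1 + z = 2 *: (1 - (2^-1 : R)%:C%C *: (1 - z)).
  rewrite scalerBr scalerA.
  have -> : 2 * (2^-1 : R)%:C%C = 1 :> R[i].
    by rewrite fmorphV rmorph_nat mulfV// pnatr_eq0.
  by rewrite scale1r scaler_nat mulr2n opprB [z - 1]addrC addrA addrK.
have [w [w1 w2]] := inv _ _ (two (J * h)) nM.
have [v [v1 v2]] : exists v, (1 - J * h) * v = 1 /\ v * (1 - J * h) = 1.
  by apply: inv (two (- (J * h))) _; rewrite opprK.
exists (v * w); split.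
  by rewrite -fact -mulrA (mulrA (1 - J * h)) v1 mul1r.
by rewrite -fact -mulrA (mulrA w) w2 mul1r.
Qed.

Section CosSinFunctions.
Variable R : realType.
Local Notation C := R[i].
Local Notation I := ('i%C : C).
Local Notation X := 'cV[int]_3.
Local Notation X' := 'rV[int]_3.
Local Notation half := (chalf R).
Local Notation half_i := (chalf_i R).
Local Notation chi := (chi R).

Definition cosC (r : X') (x : X) : C := half * (chi r x + chi (- r) x).
Definition sinC (r : X') (x : X) : C := half_i * (chi r x - chi (- r) x).

Lemma cosC_trig r : cosC r =1 trig [:: (half, r); (half, - r)].
Proof. by move=> x; rewrite /trig !big_cons big_nil addr0 -mulrDr. Qed.

Lemma sinC_trig r : sinC r =1 trig [:: (half_i, r); (- half_i, - r)].
Proof. by move=> x; rewrite /trig !big_cons big_nil addr0 mulNr -mulrBr. Qed.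

Lemma apd_cosC j r : apd j (cosC r) (fun x => - ((r 0 j)%:~R * sinC r x)).
Proof.
apply: apd_eq (apd_trig j [:: (half, r); (half, - r)]) => x.
  by rewrite cosC_trig.
rewrite /trig !big_cons big_nil /= /sinC /chalf_i mxE rmorphN /=; ring.
Qed.

Lemma apd_sinC j r : apd j (sinC r) (fun x => (r 0 j)%:~R * cosC r x).
Proof.
apply: apd_eq (apd_trig j [:: (half_i, r); (- half_i, - r)]) => x.
  by rewrite sinC_trig.
rewrite /trig !big_cons big_nil /= /cosC /chalf_i mxE rmorphN /= addr0.
have E (a b c d : C) : I * a * (- I * b) * c + I * (- a) * (- (- I * b)) * d =
    - (I * I) * (a * (b * (c + d))) by ring.
by rewrite E I2 opprK mul1r.
Qed.

Lemma ap_cosC r : ap (cosC r).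
Proof. exact: apd_ap (apd_cosC o0 r). Qed.

Lemma ap_sinC r : ap (sinC r).
Proof. exact: apd_ap (apd_sinC o0 r). Qed.

Lemma cosC_comp r (M : 'M[int]_3) x : cosC r (M *m x) = cosC (r *m M) x.
Proof. by rewrite /cosC !chi_comp mulNmx. Qed.

Lemma sinC_comp r (M : 'M[int]_3) x : sinC r (M *m x) = sinC (r *m M) x.
Proof. by rewrite /sinC !chi_comp mulNmx. Qed.

Lemma chalf_i_sqr : half_i * half_i = - (half * half).
Proof. by rewrite /chalf_i mulrACA mulNr mulrN opprK I2 mulN1r. Qed.

Lemma cosC_real r x : cosC r x = (complex.Re (chi r x))%:C%C.
Proof.
rewrite /cosC -chi_conj addcJ mulrA /chalf mulVf ?mul1r//.
by rewrite pnatr_eq0.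
Qed.

Lemma sinC_real r x : sinC r x = (complex.Im (chi r x))%:C%C.
Proof.
rewrite /sinC -chi_conj subcJ /chalf_i /chalf.
set y := _%:C%C; have -> : - I * 2^-1 * (2%:R * y * I) = - (I * I) * y by field.
by rewrite I2 opprK mul1r.
Qed.

Lemma cosC_sinC1 r x : cosC r x * cosC r x + sinC r x * sinC r x = 1.
Proof.
rewrite /cosC /sinC mulrACA [half_i * _ * _]mulrACA chalf_i_sqr mulNr -mulrBr.
rewrite chiN; have := chi_neq0 R r x; rewrite /chalf; set a := chi r x => a0.
by field.
Qed.

Lemma rmean_cosC r : r != 0 -> rmean (cosC r) = 0.
Proof.
move=> r0; rewrite (funext (cosC_trig r)) rmean_trig /const_coef !big_cons big_nil /=.
by rewrite oppr_eq0 (negPf r0) raddf0.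
Qed.

Lemma rmean_cst c : rmean (fun=> c : C) = complex.Re c.
Proof.
have -> : (fun=> c : C) = trig [:: (c, 0)].
  by apply/funext => x; rewrite /trig big_seq1 chi0 mulr1.
by rewrite rmean_trig /const_coef big_cons big_nil eqxx addr0.
Qed.

Lemma rmean_sum (J : Type) (r : seq J) (F : J -> X -> C) : (forall i, ap (F i)) ->
  rmean (fun x => \sum_(i <- r) F i x) = \sum_(i <- r) rmean (F i).
Proof.
move=> h; elim: r => [|i r IH].
  rewrite big_nil; under eq_fun do rewrite big_nil.
  by rewrite rmean_cst raddf0.
rewrite big_cons -IH -rmeanD//; last exact: ap_sum.
by congr rmean; apply/funext => x; rewrite big_cons.
Qed.

Definition unit_row (k : 'I_3) : X' := delta_mx 0 k.

Lemma unit_row_mul k (M : 'M[int]_3) : unit_row k *m M = row k M.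
Proof. by rewrite /unit_row -rowE. Qed.

Definition cosX x k := cosC (unit_row k) x.
Definition sinX x k := sinC (unit_row k) x.
Definition hX x := bh (cosX x) (sinX x).

Definition volume (x : X) : C :=
  (1 + hX x * hX x)^-1 * (1 + hX x * hX x)^-1 * (sinX x o2 * sinX x o2 *
    (cosX x o0 * cosX x o0 * (sinX x o1 * sinX x o1) + sinX x o0 * sinX x o0)).

Lemma sin_sin_sqr x : 4 * (sinX x o0 * sinX x o2) ^+ 2 =
  1 - cosC (unit_row o0 + unit_row o0) x - cosC (unit_row o2 + unit_row o2) x +
  half * (cosC (unit_row o0 + unit_row o0 + (unit_row o2 + unit_row o2)) x +
     cosC (unit_row o0 + unit_row o0 - (unit_row o2 + unit_row o2)) x).
Proof.
have -> : sinX x o0 * sinX x o2 = - (half * half) *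
    ((chi (unit_row o0) x - chi (- unit_row o0) x) *
     (chi (unit_row o2) x - chi (- unit_row o2) x)).
  by rewrite -chalf_i_sqr /sinX /sinC; ring.
rewrite /cosC !(opprD, opprK, chiD, chiN) /chalf.
have a0 := chi_neq0 R (unit_row o0) x; have b0 := chi_neq0 R (unit_row o2) x.
move: a0 b0; set a := chi _ x; set b := chi _ x => a0 b0.
by field; rewrite a0 b0.
Qed.

Lemma rmean_sin_sin : rmean (fun x => 4 * (sinX x o0 * sinX x o2) ^+ 2) = 1.
Proof.
set r0 := unit_row o0 + unit_row o0; set r2 := unit_row o2 + unit_row o2.
have -> : (fun x => 4 * (sinX x o0 * sinX x o2) ^+ 2) = (fun x =>
    1 + ((- 1 : R)%:C%C * cosC r0 x + ((- 1 : R)%:C%C * cosC r2 x +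
    ((2^-1 : R)%:C%C * cosC (r0 + r2) x + (2^-1 : R)%:C%C * cosC (r0 - r2) x)))).
  apply/funext => x; rewrite sin_sin_sqr rmorphN1 fmorphV rmorph_nat !mulN1r.
  by rewrite /chalf mulrDr !addrA.
have hc r := ap_cosC r; have hz (c : R) r := apZ (c%:C%C) (hc r).
have n0 (k : 'I_3) (v : X') : v 0 k != 0 -> v != 0.
  by apply: contraNneq => ->; rewrite mxE.
have Z (c : R) r : r != 0 -> rmean (fun x => c%:C%C * cosC r x) = 0.
  by move=> r_neq0; rewrite rmeanZ ?rmean_cosC ?mulr0//; exact: hc.
have A4 := apD (hz 2^-1 (r0 + r2)) (hz 2^-1 (r0 - r2)).
have A3 := apD (hz (- 1) r2) A4; have A2 := apD (hz (- 1) r0) A3.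
rewrite (rmeanD (ap_cst 1) A2) (rmeanD (hz (- 1) r0) A3) (rmeanD (hz (- 1) r2) A4).
rewrite (rmeanD (hz 2^-1 (r0 + r2)) (hz 2^-1 (r0 - r2))) rmean_cst.
rewrite !Z ?addr0//.
- by apply: (n0 o0); rewrite !mxE.
- by apply: (n0 o0); rewrite !mxE.
- by apply: (n0 o2); rewrite !mxE.
- by apply: (n0 o0); rewrite !mxE.
Qed.

Lemma volume_ge x :
  0 <= complex.Re (volume x - (16^-1 : R)%:C%C * (4 * (sinX x o0 * sinX x o2) ^+ 2)).
Proof.
have r1 k : cosX x k = (complex.Re (chi (unit_row k) x))%:C%C := cosC_real _ _.
have r2 k : sinX x k = (complex.Im (chi (unit_row k) x))%:C%C := sinC_real _ _.
have cs k := cosC_sinC1 (unit_row k) x.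
move: (cs o0) (cs o1) (cs o2); rewrite -!/(cosX _ _) -!/(sinX _ _).
rewrite /volume /hX /bh !r1 !r2.
move: (complex.Re (chi (unit_row o0) x)) (complex.Re (chi (unit_row o1) x)).
move: (complex.Re (chi (unit_row o2) x)) (complex.Im (chi (unit_row o0) x)).
move: (complex.Im (chi (unit_row o1) x)) (complex.Im (chi (unit_row o2) x)).
move=> s1 s2 c2 s0 c0 c1.
rewrite -[1]/((1 : R)%:C)%C -[4](rmorph_nat (real_complex R)).
rewrite -!(rmorphM, rmorphD, rmorphXn, fmorphV) -rmorphB /=.
move=> /complexI e0 /complexI e1 /complexI e2.
set N := 1 + _; set S := s2 * s2 * _.
have h0 : 0 <= (s2 * (c0 * c1)) * (s2 * (c0 * c1)) by rewrite -expr2 sqr_ge0.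
have N1 : 1 <= N by rewrite lerDl.
have q0 : 0 <= s0 * s0 by rewrite -expr2 sqr_ge0.
have q1 : 0 <= s1 * s1 by rewrite -expr2 sqr_ge0.
have q2 : 0 <= s2 * s2 by rewrite -expr2 sqr_ge0.
have p0 : 0 <= c0 * c0 by rewrite -expr2 sqr_ge0.
have p1 : 0 <= c1 * c1 by rewrite -expr2 sqr_ge0.
have p2 : 0 <= c2 * c2 by rewrite -expr2 sqr_ge0.
have N2 : N <= 2.
  have -> : N = 1 + (s2 * s2) * ((c0 * c0) * (c1 * c1)) by rewrite /N; ring.
  have : (s2 * s2) * ((c0 * c0) * (c1 * c1)) <= 1.
    have k0 : c0 * c0 <= 1 by rewrite -e0 lerDl.
    have k1 : c1 * c1 <= 1 by rewrite -e1 lerDl.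
    have k2 : s2 * s2 <= 1 by rewrite -e2 lerDr.
    by apply: mulr_ile1 => //; [exact: mulr_ge0|exact: mulr_ile1].
  lra.
have N0 : 0 < N by lra.
have NN : 4^-1 <= N^-1 * N^-1.
  by rewrite -invfM lef_pV2 ?posrE ?mulr_gt0//; nra.
have Sge : s2 * s2 * (s0 * s0) <= S.
  by rewrite /S ler_wpM2l// lerDr mulr_ge0.
have S0 : 0 <= s2 * s2 * (s0 * s0) by rewrite mulr_ge0.
have : 4^-1 * (s2 * s2 * (s0 * s0)) <= N^-1 * N^-1 * S by rewrite ler_pM ?invr_ge0.
rewrite subr_ge0; apply: le_trans.
have h16 : 16^-1 * 4 = 4^-1 :> R by lra.
by rewrite mulrA h16 expr2 mulrACA [X in _ * X <= _]mulrC.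
Qed.

End CosSinFunctions.

Section DiagonalElements.
Variables (R : realType) (q : nat).
Local Notation C := R[i].
Local Notation n := q.+1.
Local Notation X := 'cV[int]_3.
Local Notation B := (apmx R q).
Implicit Types (a b : B) (f g : 'I_n -> X -> C).

Definition is_diag a f : Prop := forall x, a x = diag_mx (\row_i f i x).

Lemma is_diagD a b f g : is_diag a f -> is_diag b g -> is_diag (a + b) (fun i x => f i x + g i x).
Proof.
move=> ha hb x; rewrite apmxDE ha hb -raddfD; congr diag_mx.
by apply/rowP => i; rewrite !mxE.
Qed.

Lemma is_diagN a f : is_diag a f -> is_diag (- a) (fun i x => - f i x).
Proof.
move=> ha x; rewrite apmxNE ha -raddfN; congr diag_mx.
by apply/rowP => i; rewrite !mxE.
Qed.

Lemma is_diagB a b f g : is_diag a f -> is_diag b g -> is_diag (a - b) (fun i x => f i x - g i x).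
Proof. by move=> ha hb; apply: is_diagD => //; exact: is_diagN. Qed.

Lemma is_diagM a b f g : is_diag a f -> is_diag b g -> is_diag (a * b) (fun i x => f i x * g i x).
Proof.
move=> ha hb x; rewrite apmxME ha hb mulmx_diag; congr diag_mx.
by apply/rowP => i; rewrite !mxE.
Qed.

Lemma is_diagZ (c : C) a f : is_diag a f -> is_diag (c *: a) (fun i x => c * f i x).
Proof.
move=> ha x; rewrite apmxZE ha -linearZ; congr diag_mx.
by apply/rowP => i; rewrite !mxE.
Qed.

Lemma is_diag1 : is_diag 1 (fun _ _ => 1).
Proof.
move=> x; rewrite apmx1E; apply/matrixP => i j; rewrite !mxE.
by case: eqP.
Qed.

Lemma is_diag_star a f : is_diag a f -> is_diag (star a) (fun i x => conjc (f i x)).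
Proof.
move=> ha x; have -> : star a x = adj (a x) by [].
rewrite ha; apply/matrixP => i j; rewrite !mxE eq_sym.
by have [->|_] := eqVneq i j; rewrite ?mulr1n ?mulr0n ?conjc0.
Qed.

Lemma is_diag_diag a f i x : is_diag a f -> a x i i = f i x.
Proof. by move=> ->; rewrite !mxE eqxx. Qed.

Lemma is_diag_inv a b f : is_diag a f -> a * b = 1 -> (forall i x, f i x != 0) ->
  is_diag b (fun i x => (f i x)^-1).
Proof.
move=> ha ab f0 x; apply/matrixP => i j.
have : (a x *m b x) i j = (i == j)%:R by rewrite -apmxME ab apmx1E mxE.
rewrite ha mul_diag_mx !mxE => E; apply: (mulfI (f0 i x)).
by rewrite E; have [_|_] := eqVneq i j; rewrite ?mulr1n ?mulr0n ?mulfV ?mulr0.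
Qed.

Lemma tr_is_diag a f : is_diag a f -> tr a = rmean (fun x => \sum_i f i x).
Proof.
move=> ha; congr rmean; apply/funext => x; apply: eq_bigr => i _.
exact: is_diag_diag.
Qed.

Lemma der_is_diag j a b f g : is_diag a f -> is_diag b g -> (forall i, apd j (f i) (g i)) ->
  der j a b.
Proof.
move=> ha hb h i k; have [->|ik] := eqVneq i k.
  by apply: apd_eq (h k) => x; rewrite ?ha ?hb !mxE eqxx mulr1n.
by apply: apd_eq (apd_cst j 0) => x; rewrite ?ha ?hb !mxE (negPf ik) mulr0n.
Qed.

Definition is_diagM2 (Z : 'M[B]_2) (z : 'I_n -> X -> 'M[C]_2) : Prop :=
  forall s t, is_diag (Z s t) (fun i x => z i x s t).

Lemma is_diagM2_mul Z Z' z z' : is_diagM2 Z z -> is_diagM2 Z' z' ->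
  is_diagM2 (Z *m Z') (fun i x => z i x *m z' i x).
Proof.
move=> hZ hZ' s t x; rewrite !mxE !big_ord_recl !big_ord0 !addr0.
rewrite (is_diagD (is_diagM (hZ _ _) (hZ' _ _)) (is_diagM (hZ _ _) (hZ' _ _))).
congr diag_mx; apply/rowP => i.
by rewrite !mxE !big_ord_recl big_ord0 addr0.
Qed.

Lemma is_diagM2_sub Z Z' z z' : is_diagM2 Z z -> is_diagM2 Z' z' ->
  is_diagM2 (Z - Z') (fun i x => z i x - z' i x).
Proof.
move=> hZ hZ' s t x; rewrite !mxE (is_diagB (hZ s t) (hZ' s t)).
by congr diag_mx; apply/rowP => i; rewrite !mxE.
Qed.

Lemma is_diagM2_mx2 a b c d f g f' g' : is_diag a f -> is_diag b g -> is_diag c f' -> is_diag d g' ->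
  is_diagM2 (mx2 a b c d) (fun i x => mx2 (f i x) (g i x) (f' i x) (g' i x)).
Proof.
move=> ha hb hc hd s t x; rewrite mxE.
case: ifP => s0; case: ifP => t0; rewrite ?ha ?hb ?hc ?hd;
  by congr diag_mx; apply/rowP => i; rewrite !mxE s0 t0.
Qed.

Lemma mxtr_is_diag Z z : is_diagM2 Z z -> mxtr Z = rmean (fun x => \sum_i \tr (z i x)).
Proof.
move=> hZ; rewrite /mxtr !big_ord_recl big_ord0 addr0.
rewrite -trD (tr_is_diag (is_diagD (hZ _ _) (hZ _ _))); congr rmean; apply/funext => x.
by apply: eq_bigr => i _; rewrite /mxtrace !big_ord_recl big_ord0 addr0.
Qed.

End DiagonalElements.

Section InducedCharacters.
Variables (R : realType) (q : nat).
Local Notation C := R[i].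
Local Notation I := ('i%C : C).
Local Notation n := q.+1.
Local Notation X := 'cV[int]_3.
Local Notation B := (apmx R q).
Variable M : 'I_n -> 'M[int]_3.
Variable U : 'I_3 -> B.
Hypothesis UE : forall k, is_diag (U k) (fun i x => chi R (row k (M i)) x).

Let c := cosA U.
Let s := sinA U.
Let J := imA B.

Lemma character_unitary k : star (U k) * U k = 1 /\ U k * star (U k) = 1.
Proof.
have hs := is_diag_star (UE k); have h1 := @is_diag1 R q.
have chiV r x : conjc (chi R r x) * chi R r x = 1.
  by rewrite chi_conj chiN mulVf// chi_neq0.
split; apply: apmx_eq => x; rewrite ?(is_diagM hs (UE k)) ?(is_diagM (UE k) hs) h1;
  congr diag_mx; apply/rowP => i; rewrite !mxE ?chiV//.
by rewrite mulrC chiV.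
Qed.

Lemma is_diag_comm (a b : B) f g : is_diag a f -> is_diag b g -> GRing.comm a b.
Proof.
move=> ha hb; apply: apmx_eq => x; rewrite (is_diagM ha hb) (is_diagM hb ha).
by congr diag_mx; apply/rowP => i; rewrite !mxE mulrC.
Qed.

Lemma is_diag_eq (a : B) f g : (forall i x, f i x = g i x) -> is_diag a f -> is_diag a g.
Proof.
by move=> fg ha x; rewrite ha; congr diag_mx; apply/rowP => i; rewrite !mxE fg.
Qed.

Lemma is_diag_cos k : is_diag (c k) (fun i x => cosX R (M i *m x) k).
Proof.
apply: is_diag_eq (is_diagZ (chalf R) (is_diagD (UE k) (is_diag_star (UE k)))) => i x.
by rewrite /cosX cosC_comp unit_row_mul chi_conj.
Qed.

Lemma is_diag_sin k : is_diag (s k) (fun i x => sinX R (M i *m x) k).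
Proof.
apply: is_diag_eq (is_diagZ (chalf_i R) (is_diagB (UE k) (is_diag_star (UE k)))) => i x.
by rewrite /sinX sinC_comp unit_row_mul chi_conj.
Qed.

Lemma is_diag_im : is_diag J (fun _ _ => I).
Proof.
by apply: is_diag_eq (is_diagZ I (@is_diag1 R q)) => i x; rewrite mulr1.
Qed.

Fact muP k j (i i' : 'I_n) :
  ap (fun x : X => (diag_mx (\row_i (M i k j)%:~R) : 'M[C]_n) i i').
Proof. exact: ap_cst. Qed.

(* The derivative in the direction j of the angle whose cosine is c k. *)
Definition angle_der k j : B := Apmx (muP k j).

Lemma is_diag_angle_der k j : is_diag (angle_der k j) (fun i _ => (M i k j)%:~R).
Proof. by []. Qed.

Lemma der_angle_der k j l : der l (angle_der k j) 0.
Proof. exact: (@der_cst _ _ (diag_mx (\row_i (M i k j)%:~R))). Qed.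

Lemma der_cos k j : der j (c k) (- (angle_der k j * s k)).
Proof.
apply: (der_is_diag (is_diag_cos k) (is_diagN (is_diagM (is_diag_angle_der k j) (is_diag_sin k)))) => i.
apply: apd_eq (apd_cosC j (row k (M i))) => x.
  by rewrite /cosX cosC_comp unit_row_mul.
by rewrite /sinX sinC_comp unit_row_mul mxE.
Qed.

Lemma der_sin k j : der j (s k) (angle_der k j * c k).
Proof.
apply: (der_is_diag (is_diag_sin k) (is_diagM (is_diag_angle_der k j) (is_diag_cos k))) => i.
apply: apd_eq (apd_sinC j (row k (M i))) => x.
  by rewrite /sinX sinC_comp unit_row_mul.
by rewrite /cosX cosC_comp unit_row_mul mxE.
Qed.

Let HD := @apmx_derivations R q.

Let muC k j l (a : B) : angle_der k j * (angle_der k l * a) = angle_der k l * (angle_der k j * a).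
Proof. by rewrite !mulrA (is_diag_comm (is_diag_angle_der k j) (is_diag_angle_der k l)). Qed.

Lemma smooth_cos k : smooth (@der R q) (c k) (fun j => - (angle_der k j * s k))
  (fun l j => - (angle_der k j * (angle_der k l * c k))).
Proof.
split=> [j|j l|j l]; [exact: der_cos| |by rewrite muC].
apply: derN; have := derM (der_angle_der k j l) (der_sin k l).
by rewrite mul0r add0r.
Qed.

Lemma smooth_sin k : smooth (@der R q) (s k) (fun j => angle_der k j * c k)
  (fun l j => - (angle_der k j * (angle_der k l * s k))).
Proof.
split=> [j|j l|j l]; [exact: der_sin| |by rewrite muC].
by have := derM (der_angle_der k j l) (der_cos k l); rewrite mul0r add0r mulrN.
Qed.

Lemma smooth_mx2 (a b c' d : B) a1 b1 c1 d1 a2 b2 c2 d2 :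
  smooth (@der R q) a a1 a2 -> smooth (@der R q) b b1 b2 ->
  smooth (@der R q) c' c1 c2 -> smooth (@der R q) d d1 d2 ->
  smooth (@mxder R q 2) (mx2 a b c' d) (fun j => mx2 (a1 j) (b1 j) (c1 j) (d1 j))
    (fun l j => mx2 (a2 l j) (b2 l j) (c2 l j) (d2 l j)).
Proof.
move=> ha hb hc hd; apply: smooth_mx => i k; rewrite mxE.
case i0 : (i == 0 :> nat); case k0 : (k == 0 :> nat).
- by case: ha => h1 h2 h3; split=> [j|j l|j l]; rewrite !mxE i0 k0.
- by case: hb => h1 h2 h3; split=> [j|j l|j l]; rewrite !mxE i0 k0.
- by case: hc => h1 h2 h3; split=> [j|j l|j l]; rewrite !mxE i0 k0.
- by case: hd => h1 h2 h3; split=> [j|j l|j l]; rewrite !mxE i0 k0.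
Qed.

Let dc j k := - (angle_der k j * s k).
Let ds j k := angle_der k j * c k.

Lemma smooth_bott : exists p2, smooth (@mxder R q 2) (bott J c s)
  (fun j => bott_der J c s (dc j) (ds j)) p2.
Proof.
have derJ j : der j J 0 by apply: (@der_cst _ _ (I *: 1%:M)).
have sM p p1 p2 p' p1' p2' := @smoothM _ _ _ _ HD p p1 p2 p' p1' p2'.
have sJ p p1 p2 : smooth (@der R q) p p1 p2 -> _ := smooth_mul_cst HD derJ.
have x3 := sJ _ _ _ (sM _ _ _ _ _ _ (smooth_sin o2)
  (sM _ _ _ _ _ _ (smooth_sin o0) (smooth_sin o1))).
have x1 := sJ _ _ _ (sM _ _ _ _ _ _ (smooth_sin o2) (smooth_cos o0)).
have x2 := sM _ _ _ _ _ _ (smooth_sin o2) (smooth_cos o1).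
have := smooth_mx2 (smoothD HD (smooth_cos o2) x3) (smoothD HD x1 x2)
  (smoothB HD x1 x2) (smoothB HD (smooth_cos o2) x3).
by move=> h; eexists; exact: h.
Qed.

Lemma is_diag_bh : is_diag (bh c s) (fun i x => hX R (M i *m x)).
Proof. exact: is_diagM (is_diag_sin o2) (is_diagM (is_diag_cos o0) (is_diag_cos o1)). Qed.

Lemma one_plus_hX_neq0 x : 1 + hX R x * hX R x != 0.
Proof.
rewrite /hX /bh /cosX /sinX !cosC_real sinC_real -!rmorphM -[1]/((1 : R)%:C)%C.
rewrite -rmorphD fmorph_eq0 gt_eqF// ltr_pwDl//.
by rewrite -expr2 sqr_ge0.
Qed.

Lemma is_diag_nb nb : (1 + bh c s * bh c s) * nb = 1 ->
  is_diag nb (fun i x => (1 + hX R (M i *m x) * hX R (M i *m x))^-1).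
Proof.
move=> hnb; apply: is_diag_inv (is_diagD (@is_diag1 R q) (is_diagM is_diag_bh is_diag_bh)) hnb _.
by move=> i x; exact: one_plus_hX_neq0.
Qed.

Lemma chern_bott nb : (1 + bh c s * bh c s) * nb = 1 ->
  chern (@mxtr R q 2) (fun j => bott_inv J c s nb *m bott_der J c s (dc j) (ds j)) =
  rmean (fun x => \sum_i 4 * (\det (M i))%:~R * volume R (M i *m x)).
Proof.
move=> hnb; have nbE := is_diag_nb hnb.
pose cx i x := cosX R (M i *m x); pose sx i x := sinX R (M i *m x).
pose nx i x := (1 + hX R (M i *m x) * hX R (M i *m x))^-1.
pose m i k j : C := (M i k j)%:~R.
pose z j i x := bott_inv I (cx i x) (sx i x) (nx i x) *m
  bott_der I (cx i x) (sx i x) (fun k => - (m i k j * sx i x k))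
    (fun k => m i k j * cx i x k).
have hz j : is_diagM2 (bott_inv J c s nb *m bott_der J c s (dc j) (ds j)) (z j).
  apply: is_diagM2_mul; apply: is_diagM2_mx2;
  repeat first [exact: is_diag_cos|exact: is_diag_sin|exact: is_diag_im|exact: nbE|
    exact: is_diag_angle_der|apply: is_diagM|apply: is_diagB|apply: is_diagD|apply: is_diagN].
rewrite /chern (mxtr_is_diag (is_diagM2_mul (hz o0) (is_diagM2_sub
  (is_diagM2_mul (hz o1) (hz o2)) (is_diagM2_mul (hz o2) (hz o1))))).
congr rmean; apply/funext => x; apply: eq_bigr => i _.
have zE j : z j i x = bott_inv I (cx i x) (sx i x) (nx i x) *m
  bott_der I (cx i x) (sx i x) (fun k => - (map_mx intr (M i) k j * sx i x k))
    (fun k => map_mx intr (M i) k j * cx i x k).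
  by rewrite /z; congr (_ *m bott_der _ _ _ _ _); apply/funext => k; rewrite mxE.
rewrite !zE bott_density ?I2//; last by rewrite /nx mulfV// one_plus_hX_neq0.
  by rewrite det_map_mx.
by move=> k; exact: cosC_sinC1.
Qed.

End InducedCharacters.

Section Volume.
Variable R : realType.
Local Notation C := R[i].
Local Notation X := 'cV[int]_3.

Lemma ap_volume : ap (volume R).
Proof.
have UP k (i j : 'I_1) : ap (fun x : X => (diag_mx (\row_(i < 1) chi R (row k 1%:M) x)) i j).
  apply: ap_eq (ap_chi (row k 1%:M)) => x.
  by rewrite !mxE !ord1 eqxx mulr1n.
pose U k : apmx R 0 := Apmx (UP k).
have UE k : is_diag (U k) (fun i x => chi R (row k ((fun=> 1%:M) i)) x) by [].
have UU := character_unitary UE; have hs k := is_diag_star (UE k).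
have UC k l : GRing.comm (U k) (U l) := is_diag_comm (UE k) (UE l).
have USC k l : GRing.comm (U k) (star (U l)) := is_diag_comm (UE k) (hs l).
have [nb [hnb _]] := one_plus_sqr_invertible (star_bh UC USC) (cnorm_bh UU).
have an : ap (fun x => (1 + hX R x * hX R x)^-1).
  apply: ap_eq (apP nb 0 0) => x; rewrite (is_diag_diag _ _ (is_diag_nb UE hnb)).
  by rewrite mul1mx.
have hc k := ap_cosC (R := R) (unit_row k); have hs' k := ap_sinC (R := R) (unit_row k).
by repeat first [exact: an|exact: (hc _)|exact: (hs' _)|apply: apM|apply: apD].
Qed.

Lemma rmean_volume_gt0 : 0 < rmean (volume R).
Proof.
pose f (x : X) := 4 * (sinX R x o0 * sinX R x o2) ^+ 2.
have hf : ap f.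
  have h k := ap_sinC (R := R) (unit_row k).
  apply: apZ; apply: ap_eq (apM (apM (h o0) (h o2)) (apM (h o0) (h o2))) => x.
  by rewrite expr2.
have f1 : rmean f = 1 := rmean_sin_sin R.
have hN := apN (apZ ((16^-1 : R)%:C%C) hf).
have := rmean_ge0 (apD ap_volume hN) (@volume_ge R).
rewrite (rmeanD ap_volume hN) (rmeanN (apZ _ hf)) (rmeanZ _ hf) f1 mulr1 subr_ge0.
by apply: lt_le_trans; rewrite invr_gt0.
Qed.

Lemma rmean_volume_sum n (M : 'I_n -> 'M[int]_3) :
  rmean (fun x => \sum_i 4 * (\det (M i))%:~R * volume R (M i *m x)) =
  4 * (\sum_i \det (M i))%:~R * rmean (volume R).
Proof.
have E i x : 4 * (\det (M i))%:~R * volume R (M i *m x) =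
    ((4 * (\det (M i))%:~R : R)%:C)%C * volume R (M i *m x).
  by rewrite rmorphM /= rmorph_nat rmorph_int.
have hv i := ap_comp (M i) ap_volume.
rewrite (rmean_sum _ (F := fun i x => 4 * (\det (M i))%:~R * volume R (M i *m x))).
  rewrite rmorph_sum mulr_sumr mulr_suml; apply: eq_bigr => i _ /=.
  under eq_fun do rewrite E.
  rewrite rmeanZ//; have [->|d0] := eqVneq (\det (M i)) 0.
    by rewrite mulr0 !mul0r.
  by rewrite rmean_comp//; exact: ap_volume.
by move=> i; apply: apZ.
Qed.

End Volume.

(** * Nontriviality of the Bott element in K_1 *)

Section Blocks.
Variables (R : realType) (q m k : nat).
Local Notation B := (apmx R q).

Lemma smooth_block (p : 'M[B]_m) p1 p2 : smooth (@mxder R q m) p p1 p2 ->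
  smooth (@mxder R q (m + k)) (block_mx p 0 0 1%:M)
    (fun j => block_mx (p1 j) 0 0 0) (fun l j => block_mx (p2 l j) 0 0 0).
Proof.
have D00 j : der j (0 : B) 0 by exact: (@der_cst _ _ 0).
have D10 j : der j (1 : B) 0 by exact: (@der_cst _ _ 1%:M).
move=> [h1 h2 h3]; split=> [j i l|j j' i l|j l]; last by rewrite h3.
- case: (split_ordP i) => i' ->; case: (split_ordP l) => l' ->;
    rewrite ?(block_mxEul, block_mxEur, block_mxEdl, block_mxEdr);
    [exact: h1|by rewrite !mxE|by rewrite !mxE|rewrite !mxE].
  by case: (i' == l').
- case: (split_ordP i) => i' ->; case: (split_ordP l) => l' ->;
    rewrite ?(block_mxEul, block_mxEur, block_mxEdl, block_mxEdr);
    [exact: h2|by rewrite !mxE|by rewrite !mxE|by rewrite !mxE].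
Qed.

Lemma mxtr_block (a : 'M[B]_m) : mxtr (block_mx a 0 0 0 : 'M_(m + k)) = mxtr a.
Proof.
rewrite /mxtr big_split_ord /= [X in _ + X]big1 ?addr0.
  by apply: eq_bigr => i _; rewrite block_mxEul.
by move=> i _; rewrite block_mxEdr mxE; exact: (@tr_der _ _ o0 0 0 (D0 (@apmx_derivations R q) o0)).
Qed.

Lemma chern_block (r : 'M[B]_m) (w : 'I_3 -> 'M[B]_m) :
  chern (@mxtr R q (m + k)) (fun j => block_mx r 0 0 1%:M *m block_mx (w j) 0 0 0) =
  chern (@mxtr R q m) (fun j => r *m w j).
Proof.
have E j : block_mx r 0 0 1%:M *m block_mx (w j) 0 0 0 =
    block_mx (r *m w j) 0 0 0 :> 'M[B]_(m + k).
  by rewrite mulmx_block !(mul0mx, mulmx0, addr0).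
rewrite /chern !E -!mulmxE !mulmx_block !(mul0mx, mulmx0, addr0).
by rewrite opp_block_mx add_block_mx !oppr0 !addr0 mulmx_block !(mul0mx, mulmx0, addr0) mxtr_block.
Qed.

End Blocks.

Lemma seq_pos_lower_bound (R : realType) (I : eqType) (s : seq I) (d : I -> R) :
  (forall i, 0 < d i) -> exists2 e, 0 < e & forall i, i \in s -> e <= d i.
Proof.
move=> d0; elim: s => [|i s [e e0 IH]]; first by exists 1.
exists (Num.min (d i) e); first by rewrite lt_min d0.
move=> j; rewrite inE => /orP[/eqP ->|/IH]; first by rewrite ge_min lexx.
by move=> le_ed; rewrite ge_min le_ed orbT.
Qed.

Lemma norm_continuousP (R : realType) (A : cstarAlgType R) (f : R -> A) :
  Defs.norm_continuous f -> forall t, 0 <= t <= 1 -> forall e : R, 0 < e ->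
  exists2 d : R, 0 < d & forall s, 0 <= s <= 1 -> `|s - t| < d -> cnorm (f s - f t) < e.
Proof.
move=> cf t t01 e e0; have t01' : t \in `[0, 1] by rewrite in_itv.
have /cvgrPdist_lt/(_ _ e0) := cf t t01'.
rewrite near_withinE => /nbhs_ballP[d d0 hd]; exists d => // s s01 sd.
have := hd s; rewrite /ball /= distrC sd => /(_ isT).
rewrite in_itv /= s01 => /(_ isT); rewrite sub0r normrN; apply: le_lt_trans.
exact: ler_norm.
Qed.

Lemma mx_continuousP (R : realType) (A : cstarAlgType R) m n (f : R -> 'M[A]_(m, n)) :
  mx_continuous f -> forall t, 0 <= t <= 1 -> forall e : R, 0 < e ->
  exists2 d : R, 0 < d & forall s, 0 <= s <= 1 -> `|s - t| < d -> mxnu (f s - f t) < e.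
Proof.
move=> cf t t01 e e0; have mn0 : 0 <= m%:R * n%:R :> R by rewrite mulr_ge0.
have e1 : 0 < e / (m%:R * n%:R + 1) by rewrite divr_gt0// ltr_wpDl.
have h (p : 'I_m * 'I_n) : exists d : R, 0 < d /\ forall s, 0 <= s <= 1 -> `|s - t| < d ->
    cnorm (f s p.1 p.2 - f t p.1 p.2) < e / (m%:R * n%:R + 1).
  by have [d d0 hd] := norm_continuousP (cf p.1 p.2) t01 e1; exists d.
have [d hd] := choice h.
have [d0 d00 hd0] := seq_pos_lower_bound (enum [set: 'I_m * 'I_n]) (fun p => (hd p).1).
exists d0 => // s s01 sd.
apply: le_lt_trans (_ : m%:R * n%:R * (e / (m%:R * n%:R + 1)) < e).
  apply: mxnu_le => i j; rewrite !mxE; apply: ltW; apply: (hd (i, j)).2 => //.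
  by apply: lt_le_trans sd (hd0 _ _); rewrite mem_enum inE.
rewrite mulrCA gtr_pMr// ltr_pdivrMr ?mul1r ?ltrDl//.
by rewrite ltr_wpDl.
Qed.

Lemma map_mx2 (V W : pzRingType) (pi : {rmorphism V -> W}) a b c d :
  map_mx pi (mx2 a b c d) = mx2 (pi a) (pi b) (pi c) (pi d).
Proof. by apply/matrixP => i j; rewrite !mxE; case: ifP => _; case: ifP. Qed.

Section Pushforward.
Variables (R : realType) (A B : cstarAlgType R) (pi : {lrmorphism A -> B}).
Hypothesis pi_star : {morph pi : x / star x >-> star x}.
Variable U : 'I_3 -> A.

Let V k := pi (U k).

Lemma pi_cosA k : pi (cosA U k) = cosA V k.
Proof. by rewrite /cosA linearZ /= rmorphD /= pi_star. Qed.

Lemma pi_sinA k : pi (sinA U k) = sinA V k.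
Proof. by rewrite /sinA linearZ /= rmorphB /= pi_star. Qed.

Lemma pi_imA : pi (imA A) = imA B.
Proof. by rewrite /imA linearZ /= rmorph1. Qed.

Lemma pi_bott : map_mx pi (bott (imA A) (cosA U) (sinA U)) =
  bott (imA B) (cosA V) (sinA V).
Proof.
rewrite /bott /bp /bq /bq' /bp' map_mx2.
rewrite !(rmorphD, rmorphB, rmorphM, rmorphN) /= pi_imA !(pi_cosA, pi_sinA).
reflexivity.
Qed.

Lemma pi_bott_inv nb : map_mx pi (bott_inv (imA A) (cosA U) (sinA U) nb) =
  bott_inv (imA B) (cosA V) (sinA V) (pi nb).
Proof.
rewrite /bott_inv /bott /bp /bq /bq' /bp' map_mx2.
rewrite !(rmorphD, rmorphB, rmorphM, rmorphN) /= pi_imA !(pi_cosA, pi_sinA).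
reflexivity.
Qed.

Lemma pi_bh : pi (bh (cosA U) (sinA U)) = bh (cosA V) (sinA V).
Proof. rewrite /bh !rmorphM /= !(pi_cosA, pi_sinA). reflexivity. Qed.

End Pushforward.

Lemma bott_path_obstruction (R : realType) (q p : nat) (A : cstarAlgType R)
    (pi : {lrmorphism A -> apmx R q}) (U : 'I_3 -> A) (M : 'I_q.+1 -> 'M[int]_3) nb :
  {morph pi : x / star x >-> star x} ->
  (forall k, is_diag (pi (U k)) (fun i x => chi R (row k (M i)) x)) ->
  (1 + bh (cosA U) (sinA U) * bh (cosA U) (sinA U)) * nb = 1 ->
  bott (imA A) (cosA U) (sinA U) *m bott_inv (imA A) (cosA U) (sinA U) nb = 1%:M ->
  bott_inv (imA A) (cosA U) (sinA U) nb *m bott (imA A) (cosA U) (sinA U) = 1%:M ->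
  gl_path (block_mx (bott (imA A) (cosA U) (sinA U)) 0 0 1%:M) (1%:M : 'M[A]_(2 + p)) ->
  \sum_i \det (M i) = 0.
Proof.
move=> pi_star UE hnb WWi WiW [f [f0 f1 cf fi]].
pose V k := pi (U k).
have [p2 hp2] := smooth_bott UE.
have sm := smooth_block p hp2.
have pnb : (1 + bh (cosA V) (sinA V) * bh (cosA V) (sinA V)) * pi nb = 1.
  have := congr1 pi hnb; rewrite rmorphM rmorphD rmorphM !rmorph1 /=.
  by rewrite (pi_bh pi_star).
have block1 : block_mx 1%:M 0 0 1%:M = 1%:M :> 'M[apmx R q]_(2 + p).
  by rewrite -scalar_mx_block.
have := congr1 (map_mx pi) WWi; have := congr1 (map_mx pi) WiW.
rewrite !map_mxM map_mx1 (pi_bott pi_star) (pi_bott_inv pi_star) => WiW' WWi'.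
pose W' := block_mx (bott_inv (imA (apmx R q)) (cosA V) (sinA V) (pi nb)) 0 0 1%:M : 'M_(2 + p).
have W'W : W' *m block_mx (bott (imA (apmx R q)) (cosA V) (sinA V)) 0 0 1%:M = 1%:M.
  by rewrite mulmx_block !(mul0mx, mulmx0, mulmx1, addr0, add0r) WiW' block1.
have WW' : block_mx (bott (imA (apmx R q)) (cosA V) (sinA V)) 0 0 1%:M *m W' = 1%:M.
  by rewrite mulmx_block !(mul0mx, mulmx0, mulmx1, addr0, add0r) WWi' block1.
have fpi t : 0 <= t <= 1 -> exists g, map_mx pi (f t) *m g = 1%:M /\ g *m map_mx pi (f t) = 1%:M.
  have ti : 0 <= t <= 1 -> t \in `[0, 1] by rewrite in_itv.
  by move=> /ti/fi[g [fg gf]]; exists (map_mx pi g); rewrite -!map_mxM fg gf map_mx1.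
have fc t : 0 <= t <= 1 -> forall e : R, 0 < e -> exists2 d : R, 0 < d &
    forall s, 0 <= s <= 1 -> `|s - t| < d ->
      mxnu (map_mx pi (f s) - map_mx pi (f t)) < e.
  move=> t01 e e0; have [d d0 hd] := mx_continuousP cf t01 e0.
  exists d => // s s01 sd; apply: le_lt_trans (hd s s01 sd); rewrite -map_mxB.
  apply: ler_sum => i _; apply: ler_sum => j _; rewrite mxE.
  exact: star_morphism_contractive.
have f0' : map_mx pi (f 0) = block_mx (bott (imA (apmx R q)) (cosA V) (sinA V)) 0 0 1%:M.
  by rewrite f0 map_block_mx !map_mx0 map_mx1 (pi_bott pi_star).
have f1' : map_mx pi (f 1) = 1%:M by rewrite f1 map_mx1.
have := chern_path (mx_complete_norm _ _) (mx_derivations R q (2 + p))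
  (mx_invariant_trace R q (2 + p)) (mx_reciprocals R q (2 + p))
  fpi fc f0' f1' sm WW' W'W.
rewrite chern_block (chern_bott UE pnb) rmean_volume_sum => /eqP.
rewrite !mulf_eq0 (gt_eqF (rmean_volume_gt0 R)) orbF pnatr_eq0/= intr_eq0.
by move/eqP.
Qed.

Section TranslationUnitaries.
Variables (R : realType) (d : nat) (g : intGL d) (A : cstarAlgType R).
Variables (u : semidirect g -> A) (Y : 'M[int]_(d, 3)).
Hypothesis hu : unitary_rep u.

Definition translations (k : 'I_3) : A := u (Semidirect (col k Y) 1%g).

Lemma translations_unitary k :
  star (translations k) * translations k = 1 /\
  translations k * star (translations k) = 1.
Proof. by case: hu => _ _; apply. Qed.

Lemma translations_comm k l : GRing.comm (translations k) (translations l).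
Proof.
case: hu => _ uM _; rewrite /GRing.comm /translations -!uM; congr u.
by congr Semidirect; rewrite /= !mul1mx addrC.
Qed.

Lemma translations_star_comm k l :
  GRing.comm (translations k) (star (translations l)).
Proof.
have [VU UV] := translations_unitary l.
by apply: comm_inverse UV VU _; exact: translations_comm.
Qed.

End TranslationUnitaries.

Theorem theorem1p1 (R : realType) (n : nat) (hn7 : (7 <= n)%N) (hodd : odd n)
    (hd : (n + 5 <= 2 * totient n)%N)
    (A : cstarAlgType R) (u : semidirect (cyclotomic_companion n) -> A)
    (hA : is_group_cstar u) :
  exists x : K1 A, x <> 0.
Proof.
have n_gt0 : (0 < n)%N by apply: leq_trans hn7.
have [hu univ] := hA.
have [q [gq gmin]] := companion_order n_gt0.
pose Y : 'M[int]_(totient n, 3) := \matrix_(i, k) (i == k :> nat)%:R.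
have YE i k : Y i k = (i == k :> nat)%:R by rewrite mxE.
have [P sum_neq0] := minor_sum_neq0 n_gt0 q hd YE.
have [pi [pi_star piE _]] := univ _ _ (rep_unitary R gq gmin P).
pose U := translations u Y.
have UU : forall k, _ := translations_unitary Y hu.
have UC : forall k l, _ := translations_comm Y hu.
have USC : forall k l, _ := translations_star_comm Y hu.
have [nb [nb1 nb2]] := one_plus_sqr_invertible (star_bh UC USC) (cnorm_bh UU).
have [WV VW] := bott_invE (@imA_comm R A) (imA2 A) (cos_cosC UC USC)
  (cos_sinC UC USC) (sin_sinC UC USC) (cos_sin1 UU) nb1 nb2.
have W_inv : mx_invertible (bott (imA A) (cosA U) (sinA U)) by eexists; split; [exact: WV|].
exists (K1_class (GLmx W_inv)) => /K1_classP/asboolP[N [/= N2 _]].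
move: N2 => /subnKC <-; rewrite mx_stab_block mx_stab1 ?leq_addr// => path.
pose M i := (P *m intGL_mx (cyclotomic_companion n ^+ i)%g *m Y)^T.
have UE k : is_diag (pi (U k)) (fun (i : 'I_q.+1) x => chi R (row k (M i)) x).
  move=> x; have -> : pi (U k) = rep R q P (Semidirect (col k Y) 1%g) := piE _.
  rewrite (rep_translation R gmin P); congr diag_mx; apply/rowP => i.
  rewrite !mxE /M -tr_col; congr (chi R _^T x).
  by apply/matrixP => a b; rewrite !mxE; apply: eq_bigr => l _; rewrite !mxE.
have := bott_path_obstruction pi_star UE nb1 WV VW path.
under eq_bigr do rewrite /M det_tr.
by move=> sum0; rewrite sum0 eqxx in sum_neq0.
Qed.
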